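(* Let $L>0$, let $P\in H^2(0,L)$ be real-valued with $P(x)\ge P^0>0$ on $[0,L]$ for some constant $P^0$, and let $\theta_1,\theta_2,\theta_3,\theta_4\in\mathbb R$. Let $\mathcal H=\{(w,v,\xi,\psi): w\in H^2(0,L),\ v\in H^1(0,L),\ \xi=v(L),\ \psi=v(0)\}$ with the natural inner product $\langle z_1,z_2\rangle=\langle w_1,w_2\rangle_{H^2}+\langle v_1,v_2\rangle_{H^1}+\xi_1\bar\xi_2+\psi_1\bar\psi_2$. Define $F[w,v]=\theta_1v(0)+\theta_2v'(0)+\theta_3w(0)+\theta_4w'(0)$ and the operator $A$ by $A(w,v,\xi,\psi)=(v,(Pw')',-w'(L),F[w,v])$ on the domain $$D(A)=\{(w,v,\xi,\psi): w\in H^3(0,L),\ v\in H^2(0,L),\ \xi=v(L),\ \psi=v(0),\ (Pw')'(L)=-w'(L),\ (Pw')'(0)=F[w,v]\}.$$ Suppose there are constants $a,b>0$ with $(a+b-1)^2<4ab$ such that $\theta_1=\theta_3/b-a$ and $\theta_2=\theta_4/b$, and suppose $\theta_1,\theta_3<0$ and $\theta_2,\theta_4>0$. Then $A$ is the infinitesimal generator of a $C_0$-semigroup of uniformly bounded operators $\{T(t)\}_{t\ge0}$ on $\mathcal H$.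
   Context: $\mathcal H$ is a complex Hilbert space, a closed subspace of $H^2(0,L)\times H^1(0,L)\times\mathbb C\times\mathbb C$. Prime denotes $d/dx$. This operator encodes the rescaled closed-loop gantry crane system $\partial_t^2 w=\partial_x(P\partial_x w)$, $\partial_t^2w(t,L)=-\partial_xw(t,L)$, $\partial_t^2w(t,0)=\theta_1 v(t,0)+\theta_2\partial_xv(t,0)+\theta_3w(t,0)+\theta_4\partial_xw(t,0)$ with $v=\partial_tw$. *)

(* Defs.v *)
From mathcomp Require Import all_boot all_order all_algebra.
From mathcomp Require Import all_classical all_reals all_analysis.
Import Order.TTheory GRing.Theory Num.Theory.
From mathcomp.real_closed Require Import complex.
Import numFieldNormedType.Exports.
Set Implicit Arguments. Unset Strict Implicit. Unset Printing Implicit Defensive.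
Local Open Scope classical_set_scope.
Local Open Scope ring_scope.
Local Open Scope complex_scope.

Section Crane.
Variable R : realType.
Let mu := @lebesgue_measure R.

Definition itv0 (L : R) : set R := `[0, L].

Definition L2r (L : R) (f : R -> R) : Prop :=
  measurable_fun (itv0 L) f /\
  (\int[mu]_(x in itv0 L) ((f x) ^+ 2)%:E < +oo)%E.

Definition prim (g : R -> R) (x : R) : R := Rintegral mu `[0, x] g.

(* g is a (weak) derivative of f on (0,L): f is absolutely continuous on
   [0,L] with f x = f 0 + \int_0^x g, and g in L^2(0,L). *)
Definition has_derivR (L : R) (f g : R -> R) : Prop :=
  L2r L g /\ forall x, 0 <= x <= L -> f x = f 0 + prim g x.

Definition contR (L : R) (f : R -> R) : Prop :=
  {within `[0, L], continuous f}.

(* chosen derivative: the continuous representative when it exists,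
   otherwise some weak derivative, otherwise 0 *)
Definition dR (L : R) (f : R -> R) : R -> R :=
  xget (xget (fun=> 0) (has_derivR L f))
       (fun g => has_derivR L f g /\ contR L g).

Definition H1R (L : R) (f : R -> R) : Prop := exists g, has_derivR L f g.
Definition H2R (L : R) (f : R -> R) : Prop := H1R L f /\ H1R L (dR L f).

Definition has_derivC (L : R) (f g : R -> R[i]) : Prop :=
  has_derivR L (fun x => Re (f x)) (fun x => Re (g x)) /\
  has_derivR L (fun x => Im (f x)) (fun x => Im (g x)).

Definition contC (L : R) (f : R -> R[i]) : Prop :=
  contR L (fun x => Re (f x)) /\ contR L (fun x => Im (f x)).

Definition dC (L : R) (f : R -> R[i]) : R -> R[i] :=
  xget (xget (fun=> 0) (has_derivC L f))
       (fun g => has_derivC L f g /\ contC L g).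

Definition H1C (L : R) (f : R -> R[i]) : Prop := exists g, has_derivC L f g.
Definition H2C (L : R) (f : R -> R[i]) : Prop := H1C L f /\ H1C L (dC L f).
Definition H3C (L : R) (f : R -> R[i]) : Prop := H2C L f /\ H1C L (dC L (dC L f)).

Definition cabs2 (z : R[i]) : R := Re z ^+ 2 + Im z ^+ 2.
Definition sqL2 (L : R) (f : R -> R[i]) : R :=
  Rintegral mu (itv0 L) (fun x => cabs2 (f x)).

Definition normH2sq (L : R) (w : R -> R[i]) : R :=
  sqL2 L w + sqL2 L (dC L w) + sqL2 L (dC L (dC L w)).
Definition normH1sq (L : R) (v : R -> R[i]) : R :=
  sqL2 L v + sqL2 L (dC L v).

Record state := St { sw : R -> R[i]; sv : R -> R[i]; sxi : R[i]; spsi : R[i] }.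

Definition sadd (z1 z2 : state) : state :=
  St (fun x => sw z1 x + sw z2 x) (fun x => sv z1 x + sv z2 x)
     (sxi z1 + sxi z2) (spsi z1 + spsi z2).
Definition sscale (c : R[i]) (z : state) : state :=
  St (fun x => c * sw z x) (fun x => c * sv z x) (c * sxi z) (c * spsi z).
Definition ssub (z1 z2 : state) : state := sadd z1 (sscale (-1) z2).

Definition inH (L : R) (z : state) : Prop :=
  [/\ H2C L (sw z), H1C L (sv z), sxi z = sv z L & spsi z = sv z 0].

Definition normH (L : R) (z : state) : R :=
  Num.sqrt (normH2sq L (sw z) + normH1sq L (sv z)
            + cabs2 (sxi z) + cabs2 (spsi z)).

(* equality of elements of H (continuous representatives on [0,L]) *)
Definition eqH (L : R) (z1 z2 : state) : Prop :=
  [/\ forall x, 0 <= x <= L -> sw z1 x = sw z2 x,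
      forall x, 0 <= x <= L -> sv z1 x = sv z2 x,
      sxi z1 = sxi z2 & spsi z1 = spsi z2].

Definition Fb (L th1 th2 th3 th4 : R) (w v : R -> R[i]) : R[i] :=
  th1%:C * v 0 + th2%:C * dC L v 0 + th3%:C * w 0 + th4%:C * dC L w 0.

(* (P w')' = P' w' + P w'' *)
Definition flux (L : R) (P : R -> R) (w : R -> R[i]) (x : R) : R[i] :=
  (dR L P x)%:C * dC L w x + (P x)%:C * dC L (dC L w) x.

Definition opA (L : R) (P : R -> R) (th1 th2 th3 th4 : R) (z : state) : state :=
  St (sv z) (flux L P (sw z)) (- dC L (sw z) L)
     (Fb L th1 th2 th3 th4 (sw z) (sv z)).

Definition inDA (L : R) (P : R -> R) (th1 th2 th3 th4 : R) (z : state) : Prop :=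
  [/\ H3C L (sw z), H2C L (sv z), sxi z = sv z L, spsi z = sv z 0 &
      flux L P (sw z) L = - dC L (sw z) L /\
      flux L P (sw z) 0 = Fb L th1 th2 th3 th4 (sw z) (sv z)].

Definition dquot (T : R -> state -> state) (z : state) (h : R) : state :=
  sscale (h^-1)%:C (ssub (T h z) z).

Definition generates_ub_C0_semigroup (L : R) (DA : state -> Prop)
    (opA0 : state -> state) (T : R -> state -> state) : Prop :=
      (forall t z, 0 <= t -> inH L z -> inH L (T t z)) /\
      (forall t z1 z2, 0 <= t -> inH L z1 -> inH L z2 -> eqH L z1 z2 ->
          eqH L (T t z1) (T t z2)) /\
      (forall t c z1 z2, 0 <= t -> inH L z1 -> inH L z2 ->
          eqH L (T t (sadd (sscale c z1) z2))
                (sadd (sscale c (T t z1)) (T t z2))) /\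
      (exists M : R, forall t z, 0 <= t -> inH L z ->
          normH L (T t z) <= M * normH L z) /\
      (forall z, inH L z -> eqH L (T 0 z) z) /\
      (forall t s z, 0 <= t -> 0 <= s -> inH L z ->
          eqH L (T (t + s) z) (T t (T s z))) /\
      (forall z, inH L z -> normH L (ssub (T h z) z) @[h --> 0^'+] --> 0) /\
      (forall z, inH L z ->
          ((exists y, inH L y /\
             normH L (ssub (dquot T z h) y) @[h --> 0^'+] --> 0) <-> DA z)) /\
      (forall z, DA z -> normH L (ssub (dquot T z h) (opA0 z)) @[h --> 0^'+] --> 0).

End Crane.

(* Main.v *)
(* Split the system into real and imaginary parts. For [w_tt = (P w_x)_x] put
   [u = v + b w]. The wave energy of [(u, u_t)], with suitable boundary terms, is a
   quadratic form on [H^2 x H^1]: integrating its cross terms by parts shows that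
   it is equivalent to the square of the natural norm, and because
   [th1 = th3 / b - a], [th2 = th4 / b] all boundary contributions to its time
   derivative cancel except a nonpositive one at [x = 0]. So [A] is dissipative for
   an equivalent inner product. For large [h], [I - h A] is onto: the equation is a
   linear second order boundary value problem, whose initial value version is
   solved by a Picard iteration, and the two free initial data are then fixed by a
   2 x 2 linear system that is injective by dissipativity. Finally, a dissipative
   [A] with [I - h A] onto generates a contraction semigroup, obtained as the limit
   of the implicit Euler schemes with steps [2^-n]. *)

From HB Require Import structures.
Require Import Defs.
From mathcomp Require Import all_boot all_order all_algebra.
From mathcomp Require Import all_classical all_reals all_analysis.
From mathcomp Require Import measurable_realfun ring lra zify.
Import Order.TTheory GRing.Theory Num.Theory.
From mathcomp.real_closed Require Import complex.
Import numFieldNormedType.Exports.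
Set Implicit Arguments. Unset Strict Implicit. Unset Printing Implicit Defensive.
Local Open Scope classical_set_scope.
Local Open Scope ring_scope.

(** * Contractions in pseudo-metric spaces *)

(** The natural norm lies one derivative above the usual wave energy, which controls only [w'] and
    [v]. The energy of [u = v + b w] closes this gap: [u_x] contains [v'], and [u_t = (P w')' + b v]
    contains [w'']. The factor [b] is dictated by the boundary law at 0, which under the relations
    for [th1] and [th2] reads [v_t = (th3 u + th4 u_x) / b - a v]. Solved for [u_x(0)], it turns the
    power [- P(0) u_x(0) u_t(0)] into a negative multiple of [v_t^2 + a b v^2] plus exact time
    derivatives of multiples of [u(0)^2] and [v(0)^2], which are absorbed into the form. At [L],
    [u_t = b v - w'] has time derivative [- u_x], so a multiple of [u_t(L)^2] cancels the power
    there. Weak derivatives are determined only almost everywhere, while the boundary conditions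
    need point values. Hence the generator is first handled as a linear relation between functions,
    and continuity is used to identify its derivatives pointwise. Dyadic steps are convenient
    because only a step and its half ever have to be compared. *)

Lemma expr_small (R : realType) (k C e : R) : 0 <= k < 1 -> 0 < e ->
  exists n0, forall n, (n0 <= n)%N -> C * k ^+ n <= e.
Proof.
move=> /andP[k0 k1] e0.
have := @cvg_geometric R C k.
rewrite ger0_norm// => /(_ k1)/cvgr_dist_le/(_ e e0)[n0 _ H]; exists n0 => n n0n.
have := H n n0n; rewrite /geometric/= sub0r normrN.
by apply: le_trans; exact: ler_norm.
Qed.

Lemma half_pow_small (R : realType) (C e : R) : 0 < e ->
  exists n0, forall n, (n0 <= n)%N -> C * 2^-1 ^+ n <= e.
Proof. by apply: expr_small; lra. Qed.

Section PseudoMetric.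
Variables (R : realType) (T : Type) (d : T -> T -> R).

Definition dist_cvg (u : nat -> T) (l : T) : Prop :=
  forall e, 0 < e -> exists n0, forall n, (n0 <= n)%N -> d (u n) l <= e.

Definition dist_cauchy (u : nat -> T) : Prop :=
  forall e, 0 < e -> exists n0, forall m n, (n0 <= m)%N -> (n0 <= n)%N ->
    d (u m) (u n) <= e.

Definition dist_complete : Prop := forall u, dist_cauchy u -> exists l, dist_cvg u l.

Hypothesis d_ge0 : forall x y, 0 <= d x y.
Hypothesis d_xx : forall x, d x x = 0.
Hypothesis dC : forall x y, d x y = d y x.
Hypothesis d_tri : forall y x z, d x z <= d x y + d y z.

Lemma geometric_cauchy (k C : R) (u : nat -> T) : 0 <= k < 1 ->
  (forall n, d (u n) (u n.+1) <= C * k ^+ n) -> dist_cauchy u.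
Proof.
move=> /[dup] k01 /andP[k0 k1] H e e0.
have C0 : 0 <= C.
  by have := le_trans (d_ge0 _ _) (H 0%N); rewrite expr0 mulr1.
(* The exact partial sum is carried along: the cruder bound by [1 / (1 - k)] would not survive the
   induction on [m]. *)
have Hm n m : d (u n) (u (n + m)%N) <= C * k ^+ n * (1 - k ^+ m) / (1 - k).
  elim: m => [|m IH]; first by rewrite addn0 d_xx expr0 subrr mulr0 mul0r.
  apply: le_trans (d_tri (u (n + m)%N) _ _) _.
  rewrite addnS; apply: le_trans (lerD IH (H (n + m)%N)) _.
  rewrite le_eqVlt; apply/orP; left; apply/eqP; rewrite exprD exprS.
  by field; lra.
have [n0 Hn0] := @expr_small _ k (C / (1 - k)) (e / 2) k01 ltac:(lra).
have key n m : (n0 <= n)%N -> d (u n) (u (n + m)%N) <= e / 2.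
  move=> n0n; apply: le_trans (Hm n m) _; apply: le_trans _ (Hn0 n n0n).
  rewrite [leRHS]mulrAC ler_pM2r ?invr_gt0 ?subr_gt0//.
  rewrite ler_piMr ?mulr_ge0 ?exprn_ge0//.
  have := exprn_ge0 m k0; lra.
exists n0 => m n n0m n0n.
apply: le_trans (d_tri (u n0) _ _) _.
have h1 := key n0 (m - n0)%N (leqnn _); have h2 := key n0 (n - n0)%N (leqnn _).
rewrite subnKC// in h1; rewrite subnKC// in h2.
rewrite dC; lra.
Qed.

(** [d] is only a pseudo-metric, so a fixed point is a point at distance zero from its image; for
    the L2 distance this is equality almost everywhere. *)
Lemma contraction_fixpoint (k : R) (f : T -> T) : T -> 0 <= k < 1 ->
  dist_complete -> (forall x y, d (f x) (f y) <= k * d x y) ->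
  exists x, d (f x) x = 0.
Proof.
move=> x0 k01 cpl Hf; case/andP: (k01) => k0 k1.
pose u n := iter n f x0.
have H n : d (u n) (u n.+1) <= d x0 (f x0) * k ^+ n.
  elim: n => [|n IH]; first by rewrite expr0 mulr1.
  rewrite /u [in X in d X _]iterS [in X in d _ X]iterS.
  apply: le_trans (Hf _ _) _.
  by rewrite exprS mulrCA ler_wpM2l.
have [l Hl] := cpl u (geometric_cauchy k01 H).
exists l; apply/le_anti; rewrite d_ge0 andbT.
apply/ler_addgt0Pr => e e0; rewrite add0r.
have [n0 Hn0] := Hl (e / 2) ltac:(lra).
apply: le_trans (d_tri (f (u n0)) _ _) _.
have h1 := Hn0 n0 (leqnn _); have h2 := Hn0 n0.+1 (leqnSn _).
have h3 : d (f l) (f (u n0)) <= e / 2.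
  apply: le_trans (Hf _ _) _; rewrite dC; apply: le_trans _ h1.
  by rewrite ler_piMl// ltW.
rewrite /u iterS in h2; rewrite -/(u n0) in h2; lra.
Qed.

Lemma dist_cvg_unique u l l' : dist_cvg u l -> dist_cvg u l' -> d l l' = 0.
Proof.
move=> H H'; apply/le_anti; rewrite d_ge0 andbT.
apply/ler_addgt0Pr => e e0; rewrite add0r.
have [n0 Hn0] := H (e / 2) ltac:(lra).
have [n1 Hn1] := H' (e / 2) ltac:(lra).
apply: le_trans (d_tri (u (maxn n0 n1)) _ _) _.
have h1 := Hn0 _ (leq_maxl n0 n1); have h2 := Hn1 _ (leq_maxr n0 n1).
rewrite dC; lra.
Qed.

End PseudoMetric.

(** * Semigroups generated by dissipative relations on a Hilbert space *)

Lemma nat_case2 m k : (m <= k)%N -> (k < m.+2)%N -> k = m \/ k = m.+1.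
Proof. lia. Qed.

Section Hilbert.
Variables (R : realType) (V : lmodType R) (ip : V -> V -> R).
Hypothesis ipC : forall x y, ip x y = ip y x.
Hypothesis ipL : forall a x y z, ip (a *: x + y) z = a * ip x z + ip y z.
Hypothesis ip_ge0 : forall x, 0 <= ip x x.
Hypothesis ip_def : forall x, ip x x = 0 -> x = 0.

Definition ipnorm (x : V) : R := Num.sqrt (ip x x).

Lemma ip0l z : ip 0 z = 0.
Proof. by have := ipL (-1) 0 0 z; rewrite scaler0 addr0; lra. Qed.

Lemma ipDl x y z : ip (x + y) z = ip x z + ip y z.
Proof. by rewrite -[x in LHS]scale1r ipL mul1r. Qed.

Lemma ipZl a x z : ip (a *: x) z = a * ip x z.
Proof. by rewrite -[a *: x]addr0 ipL ip0l addr0. Qed.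

Lemma ipNl x z : ip (- x) z = - ip x z.
Proof. by rewrite -scaleN1r ipZl mulN1r. Qed.

Lemma ipBl x y z : ip (x - y) z = ip x z - ip y z.
Proof. by rewrite ipDl ipNl. Qed.

Lemma ipDr x y z : ip z (x + y) = ip z x + ip z y.
Proof. by rewrite ipC ipDl !(ipC z). Qed.

Lemma ipZr a x z : ip z (a *: x) = a * ip z x.
Proof. by rewrite ipC ipZl (ipC z). Qed.

Lemma ipBr x y z : ip z (x - y) = ip z x - ip z y.
Proof. by rewrite ipC ipBl !(ipC z). Qed.

Lemma ipnorm_ge0 x : 0 <= ipnorm x. Proof. exact: sqrtr_ge0. Qed.

Lemma ipnorm_sqr x : ipnorm x ^+ 2 = ip x x. Proof. by rewrite sqr_sqrtr. Qed.

Lemma ipnorm0 : ipnorm 0 = 0. Proof. by rewrite /ipnorm ip0l sqrtr0. Qed.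

Lemma ipnormZ a x : ipnorm (a *: x) = `|a| * ipnorm x.
Proof.
by rewrite /ipnorm ipZl ipZr mulrA -expr2 sqrtrM ?sqr_ge0// sqrtr_sqr.
Qed.

Lemma ipnormN x : ipnorm (- x) = ipnorm x.
Proof. by rewrite -scaleN1r ipnormZ normrN1 mul1r. Qed.

Lemma ipnormB x y : ipnorm (x - y) = ipnorm (y - x).
Proof. by rewrite -ipnormN opprB. Qed.

Lemma ipnorm_eq0 x : ipnorm x = 0 -> x = 0.
Proof. by move=> x0; apply: ip_def; rewrite -ipnorm_sqr x0 expr0n. Qed.

(** Cauchy-Schwarz, from the nonnegative square of [ipnorm y *: x - ipnorm x *: y]. *)
Lemma ip_le x y : ip x y <= ipnorm x * ipnorm y.
Proof.
have [/ipnorm_eq0 ->|x0] := eqVneq (ipnorm x) 0; first by rewrite ip0l ipnorm0 mul0r.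
have [/ipnorm_eq0 ->|y0] := eqVneq (ipnorm y) 0; first by rewrite ipC ip0l ipnorm0 mulr0.
have := ip_ge0 (ipnorm y *: x - ipnorm x *: y).
rewrite ipBl !ipBr !ipZl !ipZr -!ipnorm_sqr (ipC y x).
have X : 0 < ipnorm x by rewrite lt_def x0 ipnorm_ge0.
have Y : 0 < ipnorm y by rewrite lt_def y0 ipnorm_ge0.
have XY := mulr_gt0 X Y.
move=> H; rewrite -subr_ge0 -(pmulr_rge0 _ XY); nra.
Qed.

Lemma ipnormD x y : ipnorm (x + y) <= ipnorm x + ipnorm y.
Proof.
rewrite -(@ler_pXn2r _ 2) ?nnegrE ?addr_ge0 ?ipnorm_ge0//.
rewrite ipnorm_sqr ipDl !ipDr (ipC y x) sqrrD !ipnorm_sqr.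
have := ip_le x y; lra.
Qed.

Lemma ipnorm_tri y x z : ipnorm (x - z) <= ipnorm (x - y) + ipnorm (y - z).
Proof. by rewrite -[x - z](subrKA y); exact: ipnormD. Qed.

Let d x y := ipnorm (x - y).
Let d_ge0 x y : 0 <= d x y. Proof. exact: ipnorm_ge0. Qed.
Let d_xx x : d x x = 0. Proof. by rewrite /d subrr ipnorm0. Qed.
Let dC x y : d x y = d y x. Proof. exact: ipnormB. Qed.
Let d_tri y x z : d x z <= d x y + d y z. Proof. exact: ipnorm_tri. Qed.

Hypothesis cpl : dist_complete (fun x y => ipnorm (x - y)).

Notation cvgs := (dist_cvg (fun x y => ipnorm (x - y))).

Lemma cvgs_uniq u l l' : cvgs u l -> cvgs u l' -> l = l'.
Proof.
move=> H H'; apply: subr0_eq; apply: ipnorm_eq0.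
exact: (@dist_cvg_unique _ _ d d_ge0 dC d_tri u).
Qed.

Lemma cvgs_lin a u v l l' : cvgs u l -> cvgs v l' ->
  cvgs (fun n => a *: u n + v n) (a *: l + l').
Proof.
move=> H H' e e0.
have a1 : 0 < `|a| + 1 by rewrite ltr_wpDl.
have [n0 Hn0] := H (e / 2 / (`|a| + 1)) ltac:(by rewrite !divr_gt0).
have [n1 Hn1] := H' (e / 2) ltac:(lra).
exists (maxn n0 n1) => n; rewrite geq_max => /andP[/Hn0 h0 /Hn1 h1].
rewrite opprD addrACA -scalerBr; apply: le_trans (ipnormD _ _) _; rewrite ipnormZ.
rewrite ler_pdivlMr// in h0.
have := ipnorm_ge0 (u n - l); move: (normr_ge0 a); nra.
Qed.

Lemma cvgs_bound u l c B : cvgs u l -> (forall n, ipnorm (u n - c) <= B) ->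
  ipnorm (l - c) <= B.
Proof.
move=> H HB; apply/ler_addgt0Pr => e e0.
have [n0 Hn0] := H e e0.
apply: le_trans (ipnorm_tri (u n0) _ _) _.
by rewrite ipnormB addrC; apply: lerD; [exact: HB|exact: Hn0].
Qed.

(* [G x y] stands for [x \in D(A)] and [A x = y]. *)
Variable G : V -> V -> Prop.
Hypothesis G_lin : forall a x y x' y', G x y -> G x' y' ->
  G (a *: x + x') (a *: y + y').
Hypothesis G_diss : forall x y, G x y -> ip y x <= 0.
Hypothesis G_fun : forall y, G 0 y -> y = 0.
Hypothesis G_range : exists2 h0 : R, 0 < h0 &
  forall f, exists x, G x (h0^-1 *: (x - f)).

Lemma G00 : G 0 0.
Proof.
have [h0 _ /(_ 0)[x Gx]] := G_range.
by have := G_lin (-1) Gx Gx; rewrite !scaleN1r !addNr.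
Qed.

Lemma G_B x y x' y' : G x y -> G x' y' -> G (x - x') (y - y').
Proof.
by move=> H H'; have := G_lin (-1) H' H; rewrite !scaleN1r ![- _ + _]addrC.
Qed.

Lemma G_Z a x y : G x y -> G (a *: x) (a *: y).
Proof. by move=> H; have := G_lin a H G00; rewrite !addr0. Qed.

Lemma G_inj x y y' : G x y -> G x y' -> y = y'.
Proof.
move=> H H'; apply: subr0_eq; apply: G_fun.
by have := G_B H H'; rewrite subrr.
Qed.

(** The premise on [G] says [u - h A u = x]. Pairing with [u] and dropping the dissipative term
    leaves [|u|^2 <= <x, u>]. *)
Lemma resolvent_le h u x : 0 < h -> G u (h^-1 *: (u - x)) -> ipnorm u <= ipnorm x.
Proof.
move=> h0 /G_diss; rewrite ipZl pmulr_rle0 ?invr_gt0// ipBl -ipnorm_sqr.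
move=> H; have := ip_le x u; have := ipnorm_ge0 u; have := ipnorm_ge0 x.
by have [//|] := leP (ipnorm u) (ipnorm x); nra.
Qed.

Lemma resolvent_sub_le h u x v y : 0 < h -> G u (h^-1 *: (u - x)) ->
  G v (h^-1 *: (v - y)) -> ipnorm (u - v) <= ipnorm (x - y).
Proof.
move=> h0 H H'; apply: (resolvent_le h0).
by have := G_B H H'; rewrite -scalerBr opprD addrACA -opprD.
Qed.

Let surj h := forall f, exists x, G x (h^-1 *: (x - f)).

(* The resolvent at step [h] is a fixed point of a [|1 - h0/h|]-contraction. *)
Let surj_step h0 h : 0 < h0 -> h0 < h * 2 -> surj h0 -> surj h.
Proof.
move=> h00 hh S f; have h_gt0 : 0 < h by lra.
have [J0 HJ0] := choice S.
pose Phi x := J0 ((h0 / h) *: f + (1 - h0 / h) *: x).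
have k01 : 0 <= `|1 - h0 / h| < 1.
  rewrite normr_ge0/= ltr_norml; apply/andP; split.
    by rewrite ltrBrDl addrC -ltrBrDl; apply/(lt_le_trans (y := 2)) => //;
      rewrite ?ltr_pdivrMr//; lra.
  by rewrite ltrBlDr ltrDl divr_gt0.
have [x xE] : exists x, d (Phi x) x = 0.
  apply: (@contraction_fixpoint _ _ d d_ge0 d_xx dC d_tri _ _ 0 k01) => //.
  move=> x y; rewrite /d /Phi; apply: le_trans (resolvent_sub_le h00 (HJ0 _) (HJ0 _)) _.
  by rewrite opprD addrACA subrr add0r -scalerBr ipnormZ.
exists x; have {}xE : Phi x = x by apply: subr0_eq; apply: ipnorm_eq0.
have := HJ0 ((h0 / h) *: f + (1 - h0 / h) *: x).
rewrite -/(Phi x) xE; congr (G _ _).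
rewrite [_ *: f + _](_ : _ = x - (h0 / h) *: (x - f)); last first.
  by rewrite scalerBl scale1r scalerBr opprB addrCA.
rewrite opprB addrC subrK.
by rewrite scalerA; congr (_ *: _); field; rewrite !gt_eqF.
Qed.


(** One use of [surj_step] reaches every step size above half of a known one, so [n] uses reach
    everything above [h0 * 2^-n]. *)
Lemma resolvent_exists h : 0 < h -> surj h.
Proof.
have [h0 h00 S0] := G_range.
have H n : forall k : R, h0 * 2^-1 ^+ n < k -> surj k.
  elim: n => [|n IH] k.
    by rewrite expr0 mulr1 => hk; apply: (surj_step h00) => //; lra.
  rewrite exprS mulrCA => hk.
  have pn : 0 < h0 * 2^-1 ^+ n by rewrite mulr_gt0// exprn_gt0// invr_gt0.
  (* The midpoint of [h0 * 2^-n] and [2 * k]: above the first, for the induction hypothesis, and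
     below the second, for [surj_step]. *)
  apply: (@surj_step ((h0 * 2^-1 ^+ n + k * 2) / 2)); [lra|lra|].
  by apply: IH; lra.
move=> h_gt0; have [n0 Hn0] := half_pow_small h0 (e := h / 2) ltac:(lra).
by apply: (H n0); have := Hn0 n0 (leqnn _); lra.
Qed.

Definition resolvent h f : V := xget 0 [set x | G x (h^-1 *: (x - f))].
Local Notation J := resolvent.

Lemma resolventP h f : 0 < h -> G (J h f) (h^-1 *: (J h f - f)).
Proof.
move=> h0.
exact: (@xgetPex _ 0 [set x | G x (h^-1 *: (x - f))] (resolvent_exists h0 f)).
Qed.

Lemma resolvent_uniq h f x : 0 < h -> G x (h^-1 *: (x - f)) -> x = J h f.
Proof.
move=> h0 Gx; apply: subr0_eq; apply: ipnorm_eq0; apply/le_anti.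
rewrite ipnorm_ge0 andbT.
by have := resolvent_sub_le h0 Gx (resolventP f h0); rewrite subrr ipnorm0.
Qed.

Lemma resolvent_uniqE h x y : 0 < h -> G x y -> J h (x - h *: y) = x.
Proof.
move=> h0 Gxy; apply/esym/resolvent_uniq => //.
by rewrite opprB addrC subrK scalerA mulVf ?gt_eqF// scale1r.
Qed.

Lemma resolvent_lin h a x y : 0 < h -> J h (a *: x + y) = a *: J h x + J h y.
Proof.
move=> h0; apply/esym/resolvent_uniq => //.
have := G_lin a (resolventP x h0) (resolventP y h0).
by rewrite scalerA mulrC -scalerA -scalerDr scalerBr opprD addrACA.
Qed.

Lemma resolvent0 h : 0 < h -> J h 0 = 0.
Proof.
by move=> h0; apply/esym/resolvent_uniq; rewrite ?subrr ?scaler0//; exact: G00.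
Qed.

Lemma resolventB h x y : 0 < h -> J h (x - y) = J h x - J h y.
Proof.
by move=> h0; rewrite -scaleN1r addrC resolvent_lin// scaleN1r addrC.
Qed.

Lemma resolventZ h a x : 0 < h -> J h (a *: x) = a *: J h x.
Proof.
by move=> h0; have := resolvent_lin a x 0 h0; rewrite resolvent0// !addr0.
Qed.

Lemma resolvent_nm h x : 0 < h -> ipnorm (J h x) <= ipnorm x.
Proof. by move=> h0; apply: (resolvent_le h0); apply: resolventP. Qed.

Lemma resolvent_G h x y : 0 < h -> G x y -> G (J h x) (J h y).
Proof.
move=> h0 Gxy; have H := resolventP x h0.
suff <- : h^-1 *: (J h x - x) = J h y by [].
apply: resolvent_uniq => //.
have := G_Z h^-1 (G_B H Gxy).
by congr (G _ _).
Qed.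

Lemma resolvent_comm h k x : 0 < h -> 0 < k -> J h (J k x) = J k (J h x).
Proof.
move=> h0 k0; apply: resolvent_uniq => //.
by have := resolvent_G h0 (resolventP x k0); rewrite resolventZ// resolventB.
Qed.

(** Since [x = J h (x - h *: y)], the difference is [h *: J h y]. *)
Lemma resolvent_close h x y : 0 < h -> G x y -> ipnorm (J h x - x) <= h * ipnorm y.
Proof.
move=> h0 Gxy; rewrite -{2}(resolvent_uniqE h0 Gxy) -resolventB//.
rewrite opprB addrC subrK; apply: le_trans (resolvent_nm _ h0) _.
by rewrite ipnormZ gtr0_norm.
Qed.

(** With [a = J h x - x] and [b = J k x - x], dissipativity of the difference of the two resolvents
    reads [<a/h - b/k, a - b> <= 0], which forces [|b|^2 <= <a, b>]. So the distance from [x] to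
    [J h x] decreases with [h], and its squares control the mutual distances: a Cauchy property
    obtained without knowing that the domain is dense. *)
Lemma resolvent_mono h k x : 0 < k -> k < h ->
  ipnorm (J h x - J k x) ^+ 2 <= ipnorm (J h x - x) ^+ 2 - ipnorm (J k x - x) ^+ 2.
Proof.
move=> k0 kh; have h0 : 0 < h by lra.
move aE : (J h x - x) => a; move bE : (J k x - x) => b.
have ab : J h x - J k x = a - b by rewrite -aE -bE opprB addrA subrK.
have := G_diss (G_B (resolventP x h0) (resolventP x k0)).
rewrite aE bE ab (ipnorm_sqr (a - b)) !ipBl !ipZl !ipBr (ipC b a) -!ipnorm_sqr.
have := ip_ge0 (a - b); rewrite ipBl !ipBr (ipC b a) -!ipnorm_sqr.
move: (ipnorm a ^+ 2) (ipnorm b ^+ 2) (ip a b) => p q s H1 H2.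
have H3 : k * (p - s) + h * (q - s) <= 0.
  have hk : 0 < h * k by rewrite mulr_gt0.
  have := ler_wpM2l (ltW hk) H2; rewrite mulr0; congr (_ <= _).
  by field; rewrite !gt_eqF.
have : q <= s.
  suff : (h - k) * q <= (h - k) * s by rewrite ler_pM2l// subr_gt0.
  have := ler_wpM2l (ltW k0) H1; rewrite mulr0; lra.
lra.
Qed.

Definition dyadic n : R := 2^-1 ^+ n.
Local Notation hn := dyadic.
Let hn_gt0 n : 0 < hn n. Proof. by rewrite exprn_gt0// invr_gt0. Qed.
Let hnS n : hn n = 2 * hn n.+1. Proof. by rewrite /hn exprS; field. Qed.
Let hn_small C e : 0 < e -> exists n0, forall n, (n0 <= n)%N -> C * hn n <= e.
Proof. exact: half_pow_small. Qed.

Lemma resolvent_cauchy x :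
  dist_cauchy (fun x y => ipnorm (x - y)) (fun n => J (hn n) x).
Proof.
pose p n := ipnorm (J (hn n) x - x) ^+ 2.
have lt_hn m n : (m < n)%N -> hn n < hn m.
  by move=> mn; rewrite /hn ltr_iXn2l//; lra.
have H m n : (m <= n)%N -> ipnorm (J (hn m) x - J (hn n) x) ^+ 2 <= p m - p n.
  rewrite leq_eqVlt => /predU1P[->|mn]; first by rewrite !subrr ipnorm0 expr0n.
  by apply: resolvent_mono => //; exact: lt_hn.
have inf_p : has_inf (range p).
  split; first by exists (p 0%N), 0%N.
  by exists 0 => _ [n _ <-]; exact: sqr_ge0.
move=> e e0.
have e20 : 0 < (e / 2) ^+ 2 by rewrite exprn_gt0// divr_gt0.
have [_ [n0 _ <-] Hn0] := inf_adherent e20 inf_p.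
have key n : (n0 <= n)%N -> ipnorm (J (hn n0) x - J (hn n) x) <= e / 2.
  move=> n0n; rewrite -(@ler_pXn2r _ 2) ?nnegrE ?ipnorm_ge0//; last by lra.
  apply: le_trans (H _ _ n0n) _.
  have : inf (range p) <= p n by apply: ge_inf; [exact: inf_p.2|exists n].
  lra.
exists n0 => m n /key h1 /key h2.
apply: le_trans (ipnorm_tri (J (hn n0) x) _ _) _; rewrite ipnormB; lra.
Qed.

(* If [J h x -> l] then [J 1 (l - x) = 0] by commutation, hence [l = x]: the
   domain is dense. *)
Lemma resolvent_cvg x : cvgs (fun n => J (hn n) x) x.
Proof.
have [l Hl] := cpl (resolvent_cauchy x).
suff lx : l = x by move: Hl; rewrite lx.
have J1 : J 1 (l - x) = 0.
  rewrite resolventB//; apply: ipnorm_eq0; apply/le_anti; rewrite ipnorm_ge0 andbT.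
  apply/ler_addgt0Pr => e e0; rewrite add0r.
  have [n0 Hn0] := Hl (e / 2) ltac:(lra).
  pose y : V := 1^-1 *: (J 1 x - x).
  have [n1 Hn1] := @hn_small (ipnorm y) (e / 2) ltac:(lra).
  pose n := maxn n0 n1.
  apply: le_trans (ipnorm_tri (J 1 (J (hn n) x)) _ _) _.
  rewrite [X in _ + X](_ : _ = ipnorm (J (hn n) (J 1 x) - J 1 x)); last first.
    by rewrite resolvent_comm.
  have h2 := resolvent_close (hn_gt0 n) (resolventP x ltr01).
  rewrite -/y in h2.
  have h1 : ipnorm (J 1 l - J 1 (J (hn n) x)) <= e / 2.
    rewrite -resolventB//; apply: le_trans (resolvent_nm _ ltr01) _.
    by rewrite ipnormB; apply: Hn0; exact: leq_maxl.
  have := Hn1 n (leq_maxr _ _); lra.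
have := resolventP (l - x) ltr01; rewrite J1 sub0r invr1 scale1r => /G_fun/eqP.
by rewrite oppr_eq0 => /eqP/subr0_eq.
Qed.

Lemma dense_dom x e : 0 < e -> exists x' y', G x' y' /\ ipnorm (x - x') <= e.
Proof.
move=> e0; have [n0 /(_ n0 (leqnn _))] := @resolvent_cvg x e e0.
rewrite ipnormB => H; eexists; eexists; split; last exact: H.
exact: resolventP.
Qed.

(** Density of [D(A^2)], where the halving estimate applies: a resolvent of a point of [D(A)] lies
    in [D(A^2)]. *)
Lemma dense_dom2 x e : 0 < e ->
  exists x' y' z', [/\ G x' y', G y' z' & ipnorm (x - x') <= e].
Proof.
move=> e0; have e20 : 0 < e / 2 by lra.
have [x1 [y1 [G1 H1]]] := dense_dom x e20.
have [n0 /(_ n0 (leqnn _))] := @resolvent_cvg x1 (e / 2) e20.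
rewrite ipnormB => H2; exists (J (hn n0) x1), ((hn n0)^-1 *: (J (hn n0) x1 - x1)).
eexists; split; first exact: resolventP.
  by apply: G_Z; apply: G_B G1; exact: resolventP.
apply: le_trans (ipnorm_tri x1 _ _) _; lra.
Qed.

Lemma iter_lin k h a x y : 0 < h ->
  iter k (J h) (a *: x + y) = a *: iter k (J h) x + iter k (J h) y.
Proof. by move=> h0; elim: k => //= k ->; rewrite resolvent_lin. Qed.

Lemma iterB k h x y : 0 < h ->
  iter k (J h) (x - y) = iter k (J h) x - iter k (J h) y.
Proof. by move=> h0; elim: k => //= k ->; rewrite resolventB. Qed.

Lemma iter_nm k h x : 0 < h -> ipnorm (iter k (J h) x) <= ipnorm x.
Proof.
by move=> h0; elim: k => //= k; apply: le_trans; exact: resolvent_nm.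
Qed.

Lemma iter_G k h x y : 0 < h -> G x y -> G (iter k (J h) x) (iter k (J h) y).
Proof. by move=> h0 Gxy; elim: k => //= k; exact: resolvent_G. Qed.

Lemma iter_close k h x y : 0 < h -> G x y ->
  ipnorm (iter k (J h) x - x) <= k%:R * h * ipnorm y.
Proof.
move=> h0 Gxy; elim: k => [|k IH]; first by rewrite subrr ipnorm0 !mul0r.
rewrite iterS; apply: le_trans (ipnorm_tri (J h x) _ _) _.
rewrite -resolventB// -(natr1 k).
have := resolvent_nm (iter k (J h) x - x) h0.
have := resolvent_close h0 Gxy; lra.
Qed.

(* [J_(2h) - J_h^2 = h^2 J_(2h) J_h^2 A^2]. *)
Lemma resolvent_halve h x y z : 0 < h -> G x y -> G y z ->
  ipnorm (J (2 * h) x - J h (J h x)) <= h ^+ 2 * ipnorm z.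
Proof.
move=> h0 Gxy Gyz; have hh : 0 < 2 * h by lra.
pose u := J (2 * h) x; pose u1 := J (2 * h) y; pose u2 := J (2 * h) z.
have G1 : G u u1 by exact: resolvent_G.
have G2 : G u1 u2 by exact: resolvent_G.
have xE : x = u - (2 * h) *: u1.
  have := G_inj (resolventP x hh) G1; rewrite -/u => <-.
  by rewrite scalerA divff ?gt_eqF// scale1r opprB addrC subrK.
(* The argument is [(1 - h A)^2 u], and [x] consists of its first two terms [u - 2 h A u]. *)
have E : J h (J h (u - (2 * h) *: u1 + h ^+ 2 *: u2)) = u.
  rewrite (_ : _ + _ = (u - h *: u1) - h *: (u1 - h *: u2)).
    by rewrite (resolventB (u - h *: u1) _ h0) resolventZ// !resolvent_uniqE.
  rewrite mulr2n mulrDl mul1r scalerDl scalerBr scalerA expr2 opprB opprD.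
  by rewrite !addrA [RHS]addrAC; congr (_ + _); rewrite addrAC.
rewrite -xE -[h ^+ 2 *: u2]opprK in E.
rewrite !resolventB// in E.
rewrite -/u -{1}E addrAC subrr sub0r ipnormN.
rewrite -scaleN1r !resolventZ// ipnormZ normrN1 mul1r ipnormZ ger0_norm ?sqr_ge0//.
apply: ler_wpM2l; first exact: sqr_ge0.
do 2 (apply: le_trans (resolvent_nm _ h0) _).
exact: resolvent_nm.
Qed.


(** The local errors of [resolvent_halve] just add up: resolvents are nonexpansive, and they commute
    with [A], so each local error is still bounded through [z = A^2 x]. *)
Lemma iter_halve k h x y z : 0 < h -> G x y -> G y z ->
  ipnorm (iter k (J (2 * h)) x - iter k.*2 (J h) x) <= k%:R * (h ^+ 2 * ipnorm z).
Proof.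
move=> h0 Gxy Gyz; have hh : 0 < 2 * h by lra.
elim: k => [|k IH]; first by rewrite subrr ipnorm0 mul0r.
rewrite doubleS !iterS.
set u := iter k (J (2 * h)) x; set v := iter k.*2 (J h) x.
apply: le_trans (ipnorm_tri (J h (J h u)) _ _) _.
rewrite -!resolventB// -(natr1 k) [leRHS]mulrDl mul1r [leRHS]addrC; apply: lerD.
  have := resolvent_halve h0 (iter_G k hh Gxy) (iter_G k hh Gyz).
  move=> /le_trans; apply; apply: ler_wpM2l; first exact: sqr_ge0.
  exact: iter_nm.
by do 2 (apply: le_trans (resolvent_nm _ h0) _); exact: IH.
Qed.

(** [y] need not lie in the domain; it is compared with a domain point [y'], and the approximation
    error enters twice. *)
Lemma iter_close2 k h y y' z' : 0 < h -> G y' z' ->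
  ipnorm (iter k (J h) y - y) <= 2 * ipnorm (y - y') + k%:R * h * ipnorm z'.
Proof.
move=> h0 Gyz.
apply: le_trans (ipnorm_tri (iter k (J h) y') _ _) _.
have := ipnorm_tri y' (iter k (J h) y') y.
rewrite -iterB//; have := iter_nm k (y - y') h0.
have := iter_close k h0 Gyz; rewrite (ipnormB y' y); lra.
Qed.

(** First-order expansion in time: the step from [k] to [k + 1] adds [h *: J^(k+1) y], whose
    deviation from [h *: y] is bounded by [iter_close2]. *)
Lemma iter_taylor k h x y y' z' : 0 < h -> G x y -> G y' z' ->
  ipnorm (iter k (J h) x - x - (k%:R * h) *: y) <=
    k%:R * h * (2 * ipnorm (y - y') + k%:R * h * ipnorm z').
Proof.
move=> h0 Gxy Gyz; elim: k => [|k IH].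
  by rewrite !mul0r scale0r subrr subr0 ipnorm0.
have E : iter k.+1 (J h) x - iter k (J h) x = h *: iter k.+1 (J h) y.
  have G1 := iter_G k h0 Gxy; rewrite !iterS.
  have := G_inj (resolventP (iter k (J h) x) h0) (resolvent_G h0 G1).
  by move=> <-; rewrite scalerA divff ?gt_eqF// scale1r.
rewrite (_ : iter k.+1 (J h) x - x - (k.+1%:R * h) *: y =
    (iter k (J h) x - x - (k%:R * h) *: y) +
    h *: (iter k.+1 (J h) y - y)); last first.
  rewrite scalerBr -E -(natr1 k) [X in X *: y]mulrDl mul1r scalerDl.
  rewrite [RHS]addrACA -opprD; congr (_ - _).
  by rewrite [RHS]addrC subrKA.
apply: le_trans (ipnormD _ _) _; rewrite ipnormZ gtr0_norm//.
have := ler_wpM2l (ltW h0) (iter_close2 k.+1 y h0 Gyz).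
have kk : (k%:R : R) * h * ipnorm z' <= k.+1%:R * h * ipnorm z'.
  rewrite -!mulrA; apply: ler_wpM2r; last by rewrite ler_nat.
  by rewrite mulr_ge0 ?ipnorm_ge0// ltW.
have k0 : 0 <= (k%:R : R) * h by rewrite mulr_ge0// ltW.
have := ler_wpM2l k0 kk.
move: IH; rewrite -!(natr1 k); nra.
Qed.

Definition nsteps n (t : R) : nat := Num.truncn (t / hn n).
Local Notation K := nsteps.

Lemma nstepsP n t : 0 <= t -> (K n t)%:R * hn n <= t < (K n t).+1%:R * hn n.
Proof.
move=> t0; rewrite -ler_pdivlMr// -ltr_pdivrMr//.
by apply: truncn_itv; rewrite divr_ge0// ltW.
Qed.

(** Halving the step doubles the count, except that the remainder lost to rounding may hold one
    further half step. *)
Lemma nstepsS n t : 0 <= t -> K n.+1 t = (K n t).*2 \/ K n.+1 t = (K n t).*2.+1.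
Proof.
move=> t0.
have := nstepsP n t0; have := nstepsP n.+1 t0; rewrite (hnS n).
move: (hn n.+1) (hn_gt0 n.+1) (K n t) (K n.+1 t) => s s0 k k'.
rewrite -!natr1 => /andP[h1 h2] /andP[h3 h4].
apply: nat_case2.
  rewrite -ltnS -(@ltr_nat R) -(ltr_pM2r s0) -natr1 -mul2n natrM.
  lra.
have E : (k.*2.+2)%:R = 2 * k%:R + 2 :> R by rewrite -addn2 natrD -mul2n natrM.
by rewrite -(@ltr_nat R) -(ltr_pM2r s0) E; lra.
Qed.

(* Implicit Euler scheme with step [2^-n]. *)
Definition euler n t x := iter (K n t) (J (hn n)) x.

(** The term [t * ipnorm z] is the accumulated halving error; [ipnorm y] pays for the extra step
    that rounding may add. *)
Lemma euler_step n t x y z : 0 <= t -> G x y -> G y z ->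
  ipnorm (euler n t x - euler n.+1 t x) <= (t * ipnorm z + ipnorm y) * 2^-1 ^+ n.
Proof.
move=> t0 Gxy Gyz; rewrite -/(dyadic n).
have a0 := hn_gt0 n.+1.
have H := iter_halve (K n t) a0 Gxy Gyz; rewrite -hnS in H.
have a1 : hn n.+1 <= 1 by apply: exprn_ile1; lra.
have H1 : (K n t)%:R * (hn n.+1 ^+ 2 * ipnorm z) <= hn n * (t * ipnorm z).
  have /andP[h1 _] := nstepsP n t0; rewrite (hnS n) in h1 *.
  have z0 := ipnorm_ge0 z; have K0 : 0 <= (K n t)%:R :> R by [].
  rewrite expr2 !mulrA; apply: ler_wpM2r => //.
  have := ler_wpM2r (ltW a0) h1; nra.
have H2 u : ipnorm (J (hn n.+1) (iter u (J (hn n.+1)) x) -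
    iter u (J (hn n.+1)) x) <= hn n * ipnorm y.
  apply: le_trans (resolvent_close a0 (iter_G u a0 Gxy)) _.
  rewrite (hnS n); have := iter_nm u y a0; have := ipnorm_ge0 y; nra.
rewrite mulrDl !(mulrC _ (hn n)) /euler.
case: (nstepsS n t0) => ->.
  apply: le_trans H _; apply: le_trans H1 _.
  by rewrite lerDl mulr_ge0 ?ipnorm_ge0// ltW.
rewrite iterS; apply: le_trans (ipnorm_tri (iter (K n t).*2 (J (hn n.+1)) x) _ _) _.
apply: lerD; first exact: le_trans H H1.
by rewrite ipnormB; exact: H2.
Qed.

Lemma eulerB n t x y : euler n t (x - y) = euler n t x - euler n t y.
Proof. exact: iterB. Qed.

Lemma euler_nm n t x : ipnorm (euler n t x) <= ipnorm x.
Proof. exact: iter_nm. Qed.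

(** Geometric convergence holds on [D(A^2)]; density and contractivity, uniform in [n], carry the
    Cauchy property to every [x]. *)
Lemma euler_cauchy t x : 0 <= t ->
  dist_cauchy (fun x y => ipnorm (x - y)) (fun n => euler n t x).
Proof.
move=> t0 e e0.
have [x' [y' [z' [G1 G2 H]]]] := dense_dom2 x (e := e / 3) ltac:(lra).
have half : 0 <= (2^-1 : R) < 1 by lra.
have [n0 Hn0] := geometric_cauchy d_ge0 d_xx dC d_tri half
  (fun n => euler_step n t0 G1 G2) (e := e / 3) ltac:(lra).
have key n : ipnorm (euler n t x - euler n t x') <= e / 3.
  by rewrite -eulerB; apply: le_trans (euler_nm _ _ _) _.
exists n0 => m n hm hn.
apply: le_trans (ipnorm_tri (euler m t x') _ _) _.
have := ipnorm_tri (euler n t x') (euler m t x') (euler n t x).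
have := Hn0 m n hm hn; have := key m; have := key n.
rewrite /d [ipnorm (euler n t x - _)]ipnormB; lra.
Qed.

Definition semigroup t x : V := xget 0 [set l | cvgs (fun n => euler n t x) l].
Local Notation S := semigroup.

Lemma semigroupP t x : 0 <= t -> cvgs (fun n => euler n t x) (S t x).
Proof.
move=> t0; have [l Hl] := cpl (euler_cauchy x t0).
by apply: (@xgetPex _ 0 [set l | cvgs (fun n => euler n t x) l]); exists l.
Qed.

Lemma semigroup_uniq t x l : 0 <= t -> cvgs (fun n => euler n t x) l -> S t x = l.
Proof. by move=> t0; apply: cvgs_uniq; exact: semigroupP. Qed.

Lemma semigroup_lin t a x y : 0 <= t -> S t (a *: x + y) = a *: S t x + S t y.
Proof.
move=> t0; apply: semigroup_uniq => //.
rewrite (_ : (fun n => _) = (fun n => a *: euler n t x + euler n t y)).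
  by apply: cvgs_lin; exact: semigroupP.
by apply/funext => n; rewrite /euler iter_lin.
Qed.

Lemma semigroupB t x y : 0 <= t -> S t (x - y) = S t x - S t y.
Proof.
by move=> t0; rewrite -scaleN1r addrC semigroup_lin// scaleN1r addrC.
Qed.

Lemma semigroup_nm t x : 0 <= t -> ipnorm (S t x) <= ipnorm x.
Proof.
move=> t0; rewrite -[S t x]subr0; apply: (cvgs_bound (semigroupP x t0)) => n.
by rewrite subr0; exact: euler_nm.
Qed.

Lemma semigroup0 x : S 0 x = x.
Proof.
apply: semigroup_uniq => // e e0; exists 0%N => n _.
by rewrite /euler /nsteps mul0r truncn0 /= subrr ipnorm0 ltW.
Qed.

Lemma semigroup_close t x y : 0 <= t -> G x y -> ipnorm (S t x - x) <= t * ipnorm y.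
Proof.
move=> t0 Gxy; apply: (cvgs_bound (semigroupP x t0)) => n.
apply: le_trans (iter_close _ _ Gxy) _ => //.
by apply: ler_wpM2r; [exact: ipnorm_ge0|case/andP: (nstepsP n t0)].
Qed.

Lemma semigroup_cont x e : 0 < e ->
  exists2 dl : R, 0 < dl & forall t, 0 <= t <= dl -> ipnorm (S t x - x) <= e.
Proof.
move=> e0; have [x' [y' [Gxy H]]] := dense_dom x (e := e / 3) ltac:(lra).
have y1 : 0 < ipnorm y' + 1 by rewrite ltr_wpDl// ipnorm_ge0.
exists (e / 3 / (ipnorm y' + 1)); first by rewrite !divr_gt0.
move=> t /andP[t0]; rewrite ler_pdivlMr// => ht.
have := semigroup_close t0 Gxy; have := semigroup_nm (x - x') t0.
rewrite semigroupB//.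
have := ipnorm_tri (S t x') (S t x) x; have := ipnorm_tri x' (S t x') x.
rewrite (ipnormB x' x); have := ipnorm_ge0 y'; nra.
Qed.

(** The step count of [t + s] is the sum of the two counts or one more. On the domain the extra
    resolvent moves a point by at most the step times [ipnorm y'], so it vanishes in the limit;
    density does the rest. *)
Lemma semigroupD t s x : 0 <= t -> 0 <= s -> S (t + s) x = S t (S s x).
Proof.
move=> t0 s0; have ts0 := addr_ge0 t0 s0.
have dom x' y' : G x' y' -> S (t + s) x' = S t (S s x').
  move=> Gxy; apply: semigroup_uniq => // e e0.
  have [n0 Hn0] := semigroupP x' s0 (e := e / 3) ltac:(lra).
  have [n1 Hn1] := semigroupP (S s x') t0 (e := e / 3) ltac:(lra).
  have [n2 Hn2] := @hn_small (ipnorm y') (e / 3) ltac:(lra).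
  exists (maxn n0 (maxn n1 n2)) => n; rewrite !geq_max.
  move=> /andP[/Hn0 h0 /andP[/Hn1 h1 /Hn2 h2]].
  apply: le_trans (ipnorm_tri (iter (K n t + K n s)%N (J (hn n)) x') _ _) _.
  have E : (K n (t + s) = K n t + K n s \/ K n (t + s) = (K n t + K n s).+1)%N.
    have := nstepsP n ts0; have := nstepsP n t0; have := nstepsP n s0.
    move: (K n (t + s)) (K n t) (K n s) => k k1 k2.
    move=> /andP[a1 a2] /andP[a3 a4] /andP[a5 a6].
    have h5 : (k < (k1 + k2).+2)%N.
      rewrite -(@ltr_nat R) -(ltr_pM2r (hn_gt0 n)) -addn2 !natrD.
      by rewrite -!natr1 in a2 a4; lra.
    have h6 : (k1 + k2 < k.+1)%N.
      by rewrite -(@ltr_nat R) -(ltr_pM2r (hn_gt0 n)) natrD; lra.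
    exact: nat_case2.
  have h3 : ipnorm (euler n (t + s) x' - iter (K n t + K n s)%N (J (hn n)) x')
      <= e / 3.
    rewrite /euler; case: E => ->; first by rewrite subrr ipnorm0; lra.
    rewrite iterS; apply: le_trans (resolvent_close _ (iter_G _ _ Gxy)) _ => //.
    apply: le_trans h2; rewrite mulrC; apply: ler_wpM2r; first exact: ltW.
    exact: iter_nm.
  rewrite iterD -/(euler n s x') -/(euler n t (euler n s x')) in h3 *.
  have h4 : ipnorm (euler n t (euler n s x') - euler n t (S s x')) <= e / 3.
    by rewrite -eulerB; apply: le_trans (euler_nm _ _ _) _.
  have := ipnorm_tri (euler n t (S s x')) (euler n t (euler n s x')) (S t (S s x')).
  lra.
apply: subr0_eq; apply: ipnorm_eq0; apply/le_anti; rewrite ipnorm_ge0 andbT.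
apply/ler_addgt0Pr => e e0; rewrite add0r.
have [x' [y' [Gxy H]]] := dense_dom x (e := e / 2) ltac:(lra).
have h1 := semigroup_nm (x - x') ts0; rewrite semigroupB// in h1.
have h2 := semigroup_nm (S s (x - x')) t0.
have h3 := semigroup_nm (x - x') s0.
rewrite !semigroupB// -(dom _ _ Gxy) in h2; rewrite semigroupB// in h3.
apply: le_trans (ipnorm_tri (S (t + s) x') _ _) _.
rewrite [X in _ + X]ipnormB; lra.
Qed.

Lemma semigroup_taylor t x y y' z' : 0 <= t -> G x y -> G y' z' ->
  ipnorm (S t x - x - t *: y) <= t * (2 * ipnorm (y - y') + t * ipnorm z').
Proof.
move=> t0 Gxy Gyz; rewrite -addrA -opprD.
apply/ler_addgt0Pr => e e0.
have [n0 Hn0] := semigroupP x t0 (e := e / 2) ltac:(lra).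
have [n1 Hn1] := @hn_small (ipnorm y) (e / 2) ltac:(lra).
pose n := maxn n0 n1; have h0 := Hn0 n (leq_maxl _ _).
have h1 := Hn1 n (leq_maxr _ _).
apply: le_trans (ipnorm_tri (euler n t x) _ _) _; rewrite ipnormB.
(* [th] is [t] rounded down to the grid; replacing one by the other costs at most one step times
   [ipnorm y]. *)
pose th := (K n t)%:R * hn n.
apply: (@le_trans _ _ (e / 2 + (ipnorm (euler n t x - x - th *: y) +
    ipnorm (th *: y - t *: y)))).
  apply: lerD => //; rewrite opprD addrA -[_ - t *: y](subrKA (th *: y)).
  exact: ipnormD.
have /andP[k1 k2] := nstepsP n t0; rewrite -/th in k1.
have h2 := iter_taylor (K n t) (hn_gt0 n) Gxy Gyz; rewrite -/th in h2.
have h3 : ipnorm (th *: y - t *: y) <= e / 2.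
  rewrite -scalerBl ipnormZ ler0_norm; last by lra.
  apply: le_trans h1; rewrite mulrC; apply: ler_wpM2l; first exact: ipnorm_ge0.
  by move: k2; rewrite -natr1 mulrDl -/th; lra.
have th0 : 0 <= th by rewrite mulr_ge0// ltW.
have z0 := ipnorm_ge0 z'; have yy0 := ipnorm_ge0 (y - y').
have h4 : th * (2 * ipnorm (y - y') + th * ipnorm z') <=
    t * (2 * ipnorm (y - y') + t * ipnorm z').
  apply: ler_pM => //; first by apply: addr_ge0; apply: mulr_ge0 => //; lra.
  by rewrite lerD2l; apply: ler_wpM2r.
rewrite -/(euler n t x) in h2; lra.
Qed.

Definition gen_at x y := forall e, 0 < e ->
  exists2 dl : R, 0 < dl &
    forall t, 0 < t < dl -> ipnorm (t^-1 *: (S t x - x) - y) <= e.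

Lemma gen_at_G x y : G x y -> gen_at x y.
Proof.
move=> Gxy e e0.
have [y' [z' [Gyz H]]] := dense_dom y (e := e / 4) ltac:(lra).
have z1 : 0 < ipnorm z' + 1 by rewrite ltr_wpDl// ipnorm_ge0.
exists (e / 2 / (ipnorm z' + 1)); first by rewrite !divr_gt0.
move=> t /andP[t0]; rewrite ltr_pdivlMr// => ht.
have := semigroup_taylor (ltW t0) Gxy Gyz.
rewrite (_ : _ - _ = t *: (t^-1 *: (S t x - x) - y)); last first.
  by rewrite scalerBr scalerA divff ?gt_eqF// scale1r.
rewrite ipnormZ gtr0_norm// ler_pM2l//.
have := ipnorm_ge0 z'; nra.
Qed.

Lemma gen_at_diss x y : gen_at x y -> ip y x <= 0.
Proof.
move=> H; apply/ler_addgt0Pr => e e0; rewrite add0r.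
have x1 : 0 < ipnorm x + 1 by rewrite ltr_wpDl// ipnorm_ge0.
have [dl dl0 Hd] := H (e / (ipnorm x + 1)) ltac:(by rewrite divr_gt0).
pose t := dl / 2; have t0 : 0 < t by rewrite divr_gt0.
have := Hd t; rewrite t0/= => /(_ ltac:(rewrite /t; lra)).
rewrite ipnormB ler_pdivlMr// => h1.
have h2 : ip (t^-1 *: (S t x - x)) x <= 0.
  rewrite ipZl pmulr_rle0 ?invr_gt0// ipBl -ipnorm_sqr.
  have := ip_le (S t x) x; have := semigroup_nm x (ltW t0).
  have := ipnorm_ge0 x; nra.
rewrite -[y](subrK (t^-1 *: (S t x - x))) ipDl.
have := ip_le (y - t^-1 *: (S t x - x)) x.
have := ipnorm_ge0 (y - t^-1 *: (S t x - x)); have := ipnorm_ge0 x; nra.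
Qed.

Lemma gen_atB x y x' y' : gen_at x y -> gen_at x' y' -> gen_at (x - x') (y - y').
Proof.
move=> H H' e e0.
have [d1 d10 H1] := H (e / 2) ltac:(lra).
have [d2 d20 H2] := H' (e / 2) ltac:(lra).
exists (Num.min d1 d2); first by rewrite lt_min d10.
move=> t; rewrite lt_min => /andP[t0 /andP[t1 t2]].
have {H1}h1 := H1 t; rewrite t0 t1 in h1.
have {H2}h2 := H2 t; rewrite t0 t2 in h2.
rewrite semigroupB; last exact: ltW.
rewrite [X in ipnorm X](_ : _ =
    (t^-1 *: (S t x - x) - y) - (t^-1 *: (S t x' - x') - y')); last first.
  rewrite [in RHS]opprD [RHS]addrACA -opprD -scalerBr.
  by congr (_ *: _ - _); rewrite opprD addrACA -opprD.
apply: le_trans (ipnormD _ _) _; rewrite ipnormN.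
have := h1 isT; have := h2 isT; lra.
Qed.

(* The generator extends [G], is dissipative, and [1 - G] is onto. *)
Lemma gen_at_iff x y : gen_at x y <-> G x y.
Proof.
split; last exact: gen_at_G.
move=> H; have := resolventP (x - y) ltr01; rewrite invr1 scale1r.
set x' := J 1 (x - y) => Gx'.
have H' := gen_atB H (gen_at_G Gx').
have E : y - (x' - (x - y)) = x - x'.
  by rewrite opprB addrC [x - y - x']addrAC subrK.
rewrite E in H'.
have xx' : x = x'.
  apply: subr0_eq; apply: ip_def; apply/le_anti.
  by rewrite ip_ge0 gen_at_diss.
by move: Gx'; rewrite -xx' opprB addrC subrK.
Qed.

(** The Lumer-Phillips theorem, with the density of the domain derived from [G_fun] and [G_range].
    The last clause is an equivalence: the generator is [G] itself and not merely an extension of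
    it. *)
Theorem hilbert_generation : exists T : R -> V -> V,
  [/\ forall t a x y, 0 <= t -> T t (a *: x + y) = a *: T t x + T t y,
      forall t x, 0 <= t -> ipnorm (T t x) <= ipnorm x,
      (forall x, T 0 x = x) /\
        (forall t s x, 0 <= t -> 0 <= s -> T (t + s) x = T t (T s x)),
      forall x e, 0 < e -> exists2 dl : R, 0 < dl &
        forall t, 0 <= t <= dl -> ipnorm (T t x - x) <= e &
      forall x y, (forall e, 0 < e -> exists2 dl : R, 0 < dl &
        forall t, 0 < t < dl -> ipnorm (t^-1 *: (T t x - x) - y) <= e) <-> G x y].
Proof.
exists S; split.
- by move=> *; exact: semigroup_lin.
- by move=> *; exact: semigroup_nm.
- by split; [exact: semigroup0|move=> *; exact: semigroupD].
- exact: semigroup_cont.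
- exact: gen_at_iff.
Qed.

End Hilbert.

(** * Square-integrable functions on [0, L] *)

Section L2.
Variables (R : realType) (L : R).
Hypothesis L0 : 0 < L.
Local Notation mu := (@lebesgue_measure R).
Local Notation I := (itv0 L).
Implicit Types f g h p q : R -> R.

Lemma measurable_itv0 : measurable (I : set (measurableTypeR R)).
Proof. exact: measurable_itv. Qed.
Hint Resolve measurable_itv0 : core.

Lemma itv0P x : I x <-> 0 <= x <= L.
Proof. by rewrite /itv0 /= in_itv. Qed.

Definition measI f : Prop := measurable_fun (I : set (measurableTypeR R)) f.

Lemma L2r_meas f : L2r L f -> measI f.
Proof. by move=> [mf _]. Qed.

Lemma L2r_sq_int f : L2r L f -> mu.-integrable I (EFin \o (fun x => f x ^+ 2)).
Proof.
move=> /[dup] /L2r_meas mf [_ f2]; apply/integrableP; split.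
  by apply/measurable_EFinP; exact: measurable_funX.
apply: le_lt_trans f2; rewrite le_eqVlt; apply/orP; left; apply/eqP.
by apply: eq_integral => x _ /=; rewrite ger0_norm// sqr_ge0.
Qed.

Lemma L2_int f g : L2r L f -> L2r L g ->
  mu.-integrable I (EFin \o (fun x => f x * g x)).
Proof.
move=> Lf Lg; have := integrableD measurable_itv0 (L2r_sq_int Lf) (L2r_sq_int Lg).
apply: le_integrable => //.
  by apply/measurable_EFinP; apply: measurable_funM; exact: L2r_meas.
move=> x _ /=; rewrite lee_fin [leRHS]ger0_norm ?addr_ge0 ?sqr_ge0//.
by rewrite ler_norml; apply/andP; split; nra.
Qed.

Lemma L2r_of_int f : measI f ->
  mu.-integrable I (EFin \o (fun x => f x ^+ 2)) -> L2r L f.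
Proof.
move=> mf /integrableP[_ h]; split=> //; apply: le_lt_trans h.
rewrite le_eqVlt; apply/orP; left; apply/eqP; apply: eq_integral => x _ /=.
by rewrite ger0_norm// sqr_ge0.
Qed.

Lemma L2r_lin a f g : L2r L f -> L2r L g -> L2r L (fun x => a * f x + g x).
Proof.
move=> Lf Lg; apply: L2r_of_int.
  apply: measurable_funD; last exact: L2r_meas.
  by apply: measurable_funM => //; exact: L2r_meas.
have := integrableD measurable_itv0
  (integrableZl measurable_itv0 (2 * a ^+ 2) (L2r_sq_int Lf))
  (integrableZl measurable_itv0 2 (L2r_sq_int Lg)).
apply: le_integrable => //.
  apply/measurable_EFinP; apply: measurable_funX.
  apply: measurable_funD; last exact: L2r_meas.
  by apply: measurable_funM => //; exact: L2r_meas.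
move=> x _ /=; rewrite lee_fin !ger0_norm ?sqr_ge0//; last first.
  by have := sqr_ge0 (a * f x); have := sqr_ge0 (g x); nra.
have := sqr_ge0 (a * f x - g x); nra.
Qed.

Lemma L2r_bounded f (M : R) : measI f ->
  (forall x, 0 <= x <= L -> `|f x| <= M) -> L2r L f.
Proof.
move=> mf HM; apply: L2r_of_int => //.
have : mu.-integrable I (EFin \o (fun=> M ^+ 2)).
  apply: continuous_compact_integrable; first exact: segment_compact.
  by apply: continuous_subspaceT => y; exact: cst_continuous.
apply: le_integrable => //.
  by apply/measurable_EFinP; exact: measurable_funX.
move=> x /itv0P /HM h /=; rewrite lee_fin !ger0_norm ?sqr_ge0//.
by rewrite -real_normK ?num_real// lerXn2r// ?nnegrE// (le_trans _ h).
Qed.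

Lemma L2r_cst c : L2r L (fun=> c).
Proof. by apply: (@L2r_bounded _ `|c|); [exact: measurable_cst|]. Qed.

Lemma L2r_ext f g : (forall x, 0 <= x <= L -> f x = g x) -> L2r L f -> L2r L g.
Proof.
move=> fg [mf f2]; split.
  by apply: eq_measurable_fun mf => x /set_mem/itv0P/fg.
apply: le_lt_trans f2; rewrite le_eqVlt; apply/orP; left; apply/eqP.
by apply: eq_integral => x /set_mem/itv0P/fg ->.
Qed.

Lemma contR_measurable f : contR L f -> measI f.
Proof. by apply: subspace_continuous_measurable_fun. Qed.

Lemma contR_bounded f : contR L f ->
  exists M, forall x, 0 <= x <= L -> `|f x| <= M.
Proof.
move=> cf; have cpt : compact (f @` `[0, L]).
  by apply: continuous_compact => //; exact: segment_compact.
have [M [_ HM]] := compact_bounded cpt.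
exists (M + 1) => x x0; apply: (HM (M + 1)); first by rewrite ltrDl.
by exists x => //; rewrite /= in_itv.
Qed.

Lemma contR_L2 f : contR L f -> L2r L f.
Proof.
move=> cf; have [M HM] := contR_bounded cf.
by apply: (L2r_bounded _ HM); exact: contR_measurable.
Qed.

Lemma L2rM_cont f g : contR L f -> L2r L g -> L2r L (fun x => f x * g x).
Proof.
move=> cf Lg; have [M HM] := contR_bounded cf.
have mfg : measI (fun x => f x * g x).
  by apply: measurable_funM; [exact: contR_measurable|exact: L2r_meas].
apply: L2r_of_int => //.
have := integrableZl measurable_itv0 (M ^+ 2) (L2r_sq_int Lg).
apply: le_integrable => //.
  by apply/measurable_EFinP; exact: measurable_funX.
move=> x /itv0P /HM h /=; rewrite lee_fin ger0_norm ?sqr_ge0//.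
rewrite ger0_norm; last by apply: mulr_ge0; exact: sqr_ge0.
rewrite exprMn; apply: ler_wpM2r; first exact: sqr_ge0.
by rewrite -real_normK ?num_real// lerXn2r// ?nnegrE// (le_trans _ h).
Qed.

Definition L2dot f g : R := Rintegral mu I (fun x => f x * g x).

Lemma L2dotC f g : L2dot f g = L2dot g f.
Proof. by apply: eq_Rintegral => x _; rewrite mulrC. Qed.

Lemma L2dot_lin a f g h : L2r L f -> L2r L g -> L2r L h ->
  L2dot (fun x => a * f x + g x) h = a * L2dot f h + L2dot g h.
Proof.
move=> Lf Lg Lh; rewrite /L2dot.
rewrite -RintegralZl//; last exact: L2_int.
rewrite -RintegralD//; first by apply: eq_Rintegral => x _; rewrite mulrDl mulrA.
- exact: (integrableZl measurable_itv0 a (L2_int Lf Lh)).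
- exact: L2_int.
Qed.

Lemma L2dot_ge0 f : 0 <= L2dot f f.
Proof. by apply: Rintegral_ge0 => x _; rewrite -expr2 sqr_ge0. Qed.

Lemma L2dot_ext f f' g g' : (forall x, 0 <= x <= L -> f x = f' x) ->
  (forall x, 0 <= x <= L -> g x = g' x) -> L2dot f g = L2dot f' g'.
Proof.
by move=> ff gg; apply: eq_Rintegral => x /set_mem/itv0P x0; rewrite ff// gg.
Qed.

Lemma L2dot_ae f g h : L2r L f -> L2r L g -> L2r L h ->
  {ae mu, forall x, I x -> f x = g x} -> L2dot f h = L2dot g h.
Proof.
move=> Lf Lg Lh fg; rewrite /L2dot /Rintegral; congr fine.
apply: ae_eq_integral => //.
- exact: (measurable_int _ (L2_int Lf Lh)).
- exact: (measurable_int _ (L2_int Lg Lh)).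
- move: fg; apply: filterS; first exact: (ae_filter_ringOfSetsType mu).
  by move=> x H /H /= ->.
Qed.

Lemma L2dotD f g h : L2r L f -> L2r L g -> L2r L h ->
  L2dot (fun x => f x + g x) h = L2dot f h + L2dot g h.
Proof.
move=> Lf Lg Lh; have := L2dot_lin 1 Lf Lg Lh; rewrite mul1r => <-.
by apply: L2dot_ext => // x _; rewrite mul1r.
Qed.

Lemma L2dot0 h : L2dot (fun=> 0) h = 0.
Proof.
transitivity (Rintegral mu I (fun=> 0)).
  by apply: eq_Rintegral => x _; rewrite mul0r.
by rewrite Rintegral_cst// mul0r.
Qed.

Lemma L2dotZ a f h : L2r L f -> L2r L h ->
  L2dot (fun x => a * f x) h = a * L2dot f h.
Proof.
move=> Lf Lh; rewrite /L2dot -RintegralZl//; last exact: L2_int.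
by apply: eq_Rintegral => x _; rewrite mulrA.
Qed.

Lemma L2dot_le f g f' g' : L2r L f -> L2r L g -> L2r L f' -> L2r L g' ->
  (forall x, 0 <= x <= L -> f x * g x <= f' x * g' x) -> L2dot f g <= L2dot f' g'.
Proof.
move=> Lf Lg Lf' Lg' H; apply: le_Rintegral => //; try exact: L2_int.
Qed.

End L2.

(** * Weak derivatives *)

Section ProductRule.
Variables (R : realType).
Local Notation mu := (@lebesgue_measure R).
Local Notation mR := (measurableTypeR R).

Lemma measurable_itvR (i : interval R) : measurable ([set` i] : set mR).
Proof. exact: measurable_itv. Qed.

(* Fubini on the triangle [0 <= t < s <= x]. *)
Lemma prim_mul (p q : R -> R) (x : R) : 0 <= x ->
  mu.-integrable `[0, x] (EFin \o p) -> mu.-integrable `[0, x] (EFin \o q) ->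
  (\int[mu]_(s in `[0, x]) (p s * prim q s) =
   prim p x * prim q x - \int[mu]_(t in `[0, x]) (q t * prim p t))%R.
Proof.
move=> x0 ip iq.
pose X : set mR := `[0, x]%classic.
have mX : measurable X by exact: measurable_itvR.
pose p' : mR -> R := p \_ X; pose q' : mR -> R := q \_ X.
have restr (r : R -> R) : EFin \o (r \_ X) = (EFin \o r) \_ X.
  by apply/funext => s; rewrite /= /patch; case: ifP.
have ip' : mu.-integrable setT (EFin \o p').
  by rewrite restr; apply/(integrable_mkcond _ _).1.
have iq' : mu.-integrable setT (EFin \o q').
  by rewrite restr; apply/(integrable_mkcond _ _).1.
have mp' : measurable_fun setT p' by apply/measurable_EFinP; exact: (measurable_int mu).
have mq' : measurable_fun setT q' by apply/measurable_EFinP; exact: (measurable_int mu).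
pose h (z : mR * mR) : R := if z.2 < z.1 then p' z.1 * q' z.2 else 0.
have mh : measurable_fun setT h.
  apply: measurable_fun_ifT => //.
    apply: measurable_fun_ltr; [exact: measurable_snd|exact: measurable_fst].
  apply: measurable_funM.
    by apply: measurableT_comp => //; exact: measurable_fst.
  by apply: measurableT_comp => //; exact: measurable_snd.
have mhE : measurable_fun setT (EFin \o h) by exact/measurable_EFinP.
have inq : mu.-integrable setT (EFin \o (fun t => `|q' t|)).
  exact: integrable_norm.
have inp : mu.-integrable setT (EFin \o (fun t => `|p' t|)).
  exact: integrable_norm.
pose c : R := \int[mu]_t `|q' t|.
have cE : (\int[mu]_t (`|q' t|)%:E = c%:E)%E.
  by rewrite /c /Rintegral fineK//; exact: integrable_fin_num.
have c0 : 0 <= c by apply: Rintegral_ge0.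
have hle s t : `|h (s, t)| <= `|p' s| * `|q' t|.
  by rewrite /h /=; case: ifP => _; rewrite ?normrM ?normr0 ?mulr_ge0.
(* Tonelli: the kernel is dominated by the product [|p'(s)| |q'(t)|] of integrable functions. *)
have ih : ((mu \x mu)%E).-integrable setT (EFin \o h).
  apply/integrable12ltyP => //.
  apply: (@le_lt_trans _ _ (\int[mu]_s (c * `|p' s|)%:E)%E).
    apply: ge0_le_integral => //=.
    - by move=> s _; apply: integral_ge0.
    - apply: (measurable_fun_fubini_tonelli_F (abse \o (EFin \o h))) => //=.
      exact: measurableT_comp.
    - apply/measurable_EFinP; apply: measurable_funM => //.
      exact: measurableT_comp.
    - move=> s _.
      have -> : ((c * `|p' s|)%:E = \int[mu]_t (`|p' s|%:E * `|q' t|%:E))%E.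
        by rewrite mulrC EFinM -cE integralZl.
      apply: ge0_le_integral => //=.
      + apply/measurable_EFinP; apply: measurableT_comp => //.
        exact: (measurableT_comp mh (measurable_pair1 s)).
      + apply/measurable_EFinP; apply: measurable_funM => //.
        exact: measurableT_comp.
      + by move=> t _; rewrite lee_fin.
  have /integrableP[_] := integrableZl measurableT c inp.
  apply: le_lt_trans; rewrite le_eqVlt; apply/orP; left; apply/eqP.
  by apply: eq_integral => s _ /=; rewrite (ger0_norm (mulr_ge0 c0 (normr_ge0 _))).
have H := Fubini ih.
have E1 : (\int[mu]_s \int[mu]_t (EFin \o h) (s, t) =
    \int[mu]_(s in X) (p s * prim q s)%:E)%E.
  clear H ih mh mhE inq inp cE hle mp' mq' ip' iq' restr c0.
  rewrite [RHS]integral_mkcond; apply: eq_integral => s _.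
  rewrite [RHS]patchE; case: ifPn => [|sX]; last first.
    rewrite (_ : (fun t => _) = cst 0%E) ?integral0//.
    by apply/funext => t; rewrite /= /h /p' /= patchE (negbTE sX) mul0r if_same.
  rewrite mem_setE in_itv /= => /andP[s0 sx].
  have sub : `[0, s[%classic `<=` X.
    move=> t; rewrite /X /= !in_itv/= => /andP[-> ts]/=.
    exact: le_trans (ltW ts) sx.
  have iqs : mu.-integrable `[0, s[ (EFin \o q).
    by apply: integrableS iq => //; exact: measurable_itvR.
  rewrite EFinM.
  (* The slice of the triangle at height [s] is [[0, s[], while [prim] integrates over [[0, s]]; one
     point has measure zero. *)
  have -> : (prim q s)%:E = (\int[mu]_(t in `[0%R, s[) (q t)%:E)%E.
    rewrite /prim -Rintegral_itv_bndo_bndc// /Rintegral fineK//.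
    exact: (integrable_fin_num (measurable_itvR `[0, s[) iqs).
  transitivity (\int[mu]_(t in `[0%R, s[) ((p s)%:E * (q t)%:E))%E; last first.
    exact: (integralZl (measurable_itvR `[0, s[) iqs (p s)).
  rewrite [RHS]integral_mkcond; apply: eq_integral => t _.
  rewrite /= patchE mem_setE in_itv /= /h /= /p' /q' !patchE !mem_setE !in_itv /=.
  rewrite s0 sx /=; have [t0|t0] := leP 0 t; have [ts|ts] := ltP t s => //=.
  - by rewrite (le_trans (ltW ts) sx).
  - by rewrite mulr0.

have E2 : (\int[mu]_t \int[mu]_s (EFin \o h) (s, t) =
    \int[mu]_(t in X) (q t * (prim p x - prim p t))%:E)%E.
  clear E1 H ih mh mhE inq inp cE hle mp' mq' ip' iq' restr c0.
  rewrite [RHS]integral_mkcond; apply: eq_integral => t _.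
  rewrite [RHS]patchE; case: ifPn => [|tX]; last first.
    rewrite (_ : (fun s => _) = cst 0%E) ?integral0//.
    by apply/funext => s; rewrite /= /h /q' /= patchE (negbTE tX) mulr0 if_same.
  rewrite mem_setE in_itv /= => /andP[t0 tx].
  have sub : `]t, x]%classic `<=` X.
    move=> s; rewrite /X /= !in_itv/= => /andP[ts ->].
    by rewrite (le_trans t0 (ltW ts)).
  have ips : mu.-integrable `]t, x] (EFin \o p).
    by apply: integrableS ip => //; exact: measurable_itvR.
  rewrite EFinM.
  have -> : (prim p x - prim p t)%:E = (\int[mu]_(s in `]t, x]) (p s)%:E)%E.
    rewrite /prim Rintegral_itvB// ?bnd_simp// /Rintegral fineK//.
    exact: (integrable_fin_num (measurable_itvR `]t, x]) ips).
  transitivity (\int[mu]_(s in `]t, x]) ((q t)%:E * (p s)%:E))%E; last first.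
    exact: (integralZl (measurable_itvR `]t, x]) ips (q t)).
  rewrite [RHS]integral_mkcond; apply: eq_integral => s _.
  rewrite /= patchE mem_setE in_itv /= /h /= /p' /q' !patchE !mem_setE !in_itv /=.
  rewrite t0 tx /=; have [sx|sx] := leP s x; have [ts|ts] := ltP t s => //=.
  - by rewrite (le_trans t0 (ltW ts)) mulrC.
  - by rewrite andbF mul0r.
have {E1 E2 H}E := etrans (esym E1) (etrans H E2).
clear ih mh mhE inq inp cE hle mp' mq' ip' iq' restr c0 c h p' q'.
have prim_cont (r : R -> R) : mu.-integrable X (EFin \o r) ->
    {within X, continuous prim r}.
  by move=> ir; exact: parameterized_integral_continuous.
have bnd (r k : R -> R) : mu.-integrable X (EFin \o r) ->
    {within X, continuous k} -> mu.-integrable X (EFin \o (fun s => r s * k s)).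
  move=> ir ck.
  have cpt : compact (k @` X).
    by apply: continuous_compact => //; exact: segment_compact.
  have [M [_ HM]] := compact_bounded cpt.
  have kM s : X s -> `|k s| <= M + 1.
    by move=> Xs; apply: (HM (M + 1)); [rewrite ltrDl|exists s].
  have := integrableZl mX (M + 1) (integrable_norm ir).
  apply: le_integrable => //.
    apply/measurable_EFinP; apply: measurable_funM.
      by apply/measurable_EFinP; exact: (measurable_int mu).
    exact: subspace_continuous_measurable_fun.
  move=> s Xs /=; rewrite lee_fin normrM mulrC; apply: le_trans (ler_norm _).
  by apply: ler_wpM2r => //; exact: kM.
rewrite /Rintegral E -!/(Rintegral _ _ _); clear E.
rewrite (_ : prim p x * prim q x = \int[mu]_(t in X) (q t * prim p x)); last first.
  by rewrite RintegralZr// mulrC.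
rewrite -RintegralB//; first by apply: eq_Rintegral => t _; rewrite mulrBr.
- by apply: bnd => // s; exact: cst_continuous.
- by apply: bnd => //; exact: prim_cont.
Qed.

End ProductRule.

Section WeakDerivative.
Variables (R : realType) (L : R).
Hypothesis L0 : 0 < L.
Local Notation mu := (@lebesgue_measure R).
Local Notation I := (itv0 L).
Implicit Types f g h p q : R -> R.

Lemma L2r_int f : L2r L f -> mu.-integrable I (EFin \o f).
Proof.
move=> Lf; have := L2_int Lf (L2r_cst L 1).
by congr (integrable _ _ _); apply/funext => x /=; rewrite mulr1.
Qed.

Lemma L2r_int_sub f x : x <= L -> L2r L f -> mu.-integrable `[0, x] (EFin \o f).
Proof.
move=> xL Lf; apply: integrableS (L2r_int Lf) => //; first exact: measurable_itvR.
by move=> t; rewrite /itv0 /= !in_itv /= => /andP[-> /le_trans->].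
Qed.

Lemma prim0 f : prim f 0 = 0.
Proof. by rewrite /prim set_itv1 Rintegral_set1. Qed.

Lemma prim_lin a f g x : x <= L -> L2r L f -> L2r L g ->
  prim (fun t => a * f t + g t) x = a * prim f x + prim g x.
Proof.
move=> xL Lf Lg; have If := L2r_int_sub xL Lf; have Ig := L2r_int_sub xL Lg.
have mx := measurable_itvR `[0, x].
have aIf : mu.-integrable `[0, x] (EFin \o (fun t => a * f t)).
  exact: (integrableZl mx a If).
by rewrite /prim (RintegralD mx aIf Ig) (RintegralZl a mx If).
Qed.

Lemma prim_ext f g x : (forall t, 0 <= t <= x -> f t = g t) ->
  prim f x = prim g x.
Proof. by move=> fg; apply: eq_Rintegral => t; rewrite mem_setE in_itv => /fg. Qed.

Lemma prim_cont f : L2r L f -> contR L (prim f).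
Proof.
by move=> Lf; apply: (parameterized_integral_continuous (ltW L0)); exact: L2r_int.
Qed.

Local Notation hd := (has_derivR L).

Lemma derivR_prim c g : L2r L g -> hd (fun x => c + prim g x) g.
Proof. by move=> Lg; split=> // x _; rewrite prim0 addr0. Qed.

Lemma derivR_ext f f' g : (forall x, 0 <= x <= L -> f x = f' x) -> hd f g -> hd f' g.
Proof.
move=> ff [Lg H]; split=> // x x0.
have z0 : 0 <= (0 : R) <= L by rewrite lexx ltW.
by rewrite -(ff _ x0) -(ff _ z0); exact: H.
Qed.

Lemma derivR_ext_r f g g' : (forall x, 0 <= x <= L -> g x = g' x) -> hd f g -> hd f g'.
Proof.
move=> gg [Lg H]; split=> [|x x0]; first exact: L2r_ext Lg.
rewrite (H x x0); congr (_ + _); apply: prim_ext => t /andP[t0 tx].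
by apply: gg; rewrite t0 (le_trans tx)//; case/andP: x0.
Qed.

Lemma contR_ext f g : (forall x, 0 <= x <= L -> f x = g x) -> contR L f -> contR L g.
Proof.
move=> fg; apply: subspace_eq_continuous => x; rewrite mem_setE in_itv => /fg.
by [].
Qed.

Lemma contRD f g : contR L f -> contR L g -> contR L (fun x => f x + g x).
Proof. by move=> cf cg x; apply: cvgD; [exact: cf|exact: cg]. Qed.

Lemma contRM f g : contR L f -> contR L g -> contR L (fun x => f x * g x).
Proof. by move=> cf cg x; apply: cvgM; [exact: cf|exact: cg]. Qed.

Lemma contR_cst c : contR L (fun=> c).
Proof. by move=> x; exact: cvg_cst. Qed.

Lemma derivR_cont f g : hd f g -> contR L f.
Proof.
move=> [Lg H]; apply: (@contR_ext (fun x => f 0 + prim g x)).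
  by move=> x /H ->.
by apply: contRD; [exact: contR_cst|exact: prim_cont].
Qed.

Lemma derivR_fL2 f g : hd f g -> L2r L f.
Proof. by move=> H; apply: contR_L2 => //; exact: derivR_cont H. Qed.

Lemma derivR_lin a f g f' g' : hd f g -> hd f' g' ->
  hd (fun x => a * f x + f' x) (fun x => a * g x + g' x).
Proof.
move=> [Lg H] [Lg' H']; split=> [|x x0]; first exact: L2r_lin.
rewrite H// H'// prim_lin//; last by case/andP: x0.
ring.
Qed.

Lemma derivR_cst c : hd (fun=> c) (fun=> 0).
Proof.
split=> [|x _]; first exact: L2r_cst.
rewrite /prim Rintegral_cst ?mul0r ?addr0//; exact: measurable_itvR.
Qed.

Lemma derivRD f g f' g' : hd f g -> hd f' g' ->
  hd (fun x => f x + f' x) (fun x => g x + g' x).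
Proof.
move=> H H'; have := derivR_lin 1 H H'; congr (hd _ _); apply/funext => x.
  by rewrite mul1r.
by rewrite mul1r.
Qed.

Lemma derivRZ a f g : hd f g -> hd (fun x => a * f x) (fun x => a * g x).
Proof.
move=> H; have := derivR_lin a H (derivR_cst 0); congr (hd _ _); apply/funext => x.
  by rewrite addr0.
by rewrite addr0.
Qed.

(** Writing [f = f 0 + prim f'] and [g = g 0 + prim g'] leaves terms linear in the primitives and
    the product of two primitives, which is [prim_mul]. *)
Lemma derivRM f f' g g' : hd f f' -> hd g g' ->
  hd (fun x => f x * g x) (fun x => f x * g' x + g x * f' x).
Proof.
move=> Hf Hg; have cf := derivR_cont Hf; have cg := derivR_cont Hg.
case: (Hf) => Lf Ef; case: (Hg) => Lg Eg.
have L1 : L2r L (fun x => f x * g' x) by exact: L2rM_cont.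
have L2 : L2r L (fun x => g x * f' x) by exact: L2rM_cont.
split=> [|x /[dup] x0 /andP[x00 xL]].
  by have := L2r_lin 1 L1 L2; under eq_fun do rewrite mul1r.
have := prim_lin 1 xL L1 L2; under [in X in X -> _]eq_fun do rewrite mul1r.
rewrite mul1r => ->.
have := prim_mul x00 (L2r_int_sub xL Lf) (L2r_int_sub xL Lg).
have E1 : prim (fun x => g x * f' x) x =
    g 0 * prim f' x + \int[mu]_(s in `[0, x]) (f' s * prim g' s).
  have L3 : L2r L (fun s => prim g' s * f' s).
    by apply: L2rM_cont => //; exact: prim_cont.
  rewrite (_ : \int[mu]_(s in _) _ = prim (fun s => prim g' s * f' s) x).
    rewrite -prim_lin//; apply: prim_ext => t /andP[t0 tx].
    by rewrite Eg ?t0 ?(le_trans tx)// mulrDl.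
  by apply: eq_Rintegral => t _; rewrite mulrC.
have E2 : prim (fun x => f x * g' x) x =
    f 0 * prim g' x + \int[mu]_(s in `[0, x]) (g' s * prim f' s).
  have L3 : L2r L (fun s => prim f' s * g' s).
    by apply: L2rM_cont => //; exact: prim_cont.
  rewrite (_ : \int[mu]_(s in _) _ = prim (fun s => prim f' s * g' s) x).
    rewrite -prim_lin//; apply: prim_ext => t /andP[t0 tx].
    by rewrite Ef ?t0 ?(le_trans tx)// mulrDl.
  by apply: eq_Rintegral => t _; rewrite mulrC.
rewrite E1 E2 (Ef x x0) (Eg x x0) => ->; ring.
Qed.

Lemma derivR_ibp f f' g g' : hd f f' -> hd g g' ->
  L2dot L f g' + L2dot L g f' = f L * g L - f 0 * g 0.
Proof.
move=> Hf Hg; have [LM /(_ L)] := derivRM Hf Hg; rewrite lexx ltW// => /(_ isT) E.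
have L1 : L2r L (fun x => f x * g' x).
  by apply: L2rM_cont; [exact: derivR_cont Hf|case: Hg].
have L2 : L2r L (fun x => g x * f' x).
  by apply: L2rM_cont; [exact: derivR_cont Hg|case: Hf].
have := prim_lin 1 (lexx L) L1 L2; under [in X in X -> _]eq_fun do rewrite mul1r.
rewrite E mul1r => ->.
have -> : prim (fun x => f x * g' x) L = L2dot L f g' by [].
have -> : prim (fun x => g x * f' x) L = L2dot L g f' by [].
ring.
Qed.

End WeakDerivative.

(** * Uniqueness of derivatives, Cauchy-Schwarz, reciprocals *)

Section Uniqueness.
Variables (R : realType) (L : R).
Hypothesis L0 : 0 < L.
Local Notation mu := (@lebesgue_measure R).
Local Notation I := (itv0 L).
Local Notation hd := (has_derivR L).
Implicit Types f g h p q : R -> R.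

Lemma ae_neq (c : R) : {ae mu, forall x, x != c}.
Proof.
exists [set c]; split; first exact: measurable_set1.
  exact: lebesgue_measure_set1.
by move=> x /= /negP; rewrite negbK => /eqP.
Qed.

Lemma near_in_oo x : 0 < x < L -> \forall y \near x, 0 <= y <= L.
Proof.
move=> /andP[x0 xL].
have : \forall y \near x, y \in `]0, L[.
  by apply: near_in_itvoo; rewrite in_itv/= x0 xL.
by apply: filterS => y; rewrite in_itv /= => /andP[/ltW-> /ltW->].
Qed.

(** Lebesgue differentiation: almost everywhere [k] is the derivative of its primitive, which is
    locally constant inside the interval. *)
Lemma prim_eq0_ae k : L2r L k -> (forall x, 0 <= x <= L -> prim k x = 0) ->
  {ae mu, forall x, I x -> k x = 0}.
Proof.
move=> Lk k0.
pose kr : R -> R := k \_ I.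
have ikr : mu.-integrable setT (EFin \o kr).
  have -> : EFin \o kr = (EFin \o k) \_ I.
    by apply/funext => s; rewrite /= /kr /patch; case: ifP.
  exact: ((integrable_mkcond _ (measurable_itv0 L)).1 (L2r_int Lk)).
have H := @FTC1 R kr (BLeft 0).
have H1 : forall y, mu.-integrable [set` Interval (BLeft 0) (BRight y)] (EFin \o kr).
  by move=> y; apply: integrableS ikr => //; exact: measurable_itvR.
have H2 : locally_integrable [set: R] kr.
  exact: (integrable_locally (measurable_itv0 L) (L2r_int Lk)).
have := H H1 H2.
move: (ae_neq 0) (ae_neq L).
apply: filterS3; first exact: (ae_filter_ringOfSetsType mu).
move=> x xn0 xnL Hx /itv0P/andP[x0 xL].
have xI : 0 < x < L by rewrite !lt_neqAle x0 xL xnL eq_sym xn0.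
have [|_] := Hx; first by rewrite /= lte_fin; case/andP: xI.
rewrite {2}/kr patchE mem_setE in_itv /= x0 xL /= => <-.
rewrite derive1E (@near_eq_derive _ _ _ _ (cst 0)) ?derive_cst//.
have := near_in_oo xI; apply: filterS => y /andP[y0 yL].
rewrite /= -[RHS](k0 y) ?y0//; apply: eq_Rintegral => t.
by rewrite mem_setE in_itv /= /kr patchE mem_setE in_itv /= => /andP[-> /le_trans->].
Qed.

(** This gives point values to derivatives, which the boundary conditions at 0 and [L] require. By
    continuity the difference is at each interior point the derivative of its zero primitive;
    one-sided limits settle the endpoints. *)
Lemma cont_deriv_uniq f g g' : hd f g -> hd f g' -> contR L g -> contR L g' ->
  forall x, 0 <= x <= L -> g x = g' x.
Proof.
move=> [Lg H] [Lg' H'] cg cg'.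
pose k x := (-1) * g' x + g x.
have ck : contR L k.
  by apply: contRD => //; apply: contRM => //; exact: contR_cst.
have Lk : L2r L k by exact: L2r_lin.
have k0 x : 0 <= x <= L -> prim k x = 0.
  move=> x0; rewrite (@prim_lin _ L)//; last by case/andP: x0.
  by have := H x x0; have := H' x x0; lra.
have [ci cl cr] := (continuous_within_itvP _ L0).1 ck.
have kin x : 0 < x < L -> k x = 0.
  move=> xI; have /andP[x0 xL] := xI.
  have xi : x \in `]0, L[ by rewrite in_itv.
  have [_ <-] := continuous_FTC1_closed xL (L2r_int Lk) x0 (ci x xi).
  rewrite derive1E (@near_eq_derive _ _ _ _ (cst 0)) ?derive_cst//.
  by have := near_in_oo xI; apply: filterS => y /k0.
have k_eq0 x : 0 <= x <= L -> k x = 0.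
  move=> /andP[]; rewrite le_eqVlt => /predU1P[<- _|x0].
    have : k x @[x --> 0^'+] --> (0 : R).
      apply: cvg_near_cst; near=> y; apply: kin.
      by apply/andP; split; near: y; [exact: nbhs_right_gt|exact: nbhs_right_lt].
    by move=> H0; exact: (cvg_unique (@Rhausdorff R) cl H0).
  rewrite le_eqVlt => /predU1P[->|xL]; last by apply: kin; rewrite x0.
  have : k x @[x --> L^'-] --> (0 : R).
    apply: cvg_near_cst; near=> y; apply: kin.
    by apply/andP; split; near: y; [exact: nbhs_left_gt|exact: nbhs_left_lt].
  by move=> H0; exact: (cvg_unique (@Rhausdorff R) cr H0).
by move=> x /k_eq0; rewrite /k; lra.
Unshelve. all: by end_near. Qed.

Lemma L2dot_CS f g : L2r L f -> L2r L g -> L2dot L f g ^+ 2 <= L2dot L f f * L2dot L g g.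
Proof.
move=> Lf Lg.
have H t : 0 <= t ^+ 2 * L2dot L f f + 2 * t * L2dot L f g + L2dot L g g.
  have Lh : L2r L (fun x => t * f x + g x) by exact: L2r_lin.
  have := L2dot_ge0 L (fun x => t * f x + g x).
  rewrite L2dot_lin// ![L2dot L _ (fun x => t * f x + g x)]L2dotC.
  rewrite !L2dot_lin// (L2dotC L g f).
  by congr (0 <= _); ring.
have a0 := L2dot_ge0 L f; have c0 := L2dot_ge0 L g.
move: (L2dot L f f) (L2dot L f g) (L2dot L g g) a0 c0 H => a b c a0 c0 H.
(* For [a = 0] the quadratic in [t] is affine, and unless [b = 0] the chosen [t] gives it the value
   [-1]. For [a] nonzero, [t = - b / a] is the minimiser. *)
have [aE|a1] := eqVneq a 0.
  have := H (- (c + 1) / (2 * b)); rewrite aE mulr0 add0r mul0r.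
  have [->|b0] := eqVneq b 0; first by rewrite expr0n.
  suff -> : 2 * (- (c + 1) / (2 * b)) * b + c = - 1 by lra.
  by field.
have := H (- b / a).
have -> : (- b / a) ^+ 2 * a + 2 * (- b / a) * b + c = (a * c - b ^+ 2) / a by field.
by rewrite pmulr_lge0 ?subr_ge0// invr_gt0 lt_def a1.
Qed.

Lemma L2dot11 : L2dot L (fun=> 1) (fun=> 1) = L.
Proof.
rewrite /L2dot mulr1 (Rintegral_cst mu (measurable_itv0 L)) mul1r.
have := @lebesgue_measure_itv R `[0, L]; rewrite /= lte_fin L0 => ->.
by rewrite -EFinD subr0.
Qed.

(** Cauchy-Schwarz against the indicator of [[0, x]], whose squared norm is at most [L]. *)
Lemma prim_sqr_le g x : L2r L g -> 0 <= x <= L -> prim g x ^+ 2 <= L * L2dot L g g.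
Proof.
move=> Lg /andP[x0 xL].
pose chi : R -> R := \1_(`[0, x]%classic : set (measurableTypeR R)).
have chi01 t : chi t = (t \in `[0, x])%:R by rewrite /chi indicE mem_setE.
have Lchi : L2r L chi.
  apply: (@L2r_bounded _ _ _ 1) => //.
    by apply: measurable_indic; exact: measurable_itvR.
  by move=> t _; rewrite chi01; case: (_ \in _); rewrite ?normr1 ?normr0.
have -> : prim g x = L2dot L g chi.
  rewrite /prim /L2dot.
  have -> : `[0, x]%classic = itv0 L `&` `[0, x]%classic.
    apply/seteqP; split=> t; rewrite /itv0 /= !in_itv /=.
      by move=> /andP[-> tx]; rewrite (le_trans tx) ?tx.
    by case.
  rewrite Rintegral_mkcondr; apply: eq_Rintegral => t _.
  by rewrite patchE mem_setE chi01; case: (_ \in _); rewrite ?mulr1 ?mulr0.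
apply: le_trans (L2dot_CS Lg Lchi) _; rewrite mulrC.
apply: ler_wpM2r; first exact: L2dot_ge0.
rewrite -[leRHS]L2dot11; apply: L2dot_le => //; try exact: L2r_cst.
by move=> t _; rewrite chi01; case: (_ \in _); rewrite ?mulr1 ?mulr0.
Qed.

(** With [f'] continuous, [f] is classically differentiable inside the interval, so the usual
    derivative of [1 / f] can be integrated. It is applied to [P], to solve [P w' = p] for [w']. *)
Lemma derivR_inv f f' (c : R) : 0 < c -> (forall x, 0 <= x <= L -> c <= f x) ->
  hd f f' -> contR L f' ->
  hd (fun x => (f x)^-1) (fun x => - f' x * ((f x)^-1 * (f x)^-1)).
Proof.
move=> c0 fc Hf cf'; have cf := derivR_cont L0 Hf.
have f0 x : 0 <= x <= L -> f x != 0.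
  by move=> /fc h; rewrite gt_eqF// (lt_le_trans c0).
have ci : contR L (fun x => (f x)^-1).
  (* Setting the value 1 outside [[0, L]] keeps the denominator nonzero at every point where
     continuity is checked. *)
  pose ft x := if x \in `[0, L] then f x else 1.
  have ftE x : 0 <= x <= L -> ft x = f x by rewrite /ft in_itv /= => ->.
  apply: (@contR_ext _ _ (fun x => (ft x)^-1)) => [x /ftE ->//|x].
  apply: cvgV.
    by rewrite /ft; case: ifP; rewrite ?oner_eq0// in_itv => /f0.
  by apply: (@contR_ext _ _ f) => // y /ftE.
have cg : contR L (fun x => - f' x * ((f x)^-1 * (f x)^-1)).
  apply: contRM; last exact: contRM.
  by move=> x; apply: cvgN; exact: cf'.
have Lg := contR_L2 cg.
have [Lf' Ef] := Hf.
have [cfi _ _] := (continuous_within_itvP _ L0).1 cf'.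
have df x : 0 < x < L -> is_derive x 1 f (f' x).
  move=> xI; have /andP[x0 xL] := xI.
  have xi : x \in `]0, L[ by rewrite in_itv.
  have [d1 d2] := continuous_FTC1_closed xL (L2r_int Lf') x0 (cfi x xi).
  have nE : \forall y \near x, f 0 + prim f' y = f y.
    by have := near_in_oo xI; apply: filterS => y /Ef ->.
  apply: DeriveDef.
    apply: (@near_eq_derivable _ _ _ (fun y => f 0 + prim f' y) f x 1 nE).
    exact: derivableD.
  rewrite -(@near_eq_derive _ _ _ (fun y => f 0 + prim f' y) f x 1 nE).
  rewrite deriveD// derive_cst add0r.
  by rewrite -derive1E.
split=> // x /andP[]; rewrite le_eqVlt => /predU1P[<- _|x0 xL].
  by rewrite prim0 addr0.
have sub : `[0, x] `<=` `[0, L].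
  by move=> t /=; rewrite !in_itv /= => /andP[-> /le_trans->].
have cix := continuous_subspaceW sub ci.
have cgx := continuous_subspaceW sub cg.
have [_ cl cr] := (continuous_within_itvP _ x0).1 cix.
have dV y : y \in `]0, x[ -> derivable (fun x => (f x)^-1) y 1 /\
    derive1 (fun x => (f x)^-1) y = - f' y * ((f y)^-1 * (f y)^-1).
  rewrite in_itv /= => /andP[y0 yx].
  have yL : 0 < y < L by rewrite y0 (lt_le_trans yx).
  have fy0 : f y != 0 by apply: f0; case/andP: yL => /ltW-> /ltW->.
  have [dfy dfE] := df y yL.
  split; first exact: derivableV.
  by rewrite derive1E deriveV// dfE /GRing.scale /= expr2 invfM; ring.
have := continuous_FTC2 x0 cgx (And3 (fun y yx => (dV y yx).1) cl cr)
  (fun y yx => (dV y yx).2).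
by rewrite /prim /Rintegral => ->; rewrite -EFinB /= addrC subrK.
Qed.

End Uniqueness.

(** * Completeness of L2 *)

Section Completeness.
Variables (R : realType) (L : R).
Hypothesis L0 : 0 < L.
Local Notation mu := (@lebesgue_measure R).
Local Notation mR := (measurableTypeR R).
Local Notation I := (itv0 L).
Implicit Types f g h p q : R -> R.

Let mI := measurable_itv0 L.
Hint Resolve mI : core.

Let nsq f := L2dot L f f.

Lemma nsqE f : L2r L f -> (\int[mu]_(x in I) (f x ^+ 2)%:E = (nsq f)%:E)%E.
Proof.
move=> Lf; rewrite /nsq /L2dot /Rintegral fineK; first by [].
exact: (integrable_fin_num (measurable_itv0 L) (L2_int Lf Lf)).
Qed.

Lemma geometric_cvg (u : nat -> R) (C : R) :
  (forall n, `|u n - u n.+1| <= C * 2^-1 ^+ n) -> cvgn u.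
Proof.
move=> H; apply/cauchy_cvgP; apply: cauchy_exP => e e0.
have half : 0 <= (2^-1 : R) < 1 by lra.
have [] := @geometric_cauchy R R (fun x y => `|x - y|) _ _ _ _ 2^-1 C u half H (e / 2).
- by [].
- by move=> x; rewrite subrr normr0.
- by move=> x y; rewrite distrC.
- by move=> y x z; exact: ler_distD.
- by lra.
move=> n0 Hn0; exists (u n0), n0 => // n n0n; rewrite /= /ball /=.
by apply: (le_lt_trans (Hn0 _ _ (leqnn _) n0n)); lra.
Qed.

Lemma limn_einf_le (u : nat -> \bar R) (B : \bar R) n0 :
  (forall n, (n0 <= n)%N -> (u n <= B)%E) -> (limn_einf u <= B)%E.
Proof.
move=> H; rewrite limn_einf_lim; apply: lime_le; first exact: is_cvg_einfs.
apply: nearW => n; apply: (@le_trans _ _ (u (maxn n0 n))).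
  by apply: ereal_inf_lbound; exists (maxn n0 n) => //=; exact: leq_maxr.
by apply: H; exact: leq_maxl.
Qed.

Section Subsequence.
Variable w : nat -> R -> R.
Hypothesis Lw : forall n, L2r L (w n).
Let dw k x := w k x - w k.+1 x.
Hypothesis w_le : forall j k, (j <= k)%N ->
  nsq (fun x => w j x - w k x) <= 8^-1 ^+ j.
Let dw_le k : nsq (dw k) <= 8^-1 ^+ k. Proof. exact: w_le. Qed.

Let Ldw k : L2r L (dw k).
Proof.
have := L2r_lin (-1) (Lw k.+1) (Lw k).
by congr (L2r _ _); apply/funext => x; rewrite /dw mulN1r addrC.
Qed.

(** The weights [4^k] against the squared increments, at most [8^-k] in the mean, leave the summable
    [2^-k], so [S] is integrable. Where [S] is finite, the increments are at most
    [sqrt (S x) * 2^-k] and the sequence converges pointwise. *)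
Let S (x : mR) : \bar R := (\sum_(0 <= k <oo) (4 ^+ k * dw k x ^+ 2)%:E)%E.

Let mterm k : measurable_fun (I : set mR) (fun x => (4 ^+ k * dw k x ^+ 2)%:E).
Proof.
apply/measurable_EFinP; apply: measurable_funM => //.
by apply: measurable_funX; exact: L2r_meas (Ldw k).
Qed.

Let intS : mu.-integrable I S.
Proof.
apply/integrableP; split.
  by apply: ge0_emeasurable_sum => // k x _ _;
    rewrite lee_fin mulr_ge0 ?sqr_ge0// exprn_ge0.
rewrite (eq_integral S); last first.
  move=> x _; rewrite gee0_abs//; apply: nneseries_ge0 => k _ _.
  by rewrite lee_fin mulr_ge0 ?sqr_ge0// exprn_ge0.
rewrite integral_nneseries//; last first.
  by move=> k x _; rewrite lee_fin mulr_ge0 ?sqr_ge0// exprn_ge0.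
apply: (@le_lt_trans _ _ (EFin 2)); last exact: ltry.
apply: le_trans (epsilon_trick0 xpredT (eps := 2) _); last by [].
apply: lee_nneseries => k _; first by move=> _;
  apply: integral_ge0 => x _; rewrite lee_fin mulr_ge0 ?sqr_ge0// exprn_ge0.
rewrite (_ : (\int[mu]_(x in I) _)%E = (4 ^+ k * nsq (dw k))%:E); last first.
  rewrite EFinM -nsqE// -integralZl//; exact: L2r_sq_int.
rewrite lee_fin; apply: (@le_trans _ _ (4 ^+ k * 8^-1 ^+ k)).
  by apply: ler_wpM2l => //; rewrite exprn_ge0.
rewrite -exprMn natrX exprS invfM mulrA divff// mul1r -exprVn.
by rewrite le_eqVlt; apply/orP; left; apply/eqP; congr (_ ^+ _); lra.
Qed.

Lemma ae_cvg_subseq : exists N : set mR, [/\ measurable N, mu N = 0%E &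
  forall x, I x -> ~ N x -> cvgn (fun k => w k x)].
Proof.
have [N [mN N0 HN]] := integrable_ae (measurable_itv0 L) intS.
exists N; split=> // x Ix Nx.
have Sfin : S x \is a fin_num.
  by apply: contrapT => H; apply: Nx; apply: HN => /(_ Ix).
pose s := fine (S x).
have tk k : 4 ^+ k * dw k x ^+ 2 <= s.
  rewrite -lee_fin /s fineK//.
  have := @nneseries_lim_ge R (fun k => (4 ^+ k * dw k x ^+ 2)%:E) xpredT 0 k.+1.
  have pos j : (0%:E <= (4 ^+ j * dw j x ^+ 2)%:E)%E.
    by rewrite lee_fin mulr_ge0 ?sqr_ge0// exprn_ge0.
  move=> /(_ (fun j _ _ => pos j)); apply: le_trans.
  by rewrite big_nat_recr//= leeDr// sume_ge0.
have s0 : 0 <= s by apply: le_trans (tk 0%N); rewrite mulr_ge0 ?sqr_ge0.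
apply: (@geometric_cvg _ (Num.sqrt s)) => k.
rewrite -(@ler_pXn2r _ 2) ?nnegrE ?mulr_ge0 ?sqrtr_ge0 ?exprn_ge0 ?invr_ge0//.
rewrite exprMn sqr_sqrtr// real_normK ?num_real// -exprM mulnC exprM.
rewrite -(ler_pM2l (x := 4 ^+ k)) ?exprn_gt0//.
apply: le_trans (tk k) _; rewrite mulrCA -exprMn.
by rewrite [X in X ^+ k](_ : _ = 1) ?expr1n ?mulr1//; lra.
Qed.

(** By Fatou, an eventual L2 bound on [g - w k] passes to [g - f]. Taking [g = w 0] shows that [f]
    is in L2; taking for [g] a late term of a Cauchy sequence that contains [w] as a subsequence
    gives convergence of the whole sequence. *)
Lemma subseq_limit : exists f, L2r L f /\
  forall g B, L2r L g -> 0 <= B -> forall k0,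
  (forall k, (k0 <= k)%N -> nsq (fun x => g x - w k x) <= B) ->
  nsq (fun x => g x - f x) <= B.
Proof.
have [N [mN N0 HN]] := ae_cvg_subseq.
(* [chi] kills the null set on which the sequence may diverge, so that the limit exists at every
   point of [I] and is measurable. *)
pose chi : mR -> R := \1_(~` N).
have chiE x : chi x = if x \in N then 0 else 1.
  by rewrite /chi indicE in_setC; case: (x \in N).
have mchi : measurable_fun (I : set mR) chi.
  by apply: measurable_indic; exact: measurableC.
have ae_chi : {ae mu, forall x : mR, chi x = 1}.
  exists N; split=> // x /= H; have [//|Nx] := pselect (N x); exfalso; apply: H.
  by rewrite chiE; case: ifPn => // /set_mem.
pose f (x : mR) : R := limn (fun k => w k x * chi x).
have cf x : I x -> (fun k => w k x * chi x) @ \oo --> f x.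
  move=> Ix; suff : cvgn (fun k => w k x * chi x) by [].
  rewrite chiE; case: ifPn => [_|/negP Nx].
    by under eq_fun do rewrite mulr0; exact: is_cvg_cst.
  under eq_fun do rewrite mulr1; apply: HN => // NN; apply: Nx.
  exact: mem_set.
have mf : measurable_fun (I : set mR) f.
  apply: (measurable_fun_cvg (h := fun k x => w k x * chi x)) => // k.
  by apply: measurable_funM => //; exact: L2r_meas (Lw k).
have LB g (gk : forall k, L2r L (fun x => g x - w k x)) : L2r L g ->
    forall B, 0 <= B -> forall k0,
    (forall k, (k0 <= k)%N -> nsq (fun x => g x - w k x) <= B) ->
    L2r L (fun x => g x * chi x - f x) /\
    nsq (fun x => g x * chi x - f x) <= B.
  move=> Lg B B0 k0 HB.
  pose F k (x : mR) := (((g x - w k x) * chi x) ^+ 2)%:E.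
  have mF k : measurable_fun (I : set mR) (F k).
    apply/measurable_EFinP; apply: measurable_funX.
    by apply: measurable_funM => //; exact: L2r_meas (gk k).
  have F0 k x : I x -> (0 <= F k x)%E by move=> _; rewrite lee_fin sqr_ge0.
  have mgf : measI L (fun x => g x * chi x - f x).
    by apply: measurable_funB => //; apply: measurable_funM => //; exact: L2r_meas.
  have limF x : I x -> limn_einf (F ^~ x) = ((g x * chi x - f x) ^+ 2)%:E.
    move=> Ix; have cF : F ^~ x @ \oo --> ((g x * chi x - f x) ^+ 2)%:E.
      apply: cvg_EFin; first by near=> k.
      have ca : (fun k => (g x - w k x) * chi x) @ \oo --> g x * chi x - f x.
        under eq_fun do rewrite mulrBl.
        by apply: cvgB; [exact: cvg_cst|exact: cf].
      exact: (cvgM ca ca).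
    rewrite is_cvg_limn_einfE; last by apply/cvg_ex; eexists; exact: cF.
    exact/cvg_lim.
  have := fatou mu (measurable_itv0 L) mF F0.
  rewrite (eq_integral (fun x : mR => ((g x * chi x - f x) ^+ 2)%:E)); last first.
    by move=> x /set_mem /limF.
  have intF k : (\int[mu]_(x in I) F k x = (nsq (fun x => g x - w k x))%:E)%E.
    rewrite -nsqE//; apply: ae_eq_integral => //.
    - by apply/measurable_EFinP; apply: measurable_funX; exact: L2r_meas (gk k).
    - move: ae_chi; apply: filterS.
      by move=> x; rewrite /F => -> _; rewrite mulr1.
  have FB : (limn_einf (fun k => \int[mu]_(x in I) F k x) <= B%:E)%E.
    by apply: (@limn_einf_le _ _ k0) => k /HB; rewrite intF lee_fin.
  move=> /le_trans /(_ FB) H.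
  have Lgf : L2r L (fun x => g x * chi x - f x).
    by split=> //; apply: le_lt_trans H _; exact: ltry.
  by split=> //; rewrite -lee_fin -nsqE.
have Lsub g k : L2r L g -> L2r L (fun x => g x - w k x).
  move=> Lg; have := L2r_lin (-1) (Lw k) Lg.
  by congr (L2r _ _); apply/funext => x; rewrite mulN1r addrC.
have ae_mul g : L2r L g -> L2r L (fun x => g x * chi x - f x) -> L2r L f ->
    nsq (fun x => g x - f x) = nsq (fun x => g x * chi x - f x).
  move=> Lg Lgf Lf.
  have L1 : L2r L (fun x => g x - f x).
    have := L2r_lin (-1) Lf Lg.
    by congr (L2r _ _); apply/funext => x; rewrite mulN1r addrC.
  have ae1 : {ae mu, forall x, I x -> g x - f x = g x * chi x - f x}.
    move: ae_chi; apply: filterS.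
    by move=> x -> _; rewrite mulr1.
  by rewrite /nsq (L2dot_ae L1 Lgf L1 ae1) L2dotC (L2dot_ae L1 Lgf Lgf ae1).
have Lf : L2r L f.
  have dsum k : nsq (fun x => w 0%N x - w k x) <= 1.
    exact: w_le.
  have [L1 _] := LB (w 0%N) (fun k => Lsub _ k (Lw 0%N)) (Lw 0%N) 1 ltac:(lra) 0%N
    (fun k _ => dsum k).
  have L2 : L2r L (fun x => w 0%N x * chi x).
    apply: L2r_of_int.
      by apply: measurable_funM => //; exact: L2r_meas.
    apply: le_integrable (L2r_sq_int (Lw 0%N)) => //.
      apply/measurable_EFinP; apply: measurable_funX.
      by apply: measurable_funM => //; exact: L2r_meas.
    move=> x _ /=; rewrite lee_fin chiE; case: ifP => _.
      by rewrite mulr0 expr0n normr0.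
    by rewrite mulr1.
  have := L2r_lin (-1) L1 L2.
  by congr (L2r _ _); apply/funext => x; ring.
exists f; split=> // g B Lg B0 k0 HB.
have [L1 H] := LB g (fun k => Lsub g k Lg) Lg B B0 k0 HB.
by rewrite ae_mul.
Unshelve. all: by end_near. Qed.

End Subsequence.

Lemma L2_complete (u : nat -> R -> R) : (forall n, L2r L (u n)) ->
  (forall e, 0 < e -> exists n0, forall m n, (n0 <= m)%N -> (n0 <= n)%N ->
    nsq (fun x => u m x - u n x) <= e) ->
  exists2 f, L2r L f & forall e, 0 < e ->
    exists n0, forall n, (n0 <= n)%N -> nsq (fun x => u n x - f x) <= e.
Proof.
move=> Lu Cu.
have /choice[N HN] : forall k : nat, exists n0, forall m n,
    (n0 <= m)%N -> (n0 <= n)%N -> nsq (fun x => u m x - u n x) <= 8^-1 ^+ k.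
  by move=> k; apply: Cu; rewrite exprn_gt0// invr_gt0.
(* Summing the thresholds makes [phi k] exceed every [N j] with [j <= k], and the added ones make it
   at least [k]. *)
pose phi k := (\sum_(j < k.+1) (N j).+1)%N.
have phi_ge j k : (j <= k)%N -> (N j <= phi k)%N.
  move=> jk; rewrite /phi (bigD1 (Ordinal (jk : (j < k.+1)%N)))//=.
  by rewrite addSn -addnS leq_addr.
have phi_ge2 k : (k <= phi k)%N.
  rewrite /phi -[leqLHS]/(k.+1.-1) -[k.+1 in leqLHS]card_ord -sum1_card.
  by apply: (leq_trans (leq_pred _)); apply: leq_sum.
have [f [Lf Hf]] := @subseq_limit (fun k => u (phi k)) (fun k => Lu _)
  (fun j k jk => HN j _ _ (phi_ge j j (leqnn j)) (phi_ge j k jk)).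
exists f => // e e0; have [n0 Hn0] := Cu e e0.
exists n0 => n n0n; apply: (Hf _ _ (Lu n) (ltW e0) n0) => k n0k.
by apply: Hn0 => //; exact: leq_trans (phi_ge2 k).
Qed.

End Completeness.

(** * The energy of a pair (w, v) *)

Section MoreSp.
Variables (R : realType) (L : R).
Hypothesis L0 : 0 < L.
Local Notation mu := (@lebesgue_measure R).
Local Notation I := (itv0 L).
Local Notation hd := (has_derivR L).
Implicit Types f g h p q : R -> R.

Lemma derivR_ae_eq f f' g g' : (forall x, 0 <= x <= L -> f x = f' x) ->
  hd f g -> hd f' g' -> {ae mu, forall x, I x -> g x = g' x}.
Proof.
move=> ff /(derivR_ext L0 ff)[Lg H] [Lg' H'].
have /prim_eq0_ae : L2r L (fun x => (-1) * g' x + g x) by exact: L2r_lin.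
have k0 x : 0 <= x <= L -> prim (fun x => (-1) * g' x + g x) x = 0.
  move=> x0; rewrite (@prim_lin _ L)//; last by case/andP: x0.
  by have := H x x0; have := H' x x0; lra.
move=> /(_ k0); apply: filterS; first exact: (ae_filter_ringOfSetsType mu).
by move=> x kx /kx; lra.
Qed.

Lemma L2rD f g : L2r L f -> L2r L g -> L2r L (fun x => f x + g x).
Proof.
move=> Lf Lg; have := L2r_lin 1 Lf Lg.
by congr (L2r _ _); apply/funext => x; rewrite mul1r.
Qed.

Lemma L2rZ a f : L2r L f -> L2r L (fun x => a * f x).
Proof.
move=> Lf; have := L2r_lin a Lf (L2r_cst L 0).
by congr (L2r _ _); apply/funext => x; rewrite addr0.
Qed.

Lemma L2rB f g : L2r L f -> L2r L g -> L2r L (fun x => f x - g x).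
Proof.
move=> Lf Lg; have := L2r_lin (-1) Lg Lf.
by congr (L2r _ _); apply/funext => x; rewrite mulN1r addrC.
Qed.

Lemma L2dotDD f g : L2r L f -> L2r L g ->
  L2dot L (fun x => f x + g x) (fun x => f x + g x) =
  L2dot L f f + 2 * L2dot L f g + L2dot L g g.
Proof.
move=> Lf Lg; have Lfg := L2rD Lf Lg.
rewrite L2dotD// [L2dot L f _]L2dotC [L2dot L g (fun x => f x + g x)]L2dotC.
rewrite !L2dotD// (L2dotC L g f).
ring.
Qed.

Lemma L2dot_AMGM f g : L2r L f -> L2r L g -> 2 * L2dot L f g <= L2dot L f f + L2dot L g g.
Proof.
move=> Lf Lg; have := L2dot_ge0 L (fun x => f x + (-1) * g x).
have Lg' := L2rZ (-1) Lg.
rewrite L2dotDD// (L2dotC L f) !L2dotZ// [L2dot L g (fun x => -1 * g x)]L2dotC.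
rewrite L2dotZ// (L2dotC L g f).
lra.
Qed.

Lemma L2dot_sqD f g : L2r L f -> L2r L g ->
  L2dot L (fun x => f x + g x) (fun x => f x + g x) <= 2 * L2dot L f f + 2 * L2dot L g g.
Proof. by move=> Lf Lg; rewrite L2dotDD//; have := L2dot_AMGM Lf Lg; lra. Qed.

Lemma L2dotZZ a f : L2r L f ->
  L2dot L (fun x => a * f x) (fun x => a * f x) = a ^+ 2 * L2dot L f f.
Proof.
move=> Lf; have Laf := L2rZ a Lf.
by rewrite L2dotZ// L2dotC L2dotZ// mulrA expr2.
Qed.

Lemma L2dot_mul_le f c M : contR L c -> (forall x, 0 <= x <= L -> `|c x| <= M) ->
  L2r L f -> L2dot L (fun x => c x * f x) (fun x => c x * f x) <= M ^+ 2 * L2dot L f f.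
Proof.
move=> cc HM Lf; have Lcf := L2rM_cont cc Lf; have LMf := L2rZ M Lf.
rewrite -L2dotZZ//; apply: L2dot_le => // x /HM.
rewrite ler_norml => /andP[h1 h2].
have : c x ^+ 2 <= M ^+ 2 by nra.
have := sqr_ge0 (f x); nra.
Qed.

Lemma derivR_sqr_le f g x : hd f g -> 0 <= x <= L ->
  f x ^+ 2 <= 2 * f 0 ^+ 2 + 2 * L * L2dot L g g.
Proof.
move=> [Lg H] x0; rewrite H//; have := prim_sqr_le L0 Lg x0.
have := sqr_ge0 (f 0 - prim g x); nra.
Qed.

Lemma L2dot_le_sup f B : L2r L f -> (forall x, 0 <= x <= L -> f x ^+ 2 <= B) ->
  L2dot L f f <= B * L.
Proof.
move=> Lf H; have L1 := L2r_cst L 1; rewrite -{2}(L2dot11 L0) -L2dotZ//.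
apply: L2dot_le => //; first exact: L2rZ.
by move=> x /H; lra.
Qed.

Lemma derivR_L2dot_le f g : hd f g ->
  L2dot L f f <= 2 * L * f 0 ^+ 2 + 2 * L ^+ 2 * L2dot L g g.
Proof.
move=> H; have := L2dot_le_sup (derivR_fL2 L0 H) (fun x => @derivR_sqr_le _ _ x H).
lra.
Qed.

(** Trace inequality: [f(0)^2 <= 2 f(x)^2 + 2 (prim g x)^2], integrated over [x]. *)
Lemma derivR_0_le f g : hd f g ->
  L * f 0 ^+ 2 <= 2 * L2dot L f f + 2 * L ^+ 2 * L2dot L g g.
Proof.
move=> H; have Lf := derivR_fL2 L0 H; have [Lg Hf] := H.
have pt x : 0 <= x <= L -> 1 * (f 0 ^+ 2 - 2 * L * L2dot L g g) <= 2 * f x * f x.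
  move=> x0; rewrite (Hf x x0); have := prim_sqr_le L0 Lg x0.
  have := sqr_ge0 (f 0 + 2 * prim g x); nra.
have := L2dot_le (L2r_cst L 1) (L2r_cst L _) (L2rZ 2 Lf) Lf pt.
have -> c : L2dot L (fun=> 1) (fun=> c) = c * L.
  transitivity (L2dot L (fun=> c * 1) (fun=> 1)).
    by rewrite L2dotC; apply: L2dot_ext => // x _; rewrite mulr1.
  by rewrite (L2dotZ c (L2r_cst L 1) (L2r_cst L 1)) (L2dot11 L0).
rewrite L2dotZ//; lra.
Qed.

End MoreSp.

Section Bounds.
Variables (R : realType) (T : Type) (ok : T -> Prop).

(** Comparison up to a constant uniform over [ok], so that chains of norm comparisons run without
    naming their constants. *)
Definition dominated (E F : T -> R) : Prop :=
  exists2 C, 0 <= C & forall j, ok j -> F j <= C * E j.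

Variable E : T -> R.
Hypothesis E0 : forall j, ok j -> 0 <= E j.

Lemma dominated_le F G : (forall j, ok j -> F j <= G j) -> dominated E G -> dominated E F.
Proof.
by move=> FG [C C0 H]; exists C => // j oj; apply: le_trans (FG j oj) (H j oj).
Qed.

Lemma dominatedD F G : dominated E F -> dominated E G -> dominated E (fun j => F j + G j).
Proof.
move=> [C C0 H] [C' C0' H']; exists (C + C') => [|j oj]; first exact: addr_ge0.
by rewrite mulrDl lerD// ?H ?H'.
Qed.

Lemma dominatedZ c F : 0 <= c -> dominated E F -> dominated E (fun j => c * F j).
Proof.
move=> c0 [C C0 H]; exists (c * C) => [|j oj]; first exact: mulr_ge0.
by rewrite -mulrA; apply: ler_wpM2l => //; exact: H.
Qed.

Lemma dominated_refl : dominated E E.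
Proof. by exists 1 => // j _; rewrite mul1r. Qed.

Lemma dominated_scale c F : 0 < c -> (forall j, ok j -> c * F j <= E j) -> dominated E F.
Proof.
move=> c0 H; exists c^-1; first by rewrite invr_ge0 ltW.
by move=> j oj; rewrite -(ler_pM2l c0) mulrA divff ?gt_eqF// mul1r; exact: H.
Qed.

Lemma dominated_trans F G : dominated E F -> dominated F G -> dominated E G.
Proof.
move=> [C C0 H] [C' C0' H']; exists (C' * C) => [|j oj]; first exact: mulr_ge0.
apply: le_trans (H' j oj) _; rewrite -mulrA; apply: ler_wpM2l => //; exact: H.
Qed.

End Bounds.

(* A pair [(w, v)] together with chosen weak derivatives [w', w'', v']. *)
Record jet (R : realType) := Jet
  { jw : R -> R; jw1 : R -> R; jw2 : R -> R; jv : R -> R; jv1 : R -> R }.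

Definition jlin (R : realType) (a : R) (j k : jet R) := Jet
  (fun x => a * jw j x + jw k x) (fun x => a * jw1 j x + jw1 k x)
  (fun x => a * jw2 j x + jw2 k x) (fun x => a * jv j x + jv k x)
  (fun x => a * jv1 j x + jv1 k x).

Definition isjet (R : realType) (L : R) (j : jet R) : Prop :=
  [/\ has_derivR L (jw j) (jw1 j), has_derivR L (jw1 j) (jw2 j) &
      has_derivR L (jv j) (jv1 j)].

Section Energy.
Variables (R : realType) (L : R).
Hypothesis L0 : 0 < L.
Local Notation mu := (@lebesgue_measure R).
Local Notation I := (itv0 L).
Local Notation hd := (has_derivR L).
Variables (P P1 P2 : R -> R) (P0 : R).
Hypothesis HP : hd P P1.
Hypothesis HP1 : hd P1 P2.
Hypothesis P00 : 0 < P0.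
Hypothesis P0P : forall x, 0 <= x <= L -> P0 <= P x.
Variables (b c0 kap : R).
Hypothesis b0 : 0 < b.
Hypothesis c00 : 0 < c0.
Hypothesis kap0 : 0 < kap.
Implicit Types j k : jet R.

Local Notation ok := (isjet L).
Let cP : contR L P := derivR_cont L0 HP.
Let cP1 : contR L P1 := derivR_cont L0 HP1.
Let i0 : 0 <= (0 : R) <= L. Proof. by rewrite lexx ltW. Qed.
Let iL : 0 <= L <= L. Proof. by rewrite lexx ltW. Qed.
Let PL : 0 < P L. Proof. exact: lt_le_trans (P0P iL). Qed.
Let PO : 0 < P 0. Proof. exact: lt_le_trans (P0P i0). Qed.

(* [jet_flux] is [(P w')']. Along [w_t = v], [v_t = (P w')'] the function
   [u = v + b w] has [u_x = jet_ux] and [u_t = jet_ut]; the boundary condition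
   [(P w')'(L) = - w'(L)] turns [u_t(L)] into [jet_utL]. The form [jet_form] is the wave
   energy of [u] with boundary terms. *)
Definition jet_flux j x := P1 x * jw1 j x + P x * jw2 j x.
Definition jet_ux j x := jv1 j x + b * jw1 j x.
Definition jet_ut j x := jet_flux j x + b * jv j x.
Definition jet_utL j := b * jv j L - jw1 j L.
Definition jet_u0 j := jv j 0 + b * jw j 0.

Definition jet_form j k : R :=
  L2dot L (fun x => P x * jet_ux j x) (jet_ux k) + L2dot L (jet_ut j) (jet_ut k)
  + P L * jet_utL j * jet_utL k + c0 * jet_u0 j * jet_u0 k + kap * jv j 0 * jv k 0.

(** The free data of a pair: two numbers and [w''] rebuild [w], one number and [v'] rebuild [v].
    Both the energy and the natural norm are compared with this form, and completeness is checked
    coordinate by coordinate. *)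
Definition jet_coords j : R := jw j 0 ^+ 2 + jw1 j 0 ^+ 2 + L2dot L (jw2 j) (jw2 j)
  + jv j 0 ^+ 2 + L2dot L (jv1 j) (jv1 j).

Lemma ok_lin a j k : ok j -> ok k -> ok (jlin a j k).
Proof. by move=> [h1 h2 h3] [h4 h5 h6]; split; exact: derivR_lin. Qed.

Lemma L2w j : ok j -> L2r L (jw j).
Proof. by move=> [h1 _ _]; exact: derivR_fL2 h1. Qed.
Lemma L2w1 j : ok j -> L2r L (jw1 j). Proof. by move=> [[]]. Qed.
Lemma L2w2 j : ok j -> L2r L (jw2 j). Proof. by move=> [_ []]. Qed.
Lemma L2v j : ok j -> L2r L (jv j).
Proof. by move=> [_ _ h1]; exact: derivR_fL2 h1. Qed.
Lemma L2v1 j : ok j -> L2r L (jv1 j). Proof. by move=> [_ _ []]. Qed.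
Lemma L2flx j : ok j -> L2r L (jet_flux j).
Proof.
by move=> oj; apply: L2rD; apply: L2rM_cont => //; [exact: L2w1|exact: L2w2].
Qed.
Lemma L2u1 j : ok j -> L2r L (jet_ux j).
Proof. by move=> oj; apply: L2rD; [exact: L2v1|apply: L2rZ; exact: L2w1]. Qed.
Lemma L2u2 j : ok j -> L2r L (jet_ut j).
Proof. by move=> oj; apply: L2rD; [exact: L2flx|apply: L2rZ; exact: L2v]. Qed.
Lemma L2Pu1 j : ok j -> L2r L (fun x => P x * jet_ux j x).
Proof. by move=> oj; apply: L2rM_cont => //; exact: L2u1. Qed.
Hint Resolve L2w L2w1 L2w2 L2v L2v1 L2flx L2u1 L2u2 L2Pu1 : core.

Lemma jet_formC j k : jet_form j k = jet_form k j.
Proof.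
rewrite /jet_form (L2dotC L (jet_ut j)).
rewrite (_ : L2dot L (fun x => P x * jet_ux j x) _ =
    L2dot L (fun x => P x * jet_ux k x) (jet_ux j)).
  ring.
by apply: eq_Rintegral => x _; ring.
Qed.

Lemma jet_form_lin a j k l : ok j -> ok k -> ok l ->
  jet_form (jlin a j k) l = a * jet_form j l + jet_form k l.
Proof.
move=> oj ok_ ol; rewrite /jet_form.
rewrite (_ : (fun x => P x * jet_ux (jlin a j k) x) =
  (fun x => a * (P x * jet_ux j x) + P x * jet_ux k x)); last first.
  by apply/funext => x; rewrite /jet_ux /=; ring.
rewrite (_ : jet_ut (jlin a j k) = (fun x => a * jet_ut j x + jet_ut k x)); last first.
  by apply/funext => x; rewrite /jet_ut /jet_flux /=; ring.
rewrite !L2dot_lin; auto.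
rewrite /jet_utL /jet_u0 /=; ring.
Qed.

Lemma jet_w1_uniq j k : ok j -> ok k ->
  (forall x, 0 <= x <= L -> jw j x = jw k x) ->
  forall x, 0 <= x <= L -> jw1 j x = jw1 k x.
Proof.
move=> [h1 h2 _] [h4 h5 _] ww.
apply: (cont_deriv_uniq L0 (derivR_ext L0 ww h1) h4).
  exact: derivR_cont h2.
exact: derivR_cont h5.
Qed.

(** The form depends on the functions only: [w'] is determined everywhere, being continuous, and
    [w''], [v'] almost everywhere, which suffices under the integrals. *)
Lemma jet_form_uniq j k l : ok j -> ok k -> ok l ->
  (forall x, 0 <= x <= L -> jw j x = jw k x) ->
  (forall x, 0 <= x <= L -> jv j x = jv k x) -> jet_form j l = jet_form k l.
Proof.
move=> oj ok_ ol ww vv; have w1 := jet_w1_uniq oj ok_ ww.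
have [h1 h2 h3] := oj; have [h4 h5 h6] := ok_.
have ae2 := derivR_ae_eq L0 w1 h2 h5; have ae1 := derivR_ae_eq L0 vv h3 h6.
rewrite /jet_form; congr (_ + _ + _ + _ + _).
- apply: L2dot_ae; auto.
  move: ae1; apply: filterS; first exact: (ae_filter_ringOfSetsType mu).
  by move=> x H Ix; rewrite /jet_ux H// w1//; exact/itv0P.
- apply: L2dot_ae; auto.
  move: ae2; apply: filterS; first exact: (ae_filter_ringOfSetsType mu).
  move=> x H Ix; rewrite /jet_ut /jet_flux H//.
  by have /itv0P Ix' := Ix; rewrite w1// vv.
- by rewrite /jet_utL w1// vv.
- by rewrite /jet_u0 vv// ww.
- by rewrite vv.
Qed.

Lemma jet_form_sq j : jet_form j j = L2dot L (fun x => P x * jet_ux j x) (jet_ux j)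
  + L2dot L (jet_ut j) (jet_ut j) + P L * jet_utL j ^+ 2 + c0 * jet_u0 j ^+ 2
  + kap * jv j 0 ^+ 2.
Proof. by rewrite /jet_form !expr2 !mulrA. Qed.

Lemma L2dot_wt_ge j f : L2r L f -> P0 * L2dot L f f <= L2dot L (fun x => P x * f x) f.
Proof.
move=> Lf; have LPf : L2r L (fun x => P x * f x) by exact: L2rM_cont.
rewrite -L2dotZ//; apply: L2dot_le => //; first exact: L2rZ.
by move=> x /P0P h; have := sqr_ge0 (f x); nra.
Qed.

Lemma jet_form_ge0 j : ok j -> 0 <= jet_form j j.
Proof.
move=> oj; rewrite jet_form_sq.
have h1 := L2dot_wt_ge j (L2u1 oj); have h2 := L2dot_ge0 L (jet_ux j).
have h3 := L2dot_ge0 L (jet_ut j).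
have h4 := mulr_ge0 (ltW PL) (sqr_ge0 (jet_utL j)).
have h5 := mulr_ge0 (ltW c00) (sqr_ge0 (jet_u0 j)).
have h6 := mulr_ge0 (ltW kap0) (sqr_ge0 (jv j 0)).
have h7 := mulr_ge0 (ltW P00) h2; lra.
Qed.

Let E j := jet_form j j.
Let E0 j : ok j -> 0 <= E j := @jet_form_ge0 j.
Local Notation bdE := (dominated ok E).
Local Notation bdQ := (dominated ok jet_coords).

(* The sum of squares that remains when the cross terms of [jet_form j j] are
   integrated by parts. *)
Definition jet_bulk j := L2dot L (fun x => P x * jv1 j x) (jv1 j)
  + b ^+ 2 * L2dot L (fun x => P x * jw1 j x) (jw1 j)
  + L2dot L (jet_flux j) (jet_flux j) + b ^+ 2 * L2dot L (jv j) (jv j).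

Lemma derivR_flx j : ok j -> hd (fun x => P x * jw1 j x) (jet_flux j).
Proof.
move=> [_ h2 _]; have := derivRM L0 HP h2; congr (hd _ _).
by apply/funext => x; rewrite /jet_flux; ring.
Qed.

(** The cross terms [2 b <P w', v'>] and [2 b <v, (P w')'>] add up to the boundary values of
    [2 b P w' v]. The value at [L] cancels the cross term of [P L * jet_utL j ^+ 2]; the one at 0
    stays and has no sign. *)
Lemma jet_form_expand j : ok j -> jet_form j j = jet_bulk j
  + P L * (jw1 j L ^+ 2 + b ^+ 2 * jv j L ^+ 2) - 2 * b * P 0 * jw1 j 0 * jv j 0
  + c0 * jet_u0 j ^+ 2 + kap * jv j 0 ^+ 2.
Proof.
move=> oj; rewrite jet_form_sq /jet_bulk.
have [_ _ h3] := oj.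
have ibp := derivR_ibp L0 (derivR_flx oj) h3.
have LPv1 : L2r L (fun x => P x * jv1 j x) by apply: L2rM_cont; auto.
have LPw1 : L2r L (fun x => P x * jw1 j x) by apply: L2rM_cont; auto.
have -> : L2dot L (fun x => P x * jet_ux j x) (jet_ux j) =
    L2dot L (fun x => P x * jv1 j x) (jv1 j)
    + 2 * b * L2dot L (fun x => P x * jw1 j x) (jv1 j)
    + b ^+ 2 * L2dot L (fun x => P x * jw1 j x) (jw1 j).
  rewrite (_ : (fun x => P x * jet_ux j x) =
      (fun x => b * (P x * jw1 j x) + P x * jv1 j x)); last first.
    by apply/funext => x; rewrite /jet_ux; ring.
  rewrite L2dot_lin; auto.
  have E1 (f : R -> R) : L2r L f ->
      L2dot L f (jet_ux j) = L2dot L f (jv1 j) + b * L2dot L f (jw1 j).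
    move=> Lf; rewrite L2dotC L2dotD; auto; last by apply: L2rZ; auto.
    by rewrite L2dotZ; auto; rewrite !(L2dotC L f).
  rewrite !E1; auto.
  have -> : L2dot L (fun x => P x * jv1 j x) (jw1 j) =
      L2dot L (fun x => P x * jw1 j x) (jv1 j).
    by apply: eq_Rintegral => x _; ring.
  ring.
have -> : L2dot L (jet_ut j) (jet_ut j) = L2dot L (jet_flux j) (jet_flux j)
    + 2 * b * L2dot L (jv j) (jet_flux j) + b ^+ 2 * L2dot L (jv j) (jv j).
  rewrite /jet_ut L2dotDD; auto; last by apply: L2rZ; auto.
  rewrite L2dotZZ; auto; rewrite (L2dotC L (jet_flux j)) L2dotZ; auto; ring.
have -> : L2dot L (fun x => P x * jw1 j x) (jv1 j) =
    P L * jw1 j L * jv j L - P 0 * jw1 j 0 * jv j 0 - L2dot L (jv j) (jet_flux j).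
  by rewrite -ibp; ring.
rewrite /jet_utL; ring.
Qed.

Lemma jet_bulk_ge j : ok j -> [/\ 0 <= L2dot L (fun x => P x * jv1 j x) (jv1 j),
  0 <= b ^+ 2 * L2dot L (fun x => P x * jw1 j x) (jw1 j),
  0 <= L2dot L (jet_flux j) (jet_flux j) & 0 <= b ^+ 2 * L2dot L (jv j) (jv j)].
Proof.
move=> oj; split.
- apply: le_trans (L2dot_wt_ge j (L2v1 oj)).
  by apply: mulr_ge0; [exact: ltW|exact: L2dot_ge0].
- apply: mulr_ge0; first exact: sqr_ge0.
  apply: le_trans (L2dot_wt_ge j (L2w1 oj)).
  by apply: mulr_ge0; [exact: ltW|exact: L2dot_ge0].
- exact: L2dot_ge0.
- by apply: mulr_ge0; [exact: sqr_ge0|exact: L2dot_ge0].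
Qed.

Lemma bdB_Pv1 : dominated ok jet_bulk (fun j => L2dot L (jv1 j) (jv1 j)).
Proof.
apply: (dominated_scale P00) => j oj; have [? ? ? ?] := jet_bulk_ge oj.
by have := L2dot_wt_ge j (L2v1 oj); rewrite /jet_bulk; lra.
Qed.

Lemma bdB_flx : dominated ok jet_bulk (fun j => L2dot L (jet_flux j) (jet_flux j)).
Proof.
apply: (@dominated_scale _ _ _ _ 1) => // j oj.
by have [? ? ? ?] := jet_bulk_ge oj; rewrite /jet_bulk; lra.
Qed.

Lemma bdB_Pw1 : dominated ok jet_bulk (fun j => L2dot L (fun x => P x * jw1 j x) (jw1 j)).
Proof.
apply: (@dominated_scale _ _ _ _ (b ^+ 2)) => [|j oj]; first by rewrite exprn_gt0.
by have [? ? ? ?] := jet_bulk_ge oj; rewrite /jet_bulk; lra.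
Qed.

Lemma bdB_w1 : dominated ok jet_bulk (fun j => L2dot L (jw1 j) (jw1 j)).
Proof.
apply: (dominated_trans bdB_Pw1); apply: (dominated_scale P00) => j oj.
exact: (L2dot_wt_ge j (L2w1 oj)).
Qed.

(** [P w''] is the flux minus [P' w']; both are controlled by the bulk, and [P] is bounded below. *)
Lemma bdB_w2 : dominated ok jet_bulk (fun j => L2dot L (jw2 j) (jw2 j)).
Proof.
have [M1 HM1] := contR_bounded cP1.
have P02 : 0 < P0 ^+ 2 by rewrite exprn_gt0.
apply: (@dominated_trans _ _ _ _ (fun j => 2 * L2dot L (jet_flux j) (jet_flux j) +
    2 * M1 ^+ 2 * L2dot L (jw1 j) (jw1 j))).
  apply: dominatedD; apply: dominatedZ => //; [exact: bdB_flx| |exact: bdB_w1].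
  by have := sqr_ge0 M1; lra.
apply: (dominated_scale P02) => j oj.
have L1 : L2r L (fun x => P1 x * jw1 j x) by apply: L2rM_cont; auto.
have L2 : L2r L (fun x => P x * jw2 j x) by apply: L2rM_cont; auto.
have := L2dot_sqD (L2flx oj) (L2rZ (-1) L1); rewrite L2dotZZ// sqrrN expr1n mul1r.
have := L2dot_mul_le cP1 HM1 (L2w1 oj).
have : P0 ^+ 2 * L2dot L (jw2 j) (jw2 j) <=
    L2dot L (fun x => P x * jw2 j x) (fun x => P x * jw2 j x).
  rewrite -L2dotZZ//; last by auto.
  apply: L2dot_le => //; try (apply: L2rZ; auto).
  move=> x /P0P h; have := sqr_ge0 (jw2 j x).
  have : P0 ^+ 2 <= P x ^+ 2 by move: P00; nra.
  nra.
rewrite (_ : (fun x => jet_flux j x + _) = (fun x => P x * jw2 j x)); last first.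
  by apply/funext => x; rewrite /jet_flux; ring.
lra.
Qed.

(** The trace inequality for [P w'], whose weak derivative is the flux. *)
Lemma bdB_w10 : dominated ok jet_bulk (fun j => jw1 j 0 ^+ 2).
Proof.
have [M HM] := contR_bounded cP.
have K0 : 0 < P 0 ^+ 2 * L by rewrite mulr_gt0// exprn_gt0.
apply: (@dominated_trans _ _ _ _ (fun j => 2 * M ^+ 2 * L2dot L (jw1 j) (jw1 j) +
    2 * L ^+ 2 * L2dot L (jet_flux j) (jet_flux j))).
  apply: dominatedD; apply: dominatedZ; [|exact: bdB_w1| |exact: bdB_flx].
    by have := sqr_ge0 M; lra.
  by have := sqr_ge0 L; lra.
apply: (dominated_scale K0) => j oj.
have := derivR_0_le L0 (derivR_flx oj); have := L2dot_mul_le cP HM (L2w1 oj).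
rewrite exprMn; lra.
Qed.

Lemma bdE_v0 : bdE (fun j => jv j 0 ^+ 2).
Proof.
apply: (dominated_scale kap0) => j oj; rewrite /E jet_form_sq.
have h1 := le_trans (mulr_ge0 (ltW P00) (L2dot_ge0 L (jet_ux j)))
  (L2dot_wt_ge j (L2u1 oj)).
have h3 := L2dot_ge0 L (jet_ut j).
have h4 := mulr_ge0 (ltW PL) (sqr_ge0 (jet_utL j)).
have h5 := mulr_ge0 (ltW c00) (sqr_ge0 (jet_u0 j)); lra.
Qed.

Lemma bdE_m : bdE (fun j => jet_u0 j ^+ 2).
Proof.
apply: (dominated_scale c00) => j oj; rewrite /E jet_form_sq.
have h1 := le_trans (mulr_ge0 (ltW P00) (L2dot_ge0 L (jet_ux j)))
  (L2dot_wt_ge j (L2u1 oj)).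
have h3 := L2dot_ge0 L (jet_ut j).
have h4 := mulr_ge0 (ltW PL) (sqr_ge0 (jet_utL j)).
have h6 := mulr_ge0 (ltW kap0) (sqr_ge0 (jv j 0)); lra.
Qed.

(** The indefinite term at 0 is split by Young's inequality: [w'(0)^2] is a trace controlled by the
    bulk, and [v(0)^2] is paid by the [kap] term of the energy. *)
Lemma bdE_B : bdE jet_bulk.
Proof.
have [C1 C10 HC1] := bdB_w10.
(* Young's weight [1 / (C1 + 1)] makes the [w'(0)^2] part at most one copy of the bulk, out of the
   two contained in [2 * E j]; [D] is the resulting coefficient of [v(0)^2]. *)
pose D := (2 * b * P 0) ^+ 2 * (C1 + 1).
apply: (@dominated_trans _ _ _ _ (fun j => 2 * E j + D * jv j 0 ^+ 2)).
  apply: dominatedD; first by apply: dominatedZ; [|exact: dominated_refl].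
  by apply: dominatedZ; [rewrite mulr_ge0 ?sqr_ge0 ?addr_ge0|exact: bdE_v0].
apply: (@dominated_scale _ _ _ _ 1) => // j oj.
rewrite /E jet_form_expand//; have h1 := HC1 j oj.
have h4 : 0 <= P L * (jw1 j L ^+ 2 + b ^+ 2 * jv j L ^+ 2).
  apply: mulr_ge0; first exact: ltW.
  by apply: addr_ge0; [|apply: mulr_ge0]; exact: sqr_ge0.
have h5 := mulr_ge0 (ltW c00) (sqr_ge0 (jet_u0 j)).
have h6 := mulr_ge0 (ltW kap0) (sqr_ge0 (jv j 0)).
have h7 : 2 * (2 * b * P 0 * jw1 j 0 * jv j 0) <=
    jw1 j 0 ^+ 2 / (C1 + 1) + D * jv j 0 ^+ 2.
  have C11 : 0 < C1 + 1 by lra.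
  rewrite -(ler_pM2l C11) mulrDr [_ * (_ / _)]mulrC divfK ?gt_eqF// /D.
  have := sqr_ge0 (jw1 j 0 - (C1 + 1) * (2 * b * P 0) * jv j 0); nra.
have h8 : jw1 j 0 ^+ 2 / (C1 + 1) <= jet_bulk j.
  rewrite ler_pdivrMr; last by lra.
  have [? ? ? ?] := jet_bulk_ge oj.
  have : 0 <= jet_bulk j by rewrite /jet_bulk; lra.
  lra.
lra.
Qed.

Lemma Q_le_E : bdE jet_coords.
Proof.
have bdw0 : bdE (fun j => jw j 0 ^+ 2).
  (* [b * w(0)] is the difference of [jet_u0 j] and [v(0)], both controlled by boundary terms of the
     energy. *)
  apply: (@dominated_trans _ _ _ _ (fun j => 2 * jet_u0 j ^+ 2 + 2 * jv j 0 ^+ 2)).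
    by apply: dominatedD; apply: dominatedZ => //; [exact: bdE_m|exact: bdE_v0].
  apply: (@dominated_scale _ _ _ _ (b ^+ 2)) => [|j oj]; first by rewrite exprn_gt0.
  have := sqr_ge0 (jet_u0 j + jv j 0); rewrite /jet_u0; nra.
apply: dominatedD; last exact: (dominated_trans bdE_B bdB_Pv1).
apply: dominatedD; last exact: bdE_v0.
apply: dominatedD; last exact: (dominated_trans bdE_B bdB_w2).
by apply: dominatedD => //; exact: (dominated_trans bdE_B bdB_w10).
Qed.


Lemma E_ge0 j : ok j -> 0 <= jet_form j j. Proof. exact: E0. Qed.

Let bdQ_proj F : (forall j, ok j -> F j <= jet_coords j) -> bdQ F.
Proof. by move=> H; apply: (@dominated_scale _ _ _ _ 1) => // j oj; rewrite mul1r H. Qed.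

Let jet_coords_terms j : [/\ 0 <= jw j 0 ^+ 2, 0 <= jw1 j 0 ^+ 2,
  0 <= L2dot L (jw2 j) (jw2 j), 0 <= jv j 0 ^+ 2 & 0 <= L2dot L (jv1 j) (jv1 j)].
Proof. by split; rewrite ?sqr_ge0 ?L2dot_ge0. Qed.

Let bdQ_w0 : bdQ (fun j => jw j 0 ^+ 2).
Proof. by apply: bdQ_proj => j _; have [] := jet_coords_terms j; rewrite /jet_coords; lra. Qed.
Let bdQ_w10 : bdQ (fun j => jw1 j 0 ^+ 2).
Proof. by apply: bdQ_proj => j _; have [] := jet_coords_terms j; rewrite /jet_coords; lra. Qed.
Let bdQ_w2 : bdQ (fun j => L2dot L (jw2 j) (jw2 j)).
Proof. by apply: bdQ_proj => j _; have [] := jet_coords_terms j; rewrite /jet_coords; lra. Qed.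
Let bdQ_v0 : bdQ (fun j => jv j 0 ^+ 2).
Proof. by apply: bdQ_proj => j _; have [] := jet_coords_terms j; rewrite /jet_coords; lra. Qed.
Let bdQ_v1 : bdQ (fun j => L2dot L (jv1 j) (jv1 j)).
Proof. by apply: bdQ_proj => j _; have [] := jet_coords_terms j; rewrite /jet_coords; lra. Qed.

Let bdQ_hd (f g : jet R -> R -> R) : (forall j, ok j -> hd (f j) (g j)) ->
  bdQ (fun j => f j 0 ^+ 2) -> bdQ (fun j => L2dot L (g j) (g j)) ->
  bdQ (fun j => L2dot L (f j) (f j)) /\ bdQ (fun j => f j L ^+ 2).
Proof.
move=> H b1 b2; split.
  apply: (dominated_le (G := fun j => 2 * L * f j 0 ^+ 2 +
      2 * L ^+ 2 * L2dot L (g j) (g j))).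
    by move=> j oj; exact: derivR_L2dot_le (H j oj).
  by apply: dominatedD; apply: dominatedZ => //; rewrite mulr_ge0// ?sqr_ge0// ltW.
apply: (dominated_le (G := fun j => 2 * f j 0 ^+ 2 + 2 * L * L2dot L (g j) (g j))).
  by move=> j oj; exact: derivR_sqr_le (H j oj) iL.
by apply: dominatedD; apply: dominatedZ => //; rewrite mulr_ge0// ltW.
Qed.

Let bdQ_w1 : bdQ (fun j => L2dot L (jw1 j) (jw1 j)) /\ bdQ (fun j => jw1 j L ^+ 2).
Proof. by apply: (bdQ_hd (g := @jw2 R)) => // j []. Qed.
Let bdQ_w : bdQ (fun j => L2dot L (jw j) (jw j)) /\ bdQ (fun j => jw j L ^+ 2).
Proof. by apply: (bdQ_hd (g := @jw1 R)) => [j []| |] //; exact: bdQ_w1.1. Qed.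
Let bdQ_v : bdQ (fun j => L2dot L (jv j) (jv j)) /\ bdQ (fun j => jv j L ^+ 2).
Proof. by apply: (bdQ_hd (g := @jv1 R)) => // j []. Qed.

Lemma E_le_Q : bdQ E.
Proof.
have [M HM] := contR_bounded cP; have [M1 HM1] := contR_bounded cP1.
have bu1 : bdQ (fun j => L2dot L (jet_ux j) (jet_ux j)).
  apply: (dominated_le (G := fun j => 2 * L2dot L (jv1 j) (jv1 j) +
      2 * b ^+ 2 * L2dot L (jw1 j) (jw1 j))).
    move=> j oj; apply: le_trans (L2dot_sqD (L2v1 oj) (L2rZ b (L2w1 oj))) _.
    by rewrite L2dotZZ ?mulrA//; auto.
  apply: dominatedD; apply: dominatedZ => //; first by rewrite mulr_ge0// sqr_ge0.
  exact: bdQ_w1.1.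
have bfl : bdQ (fun j => L2dot L (jet_flux j) (jet_flux j)).
  apply: (dominated_le (G := fun j => 2 * M1 ^+ 2 * L2dot L (jw1 j) (jw1 j) +
      2 * M ^+ 2 * L2dot L (jw2 j) (jw2 j))).
    move=> j oj.
    apply: le_trans (L2dot_sqD (L2rM_cont cP1 (L2w1 oj)) (L2rM_cont cP (L2w2 oj))) _.
    have := L2dot_mul_le cP1 HM1 (L2w1 oj); have := L2dot_mul_le cP HM (L2w2 oj); lra.
  by apply: dominatedD; (apply: dominatedZ; [by rewrite mulr_ge0// sqr_ge0|]);
    [exact: bdQ_w1.1|exact: bdQ_w2].
have bu2 : bdQ (fun j => L2dot L (jet_ut j) (jet_ut j)).
  apply: (dominated_le (G := fun j => 2 * L2dot L (jet_flux j) (jet_flux j) +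
      2 * b ^+ 2 * L2dot L (jv j) (jv j))).
    move=> j oj; apply: le_trans (L2dot_sqD (L2flx oj) (L2rZ b (L2v oj))) _.
    by rewrite L2dotZZ ?mulrA//; auto.
  apply: dominatedD; apply: dominatedZ => //; first by rewrite mulr_ge0// sqr_ge0.
  exact: bdQ_v.1.
apply: (dominated_le (G := fun j => (M ^+ 2 + 1) / 2 * L2dot L (jet_ux j) (jet_ux j)
  + L2dot L (jet_ut j) (jet_ut j) + P L * (2 * b ^+ 2 * jv j L ^+ 2 + 2 * jw1 j L ^+ 2)
  + c0 * (2 * jv j 0 ^+ 2 + 2 * b ^+ 2 * jw j 0 ^+ 2) + kap * jv j 0 ^+ 2)).
  move=> j oj; rewrite /E jet_form_sq.
  have h1 := L2dot_AMGM (L2Pu1 oj) (L2u1 oj); have h2 := L2dot_mul_le cP HM (L2u1 oj).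
  have h3 : jet_utL j ^+ 2 <= 2 * b ^+ 2 * jv j L ^+ 2 + 2 * jw1 j L ^+ 2.
    by rewrite /jet_utL; have := sqr_ge0 (b * jv j L + jw1 j L); nra.
  have h4 : jet_u0 j ^+ 2 <= 2 * jv j 0 ^+ 2 + 2 * b ^+ 2 * jw j 0 ^+ 2.
    by rewrite /jet_u0; have := sqr_ge0 (jv j 0 - b * jw j 0); nra.
  have := ler_wpM2l (ltW PL) h3; have := ler_wpM2l (ltW c00) h4; lra.
have b2 : 0 <= 2 * b ^+ 2 by rewrite mulr_ge0// sqr_ge0.
apply: dominatedD; last by apply: dominatedZ => //; exact: ltW.
apply: dominatedD; last first.
  by apply: dominatedZ; [exact: ltW|apply: dominatedD; apply: dominatedZ].
apply: dominatedD; last first.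
  apply: dominatedZ; first exact: ltW.
  by apply: dominatedD; apply: dominatedZ => //; [exact: bdQ_v.2|exact: bdQ_w1.2].
apply: dominatedD => //; apply: dominatedZ => //.
by have := sqr_ge0 M; lra.
Qed.

Definition jet_norm j : R := L2dot L (jw j) (jw j) + L2dot L (jw1 j) (jw1 j)
  + L2dot L (jw2 j) (jw2 j) + L2dot L (jv j) (jv j) + L2dot L (jv1 j) (jv1 j)
  + jv j L ^+ 2 + jv j 0 ^+ 2.

Lemma jet_norm_ge0 j : 0 <= jet_norm j.
Proof. by rewrite /jet_norm !addr_ge0// ?sqr_ge0//; exact: L2dot_ge0. Qed.

Lemma N_le_E : bdE jet_norm.
Proof.
apply: (dominated_trans Q_le_E).
do 6 (apply: dominatedD; last by first [exact: bdQ_v0 | exact: bdQ_v.2 | exact: bdQ_v1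
  | exact: bdQ_v.1 | exact: bdQ_w2 | exact: bdQ_w1.1]).
exact: bdQ_w.1.
Qed.

Lemma E_le_N : dominated ok jet_norm E.
Proof.
apply: (dominated_trans _ E_le_Q).
have [h1 h2] : (0 <= 2 :> R) /\ 0 <= 2 * L ^+ 2.
  by rewrite mulr_ge0 ?sqr_ge0.
have proj F : (forall j, ok j -> F j <= jet_norm j) -> dominated ok jet_norm F.
  by move=> H; apply: (@dominated_scale _ _ _ _ 1) => // j oj; rewrite mul1r H.
have Nt j : [/\ 0 <= L2dot L (jw j) (jw j), 0 <= L2dot L (jw1 j) (jw1 j),
    0 <= L2dot L (jw2 j) (jw2 j), 0 <= L2dot L (jv j) (jv j) &
    0 <= L2dot L (jv1 j) (jv1 j)].
  by split; exact: L2dot_ge0.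
have Nt' j := (sqr_ge0 (jv j L), sqr_ge0 (jv j 0)).
apply: dominatedD; last by apply: proj => j _;
  have [] := Nt j; have [] := Nt' j; rewrite /jet_norm; lra.
apply: dominatedD; last by apply: proj => j _;
  have [] := Nt j; have [] := Nt' j; rewrite /jet_norm; lra.
apply: dominatedD; last by apply: proj => j _;
  have [] := Nt j; have [] := Nt' j; rewrite /jet_norm; lra.
have bw1 : dominated ok jet_norm (fun j => L2dot L (jw1 j) (jw1 j)).
  by apply: proj => j _; have [] := Nt j; have [] := Nt' j; rewrite /jet_norm; lra.
apply: dominatedD.
  apply: (@dominated_trans _ _ _ _ (fun j => 2 * L2dot L (jw j) (jw j) +
      2 * L ^+ 2 * L2dot L (jw1 j) (jw1 j))).
    apply: dominatedD; apply: dominatedZ => //.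
    by apply: proj => j _; have [] := Nt j; have [] := Nt' j; rewrite /jet_norm; lra.
  by apply: (dominated_scale L0) => j [H _ _]; exact: derivR_0_le H.
apply: (@dominated_trans _ _ _ _ (fun j => 2 * L2dot L (jw1 j) (jw1 j) +
    2 * L ^+ 2 * L2dot L (jw2 j) (jw2 j))).
  apply: dominatedD; apply: dominatedZ => //.
  by apply: proj => j _; have [] := Nt j; have [] := Nt' j; rewrite /jet_norm; lra.
by apply: (dominated_scale L0) => j [_ H _]; exact: derivR_0_le H.
Qed.

End Energy.

(** * The energy space *)

Section Space.
Variables (R : realType) (L : R).

Definition represents (j : jet R) (z : (R -> R) * (R -> R)) : Prop :=
  [/\ isjet L j, jw j = z.1 & jv j = z.2].

(* Functions vanish outside [0, L], so that equality in the space is Leibniz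
   equality. *)
Definition in_energy_space : {pred (R -> R) * (R -> R)} := fun z =>
  `[< (forall x, ~~ (0 <= x <= L) -> z.1 x = 0 /\ z.2 x = 0) /\
      exists j, represents j z >].

Record energy_space :=
  EnergySpace { wv :> (R -> R) * (R -> R); _ : wv \in in_energy_space }.

HB.instance Definition _ := [isSub for wv].
HB.instance Definition _ := [Choice of energy_space by <:].

Lemma in_energy_spaceP z :
  reflect ((forall x, ~~ (0 <= x <= L) -> z.1 x = 0 /\ z.2 x = 0) /\
      exists j, represents j z) (z \in in_energy_space).
Proof. exact: asboolP. Qed.

Lemma energy_space_submod : submod_closed in_energy_space.
Proof.
split.
  apply/in_energy_spaceP; split=> //.
  exists (Jet (fun=> 0) (fun=> 0) (fun=> 0) (fun=> 0) (fun=> 0)).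
  by split=> //; split; exact: derivR_cst.
move=> a z z' /in_energy_spaceP[s1 [j [oj j1 j2]]] /in_energy_spaceP[s2 [k [ok k1 k2]]].
apply/in_energy_spaceP; split.
  move=> x xI; have [h1 h2] := s1 x xI; have [h3 h4] := s2 x xI.
  split; [change (a * z.1 x + z'.1 x = 0)|change (a * z.2 x + z'.2 x = 0)].
    by rewrite h1 h3 mulr0 addr0.
  by rewrite h2 h4 mulr0 addr0.
exists (jlin a j k); split; first exact: ok_lin.
  by rewrite /= j1 k1.
by rewrite /= j2 k2.
Qed.

HB.instance Definition _ :=
  GRing.isSubmodClosed.Build R ((R -> R) * (R -> R))%type in_energy_space
    energy_space_submod.
HB.instance Definition _ := [SubChoice_isSubLmodule of energy_space by <:].

End Space.

Section SpaceLemmas.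
Variables (R : realType) (L : R).
Hypothesis L0 : 0 < L.
Local Notation X := (energy_space L).

Lemma energy_space_supp (z : X) x : ~~ (0 <= x <= L) -> (wv z).1 x = 0 /\ (wv z).2 x = 0.
Proof. by have /in_energy_spaceP[H _] := valP z; exact: H. Qed.

Lemma energy_space_jet (z : X) : exists j, represents L j (wv z).
Proof. by have /in_energy_spaceP[_ H] := valP z. Qed.

Definition jetof (z : X) : jet R := sval (cid (energy_space_jet z)).

Lemma jetofP z : represents L (jetof z) (wv z).
Proof. exact: (svalP (cid (energy_space_jet z))). Qed.

Lemma energy_space_ext (z z' : X) : (forall x, 0 <= x <= L ->
  (wv z).1 x = (wv z').1 x /\ (wv z).2 x = (wv z').2 x) -> z = z'.
Proof.
move=> H; apply: val_inj; apply: injective_projections; apply/funext => x;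
  (have [/H[h1 h2]|xI] := boolP (0 <= x <= L); first by []);
  have [h1 h2] := energy_space_supp z xI;
  have [h3 h4] := energy_space_supp z' xI.
- exact: etrans h1 (esym h3).
- exact: etrans h2 (esym h4).
Qed.

Lemma energy_space_of_jet j : isjet L j -> exists z : X, forall x, 0 <= x <= L ->
  (wv z).1 x = jw j x /\ (wv z).2 x = jv j x.
Proof.
move=> [h1 h2 h3].
pose r (f : R -> R) x := if 0 <= x <= L then f x else 0.
have rE f x : 0 <= x <= L -> f x = r f x by rewrite /r => ->.
have H : (r (jw j), r (jv j)) \in in_energy_space L.
  apply/in_energy_spaceP; split; first by move=> x /negbTE; rewrite /r /= => ->.
  exists (Jet (r (jw j)) (jw1 j) (jw2 j) (r (jv j)) (jv1 j)); split=> //.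
  by split=> //=; [apply: derivR_ext h1|apply: derivR_ext h3] => // x; exact: rE.
by exists (EnergySpace H) => x x0; split; rewrite /= -rE.
Qed.

Lemma wv1_lin a (z z' : X) x : (wv (a *: z + z')).1 x = a * (wv z).1 x + (wv z').1 x.
Proof. by []. Qed.

Lemma wv2_lin a (z z' : X) x : (wv (a *: z + z')).2 x = a * (wv z).2 x + (wv z').2 x.
Proof. by []. Qed.

Lemma real_complete_sqr (x : nat -> R) :
  (forall e, 0 < e -> exists n0, forall m n, (n0 <= m)%N -> (n0 <= n)%N ->
    (x m - x n) ^+ 2 <= e) ->
  exists l, forall e, 0 < e -> exists n0, forall n, (n0 <= n)%N ->
    (x n - l) ^+ 2 <= e.
Proof.
move=> H.
have cx : cvgn x.
  apply/cauchy_cvgP; apply: cauchy_exP => e e0.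
  have [n0 Hn0] := H ((e / 2) ^+ 2) ltac:(by rewrite exprn_gt0// divr_gt0).
  exists (x n0), n0 => // n n0n; rewrite /= /ball /=.
  have := Hn0 _ _ (leqnn _) n0n; rewrite -[_ ^+ 2 in leLHS]real_normK ?num_real//.
  rewrite ler_pXn2r ?nnegrE//; last by lra.
  by move=> h; apply: le_lt_trans h _; lra.
exists (limn x) => e e0.
have := cx; move=> /cvgr_dist_le /(_ (Num.min 1 e)).
rewrite lt_min ltr01 e0 => /(_ isT)[n0 _ Hn]; exists n0 => n /Hn /=.
rewrite distrC le_min => /andP[h1 h2].
rewrite -real_normK ?num_real// expr2; apply: le_trans h2.
by rewrite ler_piMl.
Qed.

End SpaceLemmas.

Section EnergyForm.
Variables (R : realType) (L : R).
Hypothesis L0 : 0 < L.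
Local Notation hd := (has_derivR L).
Local Notation X := (energy_space L).
Variables (P P1 P2 : R -> R) (P0 : R).
Hypothesis HP : hd P P1.
Hypothesis HP1 : hd P1 P2.
Hypothesis P00 : 0 < P0.
Hypothesis P0P : forall x, 0 <= x <= L -> P0 <= P x.
Variables (b c0 kap : R).
Hypothesis b0 : 0 < b.
Hypothesis c00 : 0 < c0.
Hypothesis kap0 : 0 < kap.

Local Notation ipj := (jet_form L P P1 b c0 kap).
Definition energy_form (z z' : X) : R := ipj (jetof z) (jetof z').

Let okj (z : X) : isjet L (jetof z). Proof. by have [] := jetofP z. Qed.

(** [jetof] is an arbitrary choice; from here on the form may be computed with whichever jets are at
    hand. *)
Lemma energy_form_jets (z z' : X) j k : isjet L j -> isjet L k ->
  (forall x, 0 <= x <= L -> jw j x = (wv z).1 x /\ jv j x = (wv z).2 x) ->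
  (forall x, 0 <= x <= L -> jw k x = (wv z').1 x /\ jv k x = (wv z').2 x) ->
  energy_form z z' = ipj j k.
Proof.
move=> oj ok Hj Hk; have [oz z1 z2] := jetofP z; have [oz' z1' z2'] := jetofP z'.
rewrite /energy_form (@jet_form_uniq _ _ L0 _ _ _ HP HP1 _ _ _ (jetof z) j)//.
- rewrite jet_formC (@jet_form_uniq _ _ L0 _ _ _ HP HP1 _ _ _ (jetof z') k)// 1?jet_formC//.
    by move=> x /Hk[-> _]; rewrite z1'.
  by move=> x /Hk[_ ->]; rewrite z2'.
- by move=> x /Hj[-> _]; rewrite z1.
- by move=> x /Hj[_ ->]; rewrite z2.
Qed.

Let jetz (z : X) x : 0 <= x <= L ->
  jw (jetof z) x = (wv z).1 x /\ jv (jetof z) x = (wv z).2 x.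
Proof. by have [_ -> ->] := jetofP z. Qed.

Lemma energy_formC z z' : energy_form z z' = energy_form z' z. Proof. exact: jet_formC. Qed.

Lemma energy_form_lin a x y z :
  energy_form (a *: x + y) z = a * energy_form x z + energy_form y z.
Proof.
rewrite -(jet_form_lin L0 HP HP1)//.
apply: energy_form_jets; [exact: ok_lin|exact: okj| |exact: jetz].
move=> t t0; have [h1 h2] := jetz x t0; have [h3 h4] := jetz y t0.
by rewrite wv1_lin wv2_lin /= h1 h2 h3 h4.
Qed.

Lemma energy_form_ge0 z : 0 <= energy_form z z.
Proof. exact: (E_ge0 L0 HP P00 P0P b c00 kap0 (okj z)). Qed.

(** All coordinates vanish, so [w'], then [w], and likewise [v], vanish by the bound of a function
    by its value at 0 and its derivative. *)
Lemma energy_form_def z : energy_form z z = 0 -> z = 0.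
Proof.
move=> z0; have [C C0 HC] := Q_le_E L0 HP HP1 P00 P0P b0 c00 kap0.
have Q0 : jet_coords L (jetof z) <= 0.
  by have := HC _ (okj z); rewrite -/(energy_form z z) z0 mulr0.
have [h1 h2 h3] := okj z.
have s2 := L2dot_ge0 L (jw2 (jetof z)); have s1 := L2dot_ge0 L (jv1 (jetof z)).
have q1 := sqr_ge0 (jw (jetof z) 0); have q2 := sqr_ge0 (jw1 (jetof z) 0).
have q3 := sqr_ge0 (jv (jetof z) 0); move: Q0; rewrite /jet_coords => Q0.
have w1 x : 0 <= x <= L -> jw1 (jetof z) x ^+ 2 <= 0.
  move=> /(derivR_sqr_le L0 h2) h; apply: le_trans h _.
  have -> : L2dot L (jw2 (jetof z)) (jw2 (jetof z)) = 0 by lra.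
  lra.
have sw1 := L2dot_le_sup L0 (derivR_fL2 L0 h2) w1; rewrite mul0r in sw1.
have s3 := L2dot_ge0 L (jw1 (jetof z)).
apply: energy_space_ext => x x0; have [<- <-] := jetz z x0.
split; apply/eqP; rewrite -sqrf_eq0 eq_le sqr_ge0 andbT.
  apply: le_trans (derivR_sqr_le L0 h1 x0) _.
  have -> : L2dot L (jw1 (jetof z)) (jw1 (jetof z)) = 0 by lra.
  lra.
apply: le_trans (derivR_sqr_le L0 h3 x0) _.
have -> : L2dot L (jv1 (jetof z)) (jv1 (jetof z)) = 0 by lra.
lra.
Qed.

Lemma energy_norm_sqr z : ipnorm energy_form z ^+ 2 = energy_form z z.
Proof. by rewrite /ipnorm sqr_sqrtr// energy_form_ge0. Qed.

Lemma energy_form_complete : dist_complete (fun x y => ipnorm energy_form (x - y)).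
Proof.
move=> u Cu; have [C C0 HC] := Q_le_E L0 HP HP1 P00 P0P b0 c00 kap0.
have [C' C'0 HC'] := E_le_Q L0 HP HP1 P00 P0P b c00 kap0.
pose j n := jetof (u n).
have okd m n : isjet L (jlin (-1) (j n) (j m)) by apply: ok_lin; exact: okj.
have Qd m n : jet_coords L (jlin (-1) (j n) (j m)) <=
    C * ipnorm energy_form (u m - u n) ^+ 2.
  apply: le_trans (HC _ (okd m n)) _; apply: ler_wpM2l => //.
  rewrite energy_norm_sqr.
  rewrite (_ : u m - u n = (-1) *: u n + u m); last by rewrite scaleN1r addrC.
  rewrite le_eqVlt; apply/orP; left; apply/eqP/esym.
  have H x : 0 <= x <= L -> jw (jlin (-1) (j n) (j m)) x = (wv ((-1) *: u n + u m)).1 x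
      /\ jv (jlin (-1) (j n) (j m)) x = (wv ((-1) *: u n + u m)).2 x.
    by move=> x0; rewrite wv1_lin wv2_lin -!(jetz _ x0).1 -!(jetz _ x0).2.
  by apply: energy_form_jets; [exact: okd|exact: okd|exact: H|exact: H].
(* Any quantity below the coordinates of [u m - u n], in particular each single coordinate, inherits
   the Cauchy property. *)
have comp F : (forall m n, F m n <= jet_coords L (jlin (-1) (j n) (j m))) ->
    forall e, 0 < e -> exists n0, forall m n, (n0 <= m)%N -> (n0 <= n)%N -> F m n <= e.
  move=> HF e e0; have C1 : 0 < C + 1 by lra.
  have [n0 Hn0] := Cu (Num.min 1 (e / (C + 1))) ltac:(by rewrite lt_min ltr01 divr_gt0).
  exists n0 => p q hp hq; apply: le_trans (HF p q) _; apply: le_trans (Qd p q) _.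
  have := Hn0 p q hp hq; rewrite le_min ler_pdivlMr// => /andP[h1 h2].
  have := ipnorm_ge0 energy_form (u p - u q); nra.
have Qt m n : [/\ 0 <= jw (jlin (-1) (j n) (j m)) 0 ^+ 2,
    0 <= jw1 (jlin (-1) (j n) (j m)) 0 ^+ 2,
    0 <= L2dot L (jw2 (jlin (-1) (j n) (j m))) (jw2 (jlin (-1) (j n) (j m))),
    0 <= jv (jlin (-1) (j n) (j m)) 0 ^+ 2 &
    0 <= L2dot L (jv1 (jlin (-1) (j n) (j m))) (jv1 (jlin (-1) (j n) (j m)))].
  by split; rewrite ?sqr_ge0 ?L2dot_ge0.
have [al Hal] : exists l, forall e, 0 < e -> exists n0, forall n, (n0 <= n)%N ->
    (jw (j n) 0 - l) ^+ 2 <= e.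
  apply: real_complete_sqr; apply: comp => m n; have [] := Qt m n.
  by rewrite /jet_coords /= mulN1r [- _ + _]addrC; lra.
have [be Hbe] : exists l, forall e, 0 < e -> exists n0, forall n, (n0 <= n)%N ->
    (jw1 (j n) 0 - l) ^+ 2 <= e.
  apply: real_complete_sqr; apply: comp => m n; have [] := Qt m n.
  by rewrite /jet_coords /= !mulN1r ![- _ + jw1 _ _]addrC; lra.
have [ga Hga] : exists l, forall e, 0 < e -> exists n0, forall n, (n0 <= n)%N ->
    (jv (j n) 0 - l) ^+ 2 <= e.
  apply: real_complete_sqr; apply: comp => m n; have [] := Qt m n.
  by rewrite /jet_coords /= !mulN1r ![- _ + jv _ _]addrC; lra.
have spE (f g : R -> R) : L2dot L (fun x => f x - g x) (fun x => f x - g x) =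
    L2dot L (fun x => -1 * g x + f x) (fun x => -1 * g x + f x).
  by apply: L2dot_ext => x _; rewrite mulN1r addrC.
have [f2 Lf2 Hf2] : exists2 f, L2r L f & forall e, 0 < e ->
    exists n0, forall n, (n0 <= n)%N ->
      L2dot L (fun x => jw2 (j n) x - f x) (fun x => jw2 (j n) x - f x) <= e.
  apply: L2_complete => [n|]; first by have [_ []] := okj (u n).
  apply: comp => m n; rewrite spE; have [] := Qt m n; rewrite /jet_coords /=; lra.
have [g1 Lg1 Hg1] : exists2 f, L2r L f & forall e, 0 < e ->
    exists n0, forall n, (n0 <= n)%N ->
      L2dot L (fun x => jv1 (j n) x - f x) (fun x => jv1 (j n) x - f x) <= e.
  apply: L2_complete => [n|]; first by have [_ _ []] := okj (u n).
  apply: comp => m n; rewrite spE; have [] := Qt m n; rewrite /jet_coords /=; lra.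
(* The limit is rebuilt by integration from the limits [al], [be], [ga], [f2], [g1] of the five
   coordinates. *)
pose W1 x := be + prim f2 x.
have hW1 : hd W1 f2 by exact: derivR_prim.
have LW1 : L2r L W1 by exact: derivR_fL2 hW1.
pose J := Jet (fun x => al + prim W1 x) W1 f2 (fun x => ga + prim g1 x) g1.
have oJ : isjet L J by split=> //; exact: derivR_prim.
have [z Hz] := energy_space_of_jet L0 oJ.
exists z => e e0; have C'1 : 0 < C' + 1 by lra.
(* Five coordinates of size [e'] each, times [C'], stay below [e^2]. *)
pose e' := e ^+ 2 / (5 * (C' + 1)).
have e'0 : 0 < e' by rewrite divr_gt0 ?mulr_gt0 ?exprn_gt0.
have [n1 H1] := Hal e' e'0; have [n2 H2] := Hbe e' e'0; have [n3 H3] := Hga e' e'0.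
have [n4 H4] := Hf2 e' e'0; have [n5 H5] := Hg1 e' e'0.
exists (maxn (maxn n1 n2) (maxn n3 (maxn n4 n5))) => n.
rewrite !geq_max => /andP[/andP[/H1 h1 /H2 h2] /and3P[/H3 h3 /H4 h4 /H5 h5]].
have okJ : isjet L (jlin (-1) J (j n)) by apply: ok_lin => //; exact: okj.
rewrite -(@ler_pXn2r _ 2) ?nnegrE ?ipnorm_ge0//; last exact: ltW.
rewrite energy_norm_sqr.
rewrite (_ : u n - z = (-1) *: z + u n); last by rewrite scaleN1r addrC.
have H x : 0 <= x <= L -> jw (jlin (-1) J (j n)) x = (wv ((-1) *: z + u n)).1 x
    /\ jv (jlin (-1) J (j n)) x = (wv ((-1) *: z + u n)).2 x.
  move=> x0; rewrite wv1_lin wv2_lin (Hz x x0).1 (Hz x x0).2.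
  by rewrite -(jetz _ x0).1 -(jetz _ x0).2.
rewrite (energy_form_jets okJ okJ H H); apply: le_trans (HC' _ okJ) _.
rewrite spE in h4; rewrite spE in h5.
have QJ : jet_coords L (jlin (-1) J (j n)) <= 5 * e'.
  rewrite /jet_coords /= /W1 !prim0 !addr0 !mulN1r ![- _ + _ (j n) 0]addrC; lra.
apply: le_trans (ler_wpM2l C'0 QJ) _.
have -> : e ^+ 2 = (C' + 1) * (5 * e') by rewrite /e'; field; rewrite gt_eqF.
lra.
Qed.

End EnergyForm.

(** * The generator *)

Section L2Metric.
Variables (R : realType) (L : R).
Local Notation hd := (has_derivR L).

Definition L2fun := {f : R -> R | L2r L f}.
Definition L2dist (f g : L2fun) : R :=
  Num.sqrt (L2dot L (fun x => sval f x - sval g x) (fun x => sval f x - sval g x)).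

Lemma L2dist_sqr f g : L2dist f g ^+ 2 =
  L2dot L (fun x => sval f x - sval g x) (fun x => sval f x - sval g x).
Proof. by rewrite sqr_sqrtr// L2dot_ge0. Qed.

Lemma L2dist_ge0 f g : 0 <= L2dist f g. Proof. exact: sqrtr_ge0. Qed.

Lemma L2dist_xx f : L2dist f f = 0.
Proof.
rewrite /L2dist (@L2dot_ext _ _ _ (fun=> 0) _ (fun=> 0)) ?L2dot0 ?sqrtr0//.
- by move=> x _; rewrite subrr.
- by move=> x _; rewrite subrr.
Qed.

Lemma L2distC f g : L2dist f g = L2dist g f.
Proof.
rewrite /L2dist; congr Num.sqrt; apply: eq_Rintegral => x _.
by rewrite -[X in X * _]opprB -[X in _ * X]opprB mulrNN.
Qed.

Lemma L2dist_tri g f h : L2dist f h <= L2dist f g + L2dist g h.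
Proof.
have Lfg := L2rB (svalP f) (svalP g); have Lgh := L2rB (svalP g) (svalP h).
rewrite -(@ler_pXn2r _ 2) ?nnegrE ?addr_ge0 ?L2dist_ge0//.
rewrite L2dist_sqr sqrrD !L2dist_sqr.
rewrite (@L2dot_ext _ _ _ (fun x => (sval f x - sval g x) + (sval g x - sval h x)) _
  (fun x => (sval f x - sval g x) + (sval g x - sval h x))); try by move=> x _; ring.
rewrite L2dotDD// lerD2r lerD2l -[leRHS]mulr_natl; apply: ler_wpM2l => //.
apply: le_trans (ler_norm _) _.
rewrite -(@ler_pXn2r _ 2) ?nnegrE ?mulr_ge0 ?L2dist_ge0//.
by rewrite real_normK ?num_real// exprMn !L2dist_sqr; exact: L2dot_CS.
Qed.

Lemma L2dist_complete : dist_complete L2dist.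
Proof.
move=> u Cu.
have H e : 0 < e -> exists n0, forall m n, (n0 <= m)%N -> (n0 <= n)%N ->
    L2dot L (fun x => sval (u m) x - sval (u n) x)
      (fun x => sval (u m) x - sval (u n) x) <= e.
  move=> e0; have [n0 Hn0] := Cu (Num.min 1 e) ltac:(by rewrite lt_min ltr01).
  exists n0 => m n hm hn; have := Hn0 m n hm hn; rewrite le_min => /andP[h1 h2].
  rewrite -L2dist_sqr expr2; apply: le_trans h2; rewrite ler_piMl//.
  exact: L2dist_ge0.
have [f Lf Hf] := L2_complete (fun n => svalP (u n)) H.
exists (exist _ f Lf) => e e0.
have [n0 Hn0] := Hf (e ^+ 2) ltac:(by rewrite exprn_gt0).
exists n0 => n /Hn0 h.
rewrite -(@ler_pXn2r _ 2) ?nnegrE ?L2dist_ge0//; last exact: ltW.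
by rewrite L2dist_sqr.
Qed.

End L2Metric.

Section InitialValue.
Variables (R : realType) (L : R).
Hypothesis L0 : 0 < L.
Local Notation hd := (has_derivR L).
Variables (iP : R -> R) (M : R).
Hypothesis ciP : contR L iP.
Hypothesis iPM : forall x, 0 <= x <= L -> `|iP x| <= M.

(* Picard iteration for [w' = iP p], [p' = c (w - F)] contracts when [c] is small. *)
Lemma ivp_exists (c : R) : 0 <= c -> 2 * (c * L ^+ 2 * M) <= 1 ->
  forall (F : R -> R) al be, L2r L F -> exists w p,
    [/\ hd w (fun x => iP x * p x), hd p (fun x => c * (w x - F x)),
        w 0 = al & p 0 = be].
Proof.
move=> cge0 small F al be LF.
have M0 : 0 <= M.
  by apply: le_trans (normr_ge0 _) (iPM (x := 0) _); rewrite lexx ltW.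
pose p_ (y : R -> R) x := be + prim (fun t => c * (y t - F t)) x.
have Lc y : L2r L y -> L2r L (fun t => c * (y t - F t)).
  by move=> Ly; apply: L2rZ; exact: L2rB.
have Lp y : L2r L y -> L2r L (p_ y).
  by move=> Ly; apply: (derivR_fL2 L0 (derivR_prim be (Lc y Ly))).
pose w_ (y : R -> R) x := al + prim (fun t => iP t * p_ y t) x.
have LiPp y : L2r L y -> L2r L (fun t => iP t * p_ y t).
  by move=> Ly; apply: L2rM_cont => //; exact: Lp.
have Lw y : L2r L y -> L2r L (w_ y).
  by move=> Ly; apply: (derivR_fL2 L0 (derivR_prim al (LiPp y Ly))).
pose Phi (y : L2fun L) : L2fun L := exist _ (w_ (sval y)) (Lw _ (svalP y)).
have half : 0 <= (2^-1 : R) < 1 by lra.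
have contr y z : L2dist (Phi y) (Phi z) <= 2^-1 * L2dist y z.
  rewrite -(@ler_pXn2r _ 2) ?nnegrE ?mulr_ge0 ?L2dist_ge0//.
  rewrite exprMn !L2dist_sqr /=.
  have [Ly Lz] := (svalP y, svalP z).
  set f := sval y in Ly *; set g := sval z in Lz *.
  have Lfg := L2rB Ly Lz; set S := L2dot L (fun x => f x - g x) _.
  have S0 : 0 <= S by exact: L2dot_ge0.
  pose q x := p_ f x - p_ g x.
  have qE x : 0 <= x <= L -> q x = prim (fun t => c * (f t - g t)) x.
    move=> /andP[_ xL]; rewrite /q /p_.
    have := prim_lin (-1) xL (Lc _ Lz) (Lc _ Ly).
    rewrite (_ : (fun t => -1 * _ + _) = (fun t => c * (f t - g t))); first lra.
    by apply/funext => t; ring.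
  have q2 x : 0 <= x <= L -> q x ^+ 2 <= L * (c ^+ 2 * S).
    move=> x0; rewrite qE//; apply: le_trans (prim_sqr_le L0 (L2rZ c Lfg) x0) _.
    by rewrite L2dotZZ.
  have Lq : L2r L q by apply: L2rB; exact: Lp.
  have qq := L2dot_le_sup L0 Lq q2.
  have iqq := L2dot_mul_le ciP iPM Lq.
  have w2 x : 0 <= x <= L ->
      (w_ f x - w_ g x) ^+ 2 <= L * (M ^+ 2 * (L * (c ^+ 2 * S) * L)).
    move=> x0; have -> : w_ f x - w_ g x = prim (fun t => iP t * q t) x.
      have /andP[_ xL] := x0; rewrite /w_.
      have := prim_lin (-1) xL (LiPp _ Lz) (LiPp _ Ly).
      rewrite (_ : (fun t => -1 * _ + _) = (fun t => iP t * q t)); first lra.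
      by apply/funext => t; rewrite /q; ring.
    apply: le_trans (prim_sqr_le L0 (L2rM_cont ciP Lq) x0) _.
    apply: ler_wpM2l; first exact: ltW.
    apply: le_trans iqq _; apply: ler_wpM2l; first exact: sqr_ge0.
    exact: qq.
  apply: le_trans (L2dot_le_sup L0 (L2rB (Lw _ Ly) (Lw _ Lz)) w2) _.
  have -> : L * (M ^+ 2 * (L * (c ^+ 2 * S) * L)) * L = (c * L ^+ 2 * M) ^+ 2 * S by ring.
  apply: ler_wpM2r => //.
  have k0 : 0 <= c * L ^+ 2 * M.
    by apply: mulr_ge0 => //; apply: mulr_ge0 => //; exact: sqr_ge0.
  rewrite ler_pXn2r ?nnegrE//; lra.
have [y Hy] := @contraction_fixpoint _ _ _ (@L2dist_ge0 R L) (@L2dist_xx R L)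
  (@L2distC R L) (@L2dist_tri R L) _ Phi (exist _ _ (L2r_cst L 0)) half
  (@L2dist_complete R L) contr.
(* [y] is a fixed point only almost everywhere. Its image [f] satisfies the equations at every
   point, since the primitive [p_] does not see the difference. *)
pose f := w_ (sval y); have Lf : L2r L f := Lw _ (svalP y).
have fy2 : L2dot L (fun x => f x - sval y x) (fun x => f x - sval y x) = 0.
  by rewrite -(L2dist_sqr (Phi y) y) Hy expr0n.
have pE x : 0 <= x <= L -> p_ f x = p_ (sval y) x.
  move=> /[dup] x0 /andP[_ xL]; rewrite /p_.
  have := prim_lin (-1) xL (Lc _ (svalP y)) (Lc _ Lf).
  have -> : (fun t => -1 * (c * (sval y t - F t)) + c * (f t - F t)) =
      (fun t => c * (f t - sval y t)) by apply/funext => t; ring.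
  have := prim_sqr_le L0 (L2rZ c (L2rB Lf (svalP y))) x0.
  rewrite L2dotZZ; last by apply: L2rB => //; exact: svalP.
  rewrite fy2 !mulr0 => h; have := sqr_ge0 (prim (fun x => c * (f x - sval y x)) x).
  move=> h2 h3; have : prim (fun x => c * (f x - sval y x)) x ^+ 2 = 0 by lra.
  move/eqP; rewrite sqrf_eq0 => /eqP; lra.
exists f, (p_ f); split.
- apply: (derivR_ext_r (g := fun t => iP t * p_ (sval y) t)).
    by move=> x x0; rewrite pE.
  by apply: derivR_prim; apply: LiPp; exact: svalP.
- by apply: derivR_prim; exact: Lc.
- by rewrite /f /w_ prim0 addr0.
- by rewrite /p_ prim0 addr0.
Qed.

End InitialValue.

Lemma solve2x2 (R : realFieldType) (m11 m12 m21 m22 r1 r2 : R) :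
  (forall x y, x * m11 + y * m12 = 0 -> x * m21 + y * m22 = 0 -> x = 0 /\ y = 0) ->
  exists x y, x * m11 + y * m12 = r1 /\ x * m21 + y * m22 = r2.
Proof.
move=> inj; have det0 : m11 * m22 - m12 * m21 != 0.
  (* If the determinant vanishes, the two cofactor vectors lie in the kernel; injectivity makes all
     entries zero, and then [(1, 0)] lies in the kernel too. *)
  apply/eqP => D.
  have [z22 z21] := inj m22 (- m21) ltac:(lra) ltac:(ring).
  have [z12 z11] := inj m12 (- m11) ltac:(ring) ltac:(lra).
  have [] := inj 1 0 ltac:(lra) ltac:(lra); lra.
exists ((r1 * m22 - r2 * m12) / (m11 * m22 - m12 * m21)).
exists ((r2 * m11 - r1 * m21) / (m11 * m22 - m12 * m21)).
by split; field.
Qed.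

(** * Dissipativity and range of the crane operator *)

Section Generator.
Variables (R : realType) (L : R).
Hypothesis L0 : 0 < L.
Local Notation hd := (has_derivR L).
Local Notation X := (energy_space L).
Variables (P P1 P2 : R -> R) (P0 : R).
Hypothesis HP : hd P P1.
Hypothesis HP1 : hd P1 P2.
Hypothesis P00 : 0 < P0.
Hypothesis P0P : forall x, 0 <= x <= L -> P0 <= P x.
Variables (th1 th2 th3 th4 a b : R).
Hypothesis a0 : 0 < a.
Hypothesis b0 : 0 < b.
Hypothesis th1E : th1 = th3 / b - a.
Hypothesis th2E : th2 = th4 / b.
Hypothesis th30 : th3 < 0.
Hypothesis th40 : 0 < th4.

(* With these weights the boundary terms at [0] in [<A z, z>] collapse to
   [- P(0) (b / th4) (((P w')'(0))^2 + a b v(0)^2)]. *)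
Let c0 := P 0 * (- th3 / th4).
Let kap := P 0 * (b / th4) * (a + b).
Let i0 : 0 <= (0 : R) <= L. Proof. by rewrite lexx ltW. Qed.
Let iL : 0 <= L <= L. Proof. by rewrite lexx ltW. Qed.
Let PO : 0 < P 0. Proof. exact: lt_le_trans (P0P i0). Qed.
Let c00 : 0 < c0.
Proof. by rewrite /c0 mulr_gt0// divr_gt0// oppr_gt0. Qed.
Let kap0 : 0 < kap.
Proof. by rewrite /kap !mulr_gt0// ?invr_gt0// addr_gt0. Qed.
Let cP : contR L P := derivR_cont L0 HP.
Let cP1 : contR L P1 := derivR_cont L0 HP1.

Definition bc0 (j : jet R) :=
  th1 * jv j 0 + th2 * jv1 j 0 + th3 * jw j 0 + th4 * jw1 j 0.

(** The additional derivatives of [jw2 j] and [jv1 j] are the regularity of the domain; they also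
    make these two functions continuous, so that the boundary conditions have a meaning at the
    points 0 and [L]. *)
Definition crane_jet (j : jet R) : Prop :=
  [/\ isjet L j, exists w3, hd (jw2 j) w3, exists v2, hd (jv1 j) v2,
      jet_flux P P1 j L = - jw1 j L & jet_flux P P1 j 0 = bc0 j].

(** The graph of the real operator. The jet is existentially quantified because a point of the space
    carries no preferred derivatives. *)
Definition crane_rel (z y : X) : Prop := exists j, [/\ crane_jet j,
  forall x, 0 <= x <= L -> jw j x = (wv z).1 x /\ jv j x = (wv z).2 x &
  forall x, 0 <= x <= L -> (wv y).1 x = jv j x /\ (wv y).2 x = jet_flux P P1 j x].

Lemma jet_flux_lin k j j' x :
  jet_flux P P1 (jlin k j j') x = k * jet_flux P P1 j x + jet_flux P P1 j' x.
Proof. by rewrite /jet_flux /=; ring. Qed.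

Lemma crane_jet_lin k j j' : crane_jet j -> crane_jet j' ->
  crane_jet (jlin k j j').
Proof.
move=> [jo [w3 h1] [v2 h2] h3 h4] [jo' [w3' h1'] [v2' h2'] h3' h4'].
split; first exact: ok_lin.
- by exists (fun x => k * w3 x + w3' x); exact: derivR_lin.
- by exists (fun x => k * v2 x + v2' x); exact: derivR_lin.
- by rewrite jet_flux_lin h3 h3' /=; ring.
- by rewrite jet_flux_lin h4 h4' /bc0 /=; ring.
Qed.

Lemma crane_rel_lin k (z y z' y' : X) : crane_rel z y -> crane_rel z' y' ->
  crane_rel (k *: z + z') (k *: y + y').
Proof.
move=> [j [h1 h2 h3]] [j' [h1' h2' h3']]; exists (jlin k j j'); split.
- exact: crane_jet_lin.
- move=> x x0; rewrite wv1_lin wv2_lin /=.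
  by rewrite !(h2 x x0).1 !(h2 x x0).2 !(h2' x x0).1 !(h2' x x0).2.
- move=> x x0; rewrite wv1_lin wv2_lin jet_flux_lin /=.
  by rewrite !(h3 x x0).1 !(h3 x x0).2 !(h3' x x0).1 !(h3' x x0).2.
Qed.

Lemma crane_rel_fun (y : X) : crane_rel 0 y -> y = 0.
Proof.
move=> [j [[[h1 h2 h3] [w3 h4] _ _ _] hz hy]].
have w0 x : 0 <= x <= L -> jw j x = 0 by move=> /hz[].
have w1 : forall x, 0 <= x <= L -> jw1 j x = 0.
  apply: (cont_deriv_uniq L0 (derivR_ext L0 w0 h1) (derivR_cst L 0)).
    exact: derivR_cont h2.
  exact: contR_cst.
have w2 : forall x, 0 <= x <= L -> jw2 j x = 0.
  apply: (cont_deriv_uniq L0 (derivR_ext L0 w1 h2) (derivR_cst L 0)).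
    exact: derivR_cont h4.
  exact: contR_cst.
apply: energy_space_ext => x x0; have [-> ->] := hy x x0; have [_ ->] := hz x x0.
by rewrite /jet_flux w1// w2// !mulr0 addr0.
Qed.

Lemma isjet_image j : crane_jet j -> exists v2 g1,
  isjet L (Jet (jv j) (jv1 j) v2 (jet_flux P P1 j) g1) /\ hd (jv1 j) v2.
Proof.
move=> [[h1 h2 h3] [w3 h4] [v2 h5] _ _].
exists v2; eexists; split=> //; split=> //=.
exact: (derivRD (derivRM L0 HP1 h2) (derivRM L0 HP h4)).
Qed.

(** With [u = v + b w], [hu1] says [(P u_x)_x = u_tt] and [hu2] says [(u_t)_x = u_tx], so the two
    integrals combine into the boundary values of [P u_x u_t]. At [L] the [jet_utL] term cancels
    them, its time derivative being [- u_x(L)]; at 0 the law for [(P w')'(0)] leaves the term [key]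
    with a minus sign. *)
Lemma crane_rel_diss (z y : X) : crane_rel z y ->
  energy_form P P1 b c0 kap y z <= 0.
Proof.
move=> [j [cj hz hy]].
have [v2 [g1 [yo hv2]]] := isjet_image cj.
have [jo [w3 h4] _ bL b00] := cj; have [h1 h2 h3] := jo.
set jy := Jet _ _ _ _ _ in yo.
have hy' x : 0 <= x <= L -> jw jy x = (wv y).1 x /\ jv jy x = (wv y).2 x.
  by move=> /hy[-> ->].
rewrite (energy_form_jets L0 HP HP1 b c0 kap yo jo hy' hz) /jet_form.
have hu1 : hd (fun x => P x * jet_ux b j x) (jet_ut P P1 b jy).
  have := derivRM L0 HP (derivRD hv2 (derivRZ b h2)); congr (hd _ _).
  by apply/funext => x; rewrite /jet_ut /jet_flux /jy /= /jet_flux; ring.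
have hu2 : hd (jet_ut P P1 b j) (jet_ux b jy).
  have [_ _ hg] := yo.
  by have := derivRD hg (derivRZ b h3); congr (hd _ _).
have ibp := derivR_ibp L0 hu1 hu2.
have -> : L2dot L (fun x => P x * jet_ux b jy x) (jet_ux b j) =
    L2dot L (fun x => P x * jet_ux b j x) (jet_ux b jy).
  by apply: eq_Rintegral => x _; ring.
rewrite (L2dotC L (jet_ut P P1 b jy)) ibp.
have key : 0 <= P 0 * (b / th4) * (jet_flux P P1 j 0 ^+ 2 + a * b * jv j 0 ^+ 2).
  apply: mulr_ge0; first by apply: ltW; rewrite !mulr_gt0// invr_gt0.
  apply: addr_ge0; first exact: sqr_ge0.
  by apply: mulr_ge0; [rewrite ltW// mulr_gt0|exact: sqr_ge0].
rewrite -oppr_ge0; apply: le_trans key _; rewrite le_eqVlt; apply/orP; left.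
apply/eqP; rewrite /jet_utL /jet_u0 /jet_ut /jet_ux /jy /= bL b00 /bc0 th1E th2E /c0 /kap.
field.
by rewrite !gt_eqF.
Qed.


(** * Surjectivity for large steps *)

Section Range.
Variable h : R.
Hypothesis h0 : 0 < h.
Hypothesis h_large : 2 * L ^+ 2 <= h ^+ 2 * P0.

(* [j] solves [j - h A j = k] up to the boundary conditions. *)
Definition resolvent_jet (k j : jet R) : Prop :=
  [/\ isjet L j, exists w3, hd (jw2 j) w3, exists v2, hd (jv1 j) v2,
      forall x, 0 <= x <= L -> jv j x = h^-1 * (jw j x - jw k x) &
      forall x, 0 <= x <= L -> jet_flux P P1 j x = h^-1 * (jv j x - jv k x)].

Lemma resolvent_jet_lin c k k' j j' : resolvent_jet k j -> resolvent_jet k' j' ->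
  resolvent_jet (jlin c k k') (jlin c j j').
Proof.
move=> [jo [w3 h1] [v2 h2] h3 h4] [jo' [w3' h1'] [v2' h2'] h3' h4'].
split; first exact: ok_lin.
- by exists (fun x => c * w3 x + w3' x); exact: derivR_lin.
- by exists (fun x => c * v2 x + v2' x); exact: derivR_lin.
- by move=> x x0; rewrite /= h3// h3'//; ring.
- by move=> x x0; rewrite jet_flux_lin h4// h4'//=; ring.
Qed.

(** Eliminating [v] leaves [(P w')' = h^-2 (w - F)] with [F = h k_v + k_w]. In the unknowns [w] and
    [p = P w'] this is the system of [ivp_exists], with [c = h^-2] and [M = P0^-1], and [h_large] is
    exactly its smallness condition. Recovering [w' = p / P] with enough regularity uses that [P]
    has two derivatives. *)
Lemma resolvent_jet_ivp k al be : isjet L k ->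
  exists j, [/\ resolvent_jet k j, jw j 0 = al & jw1 j 0 = be].
Proof.
move=> [k1 k2 k3].
have Pn0 x : 0 <= x <= L -> P x != 0.
  by move=> /P0P hx; rewrite gt_eqF// (lt_le_trans P00).
pose iP x := (P x)^-1.
have hiP : hd iP _ := derivR_inv L0 P00 P0P HP cP1.
have hiP1 := derivRM L0 (derivRZ (-1) HP1) (derivRM L0 hiP hiP).
have iPM x : 0 <= x <= L -> `|iP x| <= P0^-1.
  move=> /P0P hx; have px : 0 < P x by exact: lt_le_trans hx.
  rewrite /iP ger0_norm; first by rewrite lef_pV2.
  by rewrite invr_ge0 ltW.
pose F x := h * jv k x + jw k x.
have hF : hd F _ := derivR_lin h k3 k1.
pose c := (h ^+ 2)^-1.
have c_ge0 : 0 <= c by rewrite invr_ge0 sqr_ge0.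
have small : 2 * (c * L ^+ 2 * P0^-1) <= 1.
  have hP : 0 < h ^+ 2 * P0 by rewrite mulr_gt0// exprn_gt0.
  have -> : 2 * (c * L ^+ 2 * P0^-1) = (2 * L ^+ 2) / (h ^+ 2 * P0).
    by rewrite /c; field; rewrite !gt_eqF.
  by rewrite ler_pdivrMr// mul1r.
have [w [p [hw hp w0 p0]]] := ivp_exists L0 (derivR_cont L0 hiP) iPM c_ge0 small al
  (P 0 * be) (derivR_fL2 L0 hF).
pose p' x := c * (-1 * F x + w x).
have hp' : hd p' _ := derivRZ c (derivR_lin (-1) hF hw).
have {}hp : hd p p'.
  by apply: derivR_ext_r hp => x _; rewrite /p'; ring.
pose iP1 x := -1 * P1 x * (iP x * iP x).
have {}hiP : hd iP iP1.
  by apply: derivR_ext_r hiP => x _; rewrite /iP1 /iP; ring.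
have hw1 := derivRM L0 hiP hp.
have hw2 := derivRD (derivRM L0 hiP hp') (derivRM L0 hp hiP1).
have hv := derivRZ h^-1 (derivR_lin (-1) k1 hw).
have hv1 := derivRZ h^-1 (derivR_lin (-1) k2 hw1).
exists (Jet w (fun x => iP x * p x) (fun x => iP x * p' x + p x * iP1 x)
  (fun x => h^-1 * (-1 * jw k x + w x)) (fun x => h^-1 * (-1 * jw1 k x + iP x * p x))).
split=> //=; last by rewrite p0 /iP mulrA mulVf ?mul1r// Pn0.
split=> //=.
- by eexists; exact: hw2.
- by eexists; exact: hv1.
- by move=> x _; ring.
- move=> x x0; rewrite /jet_flux /= /iP1 /p' /c /F /iP.
  by field; rewrite Pn0// gt_eqF.
Qed.

Let zero_jet : jet R := Jet (fun=> 0) (fun=> 0) (fun=> 0) (fun=> 0) (fun=> 0).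
Let B1 (j : jet R) := jet_flux P P1 j L + jw1 j L.
Let B2 (j : jet R) := jet_flux P P1 j 0 - bc0 j.
Let B1_lin c j k : B1 (jlin c j k) = c * B1 j + B1 k.
Proof. by rewrite /B1 jet_flux_lin /=; ring. Qed.
Let B2_lin c j k : B2 (jlin c j k) = c * B2 j + B2 k.
Proof. by rewrite /B2 jet_flux_lin /bc0 /=; ring. Qed.

Let crane_rel_of_jet (k j : jet R) (f : X) : resolvent_jet k j ->
  B1 j = 0 -> B2 j = 0 ->
  (forall x, 0 <= x <= L -> jw k x = (wv f).1 x /\ jv k x = (wv f).2 x) ->
  exists2 z : X, crane_rel z (h^-1 *: (z - f)) &
    forall x, 0 <= x <= L -> jw j x = (wv z).1 x.
Proof.
move=> [jo h1 h2 h3 h4] b1 b2 kf.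
have [z Hz] := energy_space_of_jet L0 jo.
exists z => [|x /Hz[]//]; exists j; split.
- split=> //; first by move: b1; rewrite /B1; lra.
  by move: b2; rewrite /B2; lra.
- by move=> x /Hz[-> ->].
move=> x x0; have [z1 z2] := Hz x x0; have [k1 k2] := kf x x0.
rewrite (_ : h^-1 *: (z - f) = h^-1 *: (-1 *: f + z) + 0); last first.
  by rewrite addr0 scaleN1r [z - f]addrC.
rewrite wv1_lin wv1_lin wv2_lin wv2_lin /= z1 z2 -k1 -k2 h3// h4//.
by rewrite h3//; split; rewrite /GRing.zero /=; ring.
Qed.

(** [B1] and [B2] measure the failure of the boundary conditions. [jp] is a particular solution;
    [j1] and [j2] solve the homogeneous equation with initial data [(1, 0)] and [(0, 1)]. A
    homogeneous solution without defect satisfies [A z = z / h], so dissipativity gives [z = 0], and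
    its initial data vanish. *)
Lemma crane_rel_range (f : X) : exists z, crane_rel z (h^-1 *: (z - f)).
Proof.
have zo : isjet L zero_jet by split; exact: derivR_cst.
have [j1 [s1 j1w j1w1]] := resolvent_jet_ivp 1 0 zo.
have [j2 [s2 j2w j2w1]] := resolvent_jet_ivp 0 1 zo.
have [k [ko kf1 kf2]] := energy_space_jet f.
have [jp [sp_ jpw jpw1]] := resolvent_jet_ivp 0 0 ko.
have inj x y : x * B1 j1 + y * B1 j2 = 0 -> x * B2 j1 + y * B2 j2 = 0 -> x = 0 /\ y = 0.
  move=> e1 e2.
  (* [jlin] scales only its first argument, so [y j2] is written as [(y - 1) j2 + j2]. *)
  have s0 := resolvent_jet_lin x s1 (resolvent_jet_lin (y - 1) s2 s2).
  set j := jlin x j1 _ in s0.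
  have b1 : B1 j = 0 by rewrite !B1_lin; move: e1; lra.
  have b2 : B2 j = 0 by rewrite !B2_lin; move: e2; lra.
  have [z Gz jz] := crane_rel_of_jet (f := 0) s0 b1 b2
    ltac:(by move=> t _; rewrite /= !mulr0 !addr0).
  have [jh1 jh2 _] : isjet L j by case: s0.
  have z0 : z = 0.
    apply: (energy_form_def L0 HP HP1 P00 P0P b0 c00 kap0); apply/le_anti.
    rewrite (energy_form_ge0 L0 HP P00 P0P b c00 kap0) andbT.
    have := crane_rel_diss Gz; rewrite subr0.
    rewrite (ipZl (energy_form_lin L0 HP HP1 b c0 kap)) pmulr_rle0 ?invr_gt0//.
  have w0 t : 0 <= t <= L -> jw j t = 0 by move=> /jz ->; rewrite z0.
  have w1 : forall t, 0 <= t <= L -> jw1 j t = 0.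
    apply: (cont_deriv_uniq L0 (derivR_ext L0 w0 jh1) (derivR_cst L 0)).
      exact: derivR_cont jh2.
    exact: contR_cst.
  have := w0 0 i0; have := w1 0 i0.
  rewrite /j /= j1w j2w j1w1 j2w1; lra.
have [x [y [e1 e2]]] := solve2x2 (- B1 jp) (- B2 jp) inj.
have s := resolvent_jet_lin x s1 (resolvent_jet_lin y s2 sp_).
have [|||z Gz _] := crane_rel_of_jet (f := f) s.
- by rewrite !B1_lin; lra.
- by rewrite !B2_lin; lra.
- by move=> t _; rewrite /= !mulr0 !add0r kf1 kf2.
by exists z.
Qed.

End Range.

Theorem crane_semigroup : exists T : R -> X -> X,
  [/\ forall t c x y, 0 <= t -> T t (c *: x + y) = c *: T t x + T t y,
      forall t x, 0 <= t -> ipnorm (energy_form P P1 b c0 kap) (T t x) <=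
        ipnorm (energy_form P P1 b c0 kap) x,
      (forall x, T 0 x = x) /\
        (forall t s x, 0 <= t -> 0 <= s -> T (t + s) x = T t (T s x)),
      forall x e, 0 < e -> exists2 dl : R, 0 < dl &
        forall t, 0 <= t <= dl -> ipnorm (energy_form P P1 b c0 kap) (T t x - x) <= e &
      forall x y, (forall e, 0 < e -> exists2 dl : R, 0 < dl &
        forall t, 0 < t < dl ->
          ipnorm (energy_form P P1 b c0 kap) (t^-1 *: (T t x - x) - y) <= e) <->
        crane_rel x y].
Proof.
apply: hilbert_generation.
- exact: energy_formC.
- exact: (energy_form_lin L0 HP HP1).
- exact: (energy_form_ge0 L0 HP P00 P0P).
- exact: (energy_form_def L0 HP HP1 P00 P0P b0 c00 kap0).
- exact: (energy_form_complete L0 HP HP1 P00 P0P b0 c00 kap0).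
- exact: crane_rel_lin.
- exact: crane_rel_diss.
- exact: crane_rel_fun.
(* Adding 1 gives [h <= h^2], and [h * P0 = 2 L^2 + P0] then yields the largeness condition. *)
pose h := 2 * L ^+ 2 / P0 + 1.
have h1 : 0 <= 2 * L ^+ 2 / P0.
  by apply: divr_ge0; [apply: mulr_ge0 => //; exact: sqr_ge0|exact: ltW].
exists h; first by rewrite /h; lra.
apply: crane_rel_range; first by rewrite /h; lra.
have : h <= h ^+ 2 by rewrite expr2 /h; nra.
move=> /(ler_wpM2r (ltW P00)); apply: le_trans.
by rewrite /h [leRHS]mulrDl divfK ?gt_eqF// mul1r lerDl ltW.
Qed.

End Generator.

(** * Complex-valued states *)

Section ComplexParts.
Variable R : realType.
Implicit Types (c d : R[i]) (r : R).
Lemma ReD c d : Re (c + d) = Re c + Re d. Proof. by case: c; case: d. Qed.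
Lemma ImD c d : Im (c + d) = Im c + Im d. Proof. by case: c; case: d. Qed.
Lemma ReN c : Re (- c) = - Re c. Proof. by case: c. Qed.
Lemma ImN c : Im (- c) = - Im c. Proof. by case: c. Qed.
Lemma ReM c d : Re (c * d) = Re c * Re d - Im c * Im d.
Proof. by case: c; case: d. Qed.
Lemma ImM c d : Im (c * d) = Re c * Im d + Im c * Re d.
Proof. by case: c => ? ?; case: d. Qed.
Lemma ReC r : Re (real_complex R r) = r. Proof. by []. Qed.
Lemma ImC r : Im (real_complex R r) = 0. Proof. by []. Qed.
Lemma Re1 : Re (1 : R[i]) = 1. Proof. by []. Qed.
Lemma Im1 : Im (1 : R[i]) = 0. Proof. by []. Qed.
Lemma complex_ext c d : Re c = Re d -> Im c = Im d -> c = d.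
Proof. by case: c => a b; case: d => e f /= -> ->. Qed.
Definition partsE := (ReD, ImD, ReN, ImN, ReM, ImM, ReC, ImC, Re1, Im1).
End ComplexParts.

Section ComplexDerivative.
Variables (R : realType) (L : R).
Hypothesis L0 : 0 < L.
Local Notation mu := (@lebesgue_measure R).
Local Notation hd := (has_derivR L).
Implicit Types f g : R -> R[i].

Lemma dR_spec (f : R -> R) : H1R L f -> hd f (dR L f).
Proof.
move=> H; rewrite /dR; case: xgetP => [g _ []//|_].
exact: (xgetPex _ H).
Qed.

Lemma dC_spec f : H1C L f -> has_derivC L f (dC L f).
Proof.
move=> H; rewrite /dC; case: xgetP => [g _ []//|_].
exact: (xgetPex _ H).
Qed.

Lemma dC_cont f : (exists g, has_derivC L f g /\ contC L g) -> contC L (dC L f).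
Proof.
move=> H; rewrite /dC.
by have [] := @xgetPex _ (xget (fun=> 0) (has_derivC L f))
  (fun g => has_derivC L f g /\ contC L g) H.
Qed.

(** [dC] prefers a continuous derivative, so it coincides everywhere on [[0, L]] with any continuous
    derivative that is exhibited. *)
Lemma dC_eq f (gr gi : R -> R) : hd (fun x => Re (f x)) gr ->
  hd (fun x => Im (f x)) gi -> contR L gr -> contR L gi ->
  [/\ H1C L f, contC L (dC L f) &
   forall x, 0 <= x <= L -> Re (dC L f x) = gr x /\ Im (dC L f x) = gi x].
Proof.
move=> hr hi cr ci.
have H1 : H1C L f by exists (fun x => Complex (gr x) (gi x)); split.
have [dr di] := dC_spec H1.
have [ccr cci] : contC L (dC L f).
  by apply: dC_cont; exists (fun x => Complex (gr x) (gi x)); split; split.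
split=> // x x0; split.
  exact: (cont_deriv_uniq L0 dr hr ccr cr).
exact: (cont_deriv_uniq L0 di hi cci ci).
Qed.

Lemma H1C_of f g (gr gi : R -> R) : hd (fun x => Re (g x)) gr ->
  hd (fun x => Im (g x)) gi ->
  (forall x, 0 <= x <= L -> Re (f x) = Re (g x) /\ Im (f x) = Im (g x)) -> H1C L f.
Proof.
move=> hr hi fg; exists (fun x => Complex (gr x) (gi x)); split => /=.
  by apply: (derivR_ext L0 _ hr) => x /fg[].
by apply: (derivR_ext L0 _ hi) => x /fg[].
Qed.

Lemma H2C_of f (gr gi hr hi : R -> R) : hd (fun x => Re (f x)) gr ->
  hd (fun x => Im (f x)) gi -> hd gr hr -> hd gi hi -> H2C L f.
Proof.
move=> fr fi gr' gi'.
have [H1 _ E] := dC_eq fr fi (derivR_cont L0 gr') (derivR_cont L0 gi').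
split=> //; apply: (@H1C_of _ (fun x => Complex (gr x) (gi x)) hr hi) => //.
Qed.

Definition jet_re (w v : R -> R[i]) := Jet (fun x => Re (w x))
  (fun x => Re (dC L w x)) (fun x => Re (dC L (dC L w) x)) (fun x => Re (v x))
  (fun x => Re (dC L v x)).
Definition jet_im (w v : R -> R[i]) := Jet (fun x => Im (w x))
  (fun x => Im (dC L w x)) (fun x => Im (dC L (dC L w) x)) (fun x => Im (v x))
  (fun x => Im (dC L v x)).

Lemma jets_ok w v : H2C L w -> H1C L v ->
  isjet L (jet_re w v) /\ isjet L (jet_im w v).
Proof.
move=> [/dC_spec[h1 h2] /dC_spec[h3 h4]] /dC_spec[h5 h6].
by split; split.
Qed.

Lemma sqL2E f : L2r L (fun x => Re (f x)) -> L2r L (fun x => Im (f x)) ->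
  sqL2 L f = L2dot L (fun x => Re (f x)) (fun x => Re (f x)) +
    L2dot L (fun x => Im (f x)) (fun x => Im (f x)).
Proof.
move=> Lr Li; rewrite /L2dot -RintegralD; first by [].
- exact: measurable_itv0.
- exact: L2_int.
- exact: L2_int.
Qed.

Lemma normH_sqr z : inH L z -> normH L z ^+ 2 =
  jet_norm L (jet_re (sw z) (sv z)) + jet_norm L (jet_im (sw z) (sv z)).
Proof.
move=> [Hw Hv xiE psiE].
have [[h1 h2 h3] [h4 h5 h6]] := jets_ok Hw Hv.
have E : normH2sq L (sw z) + normH1sq L (sv z) + cabs2 (sxi z) + cabs2 (spsi z) =
    jet_norm L (jet_re (sw z) (sv z)) + jet_norm L (jet_im (sw z) (sv z)).
  rewrite /normH2sq /normH1sq (sqL2E (f := sw z) (derivR_fL2 L0 h1) (derivR_fL2 L0 h4)).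
  rewrite (sqL2E (f := dC L (sw z)) h1.1 h4.1).
  rewrite (sqL2E (f := dC L (dC L (sw z))) h2.1 h5.1).
  rewrite (sqL2E (f := sv z) (derivR_fL2 L0 h3) (derivR_fL2 L0 h6)).
  rewrite (sqL2E (f := dC L (sv z)) h3.1 h6.1).
  by rewrite /jet_norm /= xiE psiE /cabs2; ring.
by rewrite /normH E sqr_sqrtr// addr_ge0// jet_norm_ge0.
Qed.

End ComplexDerivative.

Lemma cvg_right0P (R : realType) (F : R -> R) : (forall h, 0 <= F h) ->
  F h @[h --> 0^'+] --> (0 : R) <->
  (forall e, 0 < e -> exists2 dl : R, 0 < dl & forall h, 0 < h < dl -> F h <= e).
Proof.
move=> F0; split=> [cF e e0|H].
  have /cvgrPdist_le /(_ e e0)[dl /= dl0 Hd] := cF.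
  exists dl => // h /andP[h0 hd].
  have := Hd h; rewrite /= sub0r normrN gtr0_norm// => /(_ hd h0).
  by rewrite sub0r normrN ger0_norm.
apply/cvgrPdist_le => e e0; have [dl dl0 Hd] := H e e0.
exists dl => // h /=; rewrite sub0r normrN => hd h0.
rewrite sub0r normrN ger0_norm//; apply: Hd; rewrite h0/=.
exact: le_lt_trans (ler_norm _) hd.
Qed.

Section Complexification.
Variables (R : realType) (L : R).
Hypothesis L0 : 0 < L.
Local Notation hd := (has_derivR L).
Local Notation X := (energy_space L).

Let i0 : 0 <= (0 : R) <= L. Proof. by rewrite lexx ltW. Qed.
Let iL : 0 <= L <= L. Proof. by rewrite lexx ltW. Qed.

(** The default value 0 is taken when the pair lacks the required derivatives; parts of elements of
    H always have them. *)
Definition toX (w v : R -> R) : X := xget 0 [set y : X | forall x, 0 <= x <= L ->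
  (wv y).1 x = w x /\ (wv y).2 x = v x].

Lemma toX_uniq w v (y : X) : (forall x, 0 <= x <= L ->
  (wv y).1 x = w x /\ (wv y).2 x = v x) -> toX w v = y.
Proof.
move=> H; have := @xgetPex _ 0 [set y : X | forall x, 0 <= x <= L ->
  (wv y).1 x = w x /\ (wv y).2 x = v x] (ex_intro _ y H).
rewrite -/(toX w v) /= => H'; apply: energy_space_ext => x x0.
by have [-> ->] := H x x0; exact: H'.
Qed.

Definition reX (z : state R) := toX (fun x => Re (sw z x)) (fun x => Re (sv z x)).
Definition imX (z : state R) := toX (fun x => Im (sw z x)) (fun x => Im (sv z x)).

Definition stateX (x y : X) : state R :=
  St (fun t => Complex ((wv x).1 t) ((wv y).1 t))
     (fun t => Complex ((wv x).2 t) ((wv y).2 t))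
     (Complex ((wv x).2 L) ((wv y).2 L)) (Complex ((wv x).2 0) ((wv y).2 0)).

Lemma reX_stateX x y : reX (stateX x y) = x. Proof. exact: toX_uniq. Qed.
Lemma imX_stateX x y : imX (stateX x y) = y. Proof. exact: toX_uniq. Qed.

Lemma inH_reXP z : inH L z -> forall x, 0 <= x <= L ->
  (wv (reX z)).1 x = Re (sw z x) /\ (wv (reX z)).2 x = Re (sv z x).
Proof.
move=> [Hw Hv _ _]; have [jo _] := jets_ok Hw Hv.
by have [y Hy] := energy_space_of_jet L0 jo; rewrite /reX (toX_uniq Hy).
Qed.

Lemma inH_imXP z : inH L z -> forall x, 0 <= x <= L ->
  (wv (imX z)).1 x = Im (sw z x) /\ (wv (imX z)).2 x = Im (sv z x).
Proof.
move=> [Hw Hv _ _]; have [_ jo] := jets_ok Hw Hv.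
by have [y Hy] := energy_space_of_jet L0 jo; rewrite /imX (toX_uniq Hy).
Qed.

Lemma inH_of z (jr ji : jet R) : isjet L jr -> isjet L ji ->
  (forall x, 0 <= x <= L -> jw jr x = Re (sw z x) /\ jv jr x = Re (sv z x)) ->
  (forall x, 0 <= x <= L -> jw ji x = Im (sw z x) /\ jv ji x = Im (sv z x)) ->
  sxi z = sv z L -> spsi z = sv z 0 -> inH L z.
Proof.
move=> [r1 r2 r3] [h1 h2 h3] er ei xiE psiE; split=> //.
  apply: (H2C_of L0 (derivR_ext L0 _ r1) (derivR_ext L0 _ h1) r2 h2).
    by move=> x /er[].
  by move=> x /ei[].
apply: (@H1C_of _ _ L0 _ (fun x => Complex (jv jr x) (jv ji x)) _ _ r3 h3).
by move=> x x0; rewrite -(er x x0).2 -(ei x x0).2.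
Qed.

Lemma inH_stateX x y : inH L (stateX x y).
Proof.
have [jx x1 x2] := jetofP x; have [jy y1 y2] := jetofP y.
apply: (inH_of jx jy) => // t t0 /=; first by rewrite x1 x2.
by rewrite y1 y2.
Qed.

Lemma eqH_stateX z : inH L z -> eqH L (stateX (reX z) (imX z)) z.
Proof.
move=> Hz; have Er := inH_reXP Hz; have Ei := inH_imXP Hz; have [_ _ xiE psiE] := Hz.
split=> /= [x x0|x x0| |].
- by apply: complex_ext => /=; [rewrite (Er x x0).1|rewrite (Ei x x0).1].
- by apply: complex_ext => /=; [rewrite (Er x x0).2|rewrite (Ei x x0).2].
- by rewrite xiE; apply: complex_ext => /=; [rewrite (Er L iL).2|rewrite (Ei L iL).2].
- by rewrite psiE; apply: complex_ext => /=; [rewrite (Er 0 i0).2|rewrite (Ei 0 i0).2].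
Qed.

Lemma reX_lin c z1 z2 : inH L z1 -> inH L z2 ->
  reX (sadd (sscale c z1) z2) = Re c *: reX z1 + ((- Im c) *: imX z1 + reX z2).
Proof.
move=> H1 H2; apply: toX_uniq => x x0.
rewrite wv1_lin wv1_lin wv2_lin wv2_lin /= !partsE.
rewrite (inH_reXP H1 x0).1 (inH_reXP H1 x0).2 (inH_reXP H2 x0).1 (inH_reXP H2 x0).2.
rewrite (inH_imXP H1 x0).1 (inH_imXP H1 x0).2.
by split; ring.
Qed.

Lemma imX_lin c z1 z2 : inH L z1 -> inH L z2 ->
  imX (sadd (sscale c z1) z2) = Re c *: imX z1 + (Im c *: reX z1 + imX z2).
Proof.
move=> H1 H2; apply: toX_uniq => x x0.
rewrite wv1_lin wv1_lin wv2_lin wv2_lin /= !partsE.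
rewrite (inH_reXP H1 x0).1 (inH_reXP H1 x0).2.
rewrite (inH_imXP H2 x0).1 (inH_imXP H2 x0).2.
rewrite (inH_imXP H1 x0).1 (inH_imXP H1 x0).2.
by split; ring.
Qed.

Lemma inH_lin c z1 z2 : inH L z1 -> inH L z2 -> inH L (sadd (sscale c z1) z2).
Proof.
move=> H1 H2.
have [jx x1 x2] := jetofP (reX (sadd (sscale c z1) z2)).
have [jy y1 y2] := jetofP (imX (sadd (sscale c z1) z2)).
have [_ _ xi1 psi1] := H1; have [_ _ xi2 psi2] := H2.
apply: (inH_of jx jy) => /=; [| |by rewrite xi1 xi2|by rewrite psi1 psi2].
- move=> x x0; rewrite x1 x2 reX_lin// wv1_lin wv1_lin wv2_lin wv2_lin !partsE.
  rewrite (inH_reXP H1 x0).1 (inH_reXP H1 x0).2 (inH_reXP H2 x0).1 (inH_reXP H2 x0).2.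
  rewrite (inH_imXP H1 x0).1 (inH_imXP H1 x0).2.
  by split; ring.
move=> x x0; rewrite y1 y2 imX_lin// wv1_lin wv1_lin wv2_lin wv2_lin !partsE.
rewrite (inH_reXP H1 x0).1 (inH_reXP H1 x0).2.
rewrite (inH_imXP H2 x0).1 (inH_imXP H2 x0).2.
rewrite (inH_imXP H1 x0).1 (inH_imXP H1 x0).2.
by split; ring.
Qed.

Lemma reX_eqH z1 z2 : inH L z1 -> eqH L z1 z2 -> reX z1 = reX z2.
Proof.
move=> H1 [e1 e2 _ _]; apply/esym/toX_uniq => x x0.
by rewrite (inH_reXP H1 x0).1 (inH_reXP H1 x0).2 e1// e2.
Qed.

Lemma imX_eqH z1 z2 : inH L z1 -> eqH L z1 z2 -> imX z1 = imX z2.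
Proof.
move=> H1 [e1 e2 _ _]; apply/esym/toX_uniq => x x0.
by rewrite (inH_imXP H1 x0).1 (inH_imXP H1 x0).2 e1// e2.
Qed.

End Complexification.

Section StateOperations.
Variables (R : realType) (L : R).
Hypothesis L0 : 0 < L.
Local Notation hd := (has_derivR L).
Local Notation X := (energy_space L).
Local Notation reX := (@reX R L).
Local Notation imX := (@imX R L).

Lemma ssubE (z1 z2 : state R) : ssub z1 z2 = sadd (sscale (-1) z2) z1.
Proof.
by rewrite /ssub /sadd /=; congr St; try apply/funext => x; rewrite addrC.
Qed.

Lemma inH_sub (z1 z2 : state R) : inH L z1 -> inH L z2 -> inH L (ssub z1 z2).
Proof. by move=> H1 H2; rewrite ssubE; exact: inH_lin. Qed.

Lemma reXB z1 z2 : inH L z1 -> inH L z2 -> reX (ssub z1 z2) = reX z1 - reX z2.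
Proof.
move=> H1 H2; rewrite ssubE reX_lin// ReN Re1 ImN Im1 oppr0 oppr0 scale0r add0r.
by rewrite scaleN1r addrC.
Qed.

Lemma imXB z1 z2 : inH L z1 -> inH L z2 -> imX (ssub z1 z2) = imX z1 - imX z2.
Proof.
move=> H1 H2; rewrite ssubE imX_lin// ReN Re1 ImN Im1 oppr0 scale0r add0r.
by rewrite scaleN1r addrC.
Qed.

Lemma sscaleE c (z : state R) : sscale c z = sadd (sscale c z) (@stateX R L 0 0).
Proof.
by rewrite /sadd /=; case: z => w v xi psi; congr St; try apply/funext => x;
  rewrite /= addr0.
Qed.

Lemma inH_scale c (z : state R) : inH L z -> inH L (sscale c z).
Proof. by move=> H; rewrite sscaleE; apply: inH_lin => //; exact: inH_stateX. Qed.

Lemma reXZ (r : R) z : inH L z -> reX (sscale (real_complex R r) z) = r *: reX z.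
Proof.
move=> H; rewrite sscaleE reX_lin//; last exact: inH_stateX.
by rewrite reX_stateX ReC ImC oppr0 scale0r !addr0.
Qed.

Lemma imXZ (r : R) z : inH L z -> imX (sscale (real_complex R r) z) = r *: imX z.
Proof.
move=> H; rewrite sscaleE imX_lin//; last exact: inH_stateX.
by rewrite imX_stateX ReC ImC scale0r !addr0.
Qed.

End StateOperations.

Section Domain.
Variables (R : realType) (L : R).
Hypothesis L0 : 0 < L.
Local Notation hd := (has_derivR L).
Local Notation X := (energy_space L).
Local Notation reX := (@reX R L).
Local Notation imX := (@imX R L).
Variables (P P2 : R -> R).
Hypothesis HP : hd P (dR L P).
Hypothesis HP1 : hd (dR L P) P2.
Variables (th1 th2 th3 th4 : R).
Local Notation rel := (crane_rel P (dR L P) th1 th2 th3 th4).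
Local Notation DA := (inDA L P th1 th2 th3 th4).
Local Notation opA := (opA L P th1 th2 th3 th4).

Let i0 : 0 <= (0 : R) <= L. Proof. by rewrite lexx ltW. Qed.
Let iL : 0 <= L <= L. Proof. by rewrite lexx ltW. Qed.

Lemma inDA_inH z : DA z -> inH L z.
Proof. by move=> [[H2 _] [H1 _] xiE psiE _]. Qed.

Lemma Re_flux w x : Re (flux L P w x) =
  dR L P x * Re (dC L w x) + P x * Re (dC L (dC L w) x).
Proof. by rewrite /flux !partsE; ring. Qed.

Lemma Im_flux w x : Im (flux L P w x) =
  dR L P x * Im (dC L w x) + P x * Im (dC L (dC L w) x).
Proof. by rewrite /flux !partsE; ring. Qed.

Lemma inDA_crane_jets z : DA z ->
  crane_jet L P (dR L P) th1 th2 th3 th4 (jet_re L (sw z) (sv z)) /\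
  crane_jet L P (dR L P) th1 th2 th3 th4 (jet_im L (sw z) (sv z)).
Proof.
move=> [[H2w H3w] [H1v H2v] _ _ [bL b00]].
have [jr ji] := jets_ok H2w H1v.
have [[g3 [g3r g3i]] [g2 [g2r g2i]]] := (H3w, H2v).
split; split=> //.
- by eexists; exact: g3r.
- by eexists; exact: g2r.
- by rewrite /jet_flux /= -Re_flux bL ReN.
- by rewrite /jet_flux /= -Re_flux b00 /Fb /bc0 /= !partsE; ring.
- by eexists; exact: g3i.
- by eexists; exact: g2i.
- by rewrite /jet_flux /= -Im_flux bL ImN.
- by rewrite /jet_flux /= -Im_flux b00 /Fb /bc0 /= !partsE; ring.
Qed.

Lemma inDA_rel z : DA z ->
  [/\ inH L (opA z), rel (reX z) (reX (opA z)) & rel (imX z) (imX (opA z))].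
Proof.
move=> Dz; have Hz := inDA_inH Dz; have [cr ci] := inDA_crane_jets Dz.
have HA : inH L (opA z).
  have [v2r [g1r [jr _]]] := isjet_image L0 HP HP1 cr.
  have [v2i [g1i [ji _]]] := isjet_image L0 HP HP1 ci.
  have [_ _ xiE psiE [bL b00]] := Dz.
  apply: (inH_of L0 jr ji) => /=; [| |by rewrite bL|by rewrite b00].
  - by move=> x x0; rewrite Re_flux.
  - by move=> x x0; rewrite Im_flux.
split=> //.
- exists (jet_re L (sw z) (sv z)); split=> //.
    by move=> x x0; rewrite (inH_reXP L0 Hz x0).1 (inH_reXP L0 Hz x0).2.
  move=> x x0; rewrite (inH_reXP L0 HA x0).1 (inH_reXP L0 HA x0).2 /=.
  by rewrite Re_flux.
- exists (jet_im L (sw z) (sv z)); split=> //.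
    by move=> x x0; rewrite (inH_imXP L0 Hz x0).1 (inH_imXP L0 Hz x0).2.
  move=> x x0; rewrite (inH_imXP L0 HA x0).1 (inH_imXP L0 HA x0).2 /=.
  by rewrite Im_flux.
Qed.

(** The two relations supply some jets; [dC_eq] identifies them with the chosen [w'], [w''] and [v']
    at every point, which transfers both the regularity and the boundary conditions. *)
Lemma rel_inDA z y : inH L z -> rel (reX z) (reX y) -> rel (imX z) (imX y) -> DA z.
Proof.
move=> Hz [jr [[jro [w3r h1r] [v2r h2r] bLr b0r] reXE _]].
move=> [ji [[jio [w3i h1i] [v2i h2i] bLi b0i] imXE _]].
have [r1 r2 r3] := jro; have [s1 s2 s3] := jio.
have [H2w H1v xiE psiE] := Hz.
have Ewr x : 0 <= x <= L -> jw jr x = Re (sw z x).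
  by move=> x0; rewrite (reXE x x0).1 (inH_reXP L0 Hz x0).1.
have Evr x : 0 <= x <= L -> jv jr x = Re (sv z x).
  by move=> x0; rewrite (reXE x x0).2 (inH_reXP L0 Hz x0).2.
have Ewi x : 0 <= x <= L -> jw ji x = Im (sw z x).
  by move=> x0; rewrite (imXE x x0).1 (inH_imXP L0 Hz x0).1.
have Evi x : 0 <= x <= L -> jv ji x = Im (sv z x).
  by move=> x0; rewrite (imXE x x0).2 (inH_imXP L0 Hz x0).2.
have [_ _ E1] := dC_eq L0 (derivR_ext L0 Ewr r1) (derivR_ext L0 Ewi s1)
  (derivR_cont L0 r2) (derivR_cont L0 s2).
have r2' : hd (fun x => Re (dC L (sw z) x)) (jw2 jr).
  by apply: (derivR_ext L0 _ r2) => x /E1[].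
have s2' : hd (fun x => Im (dC L (sw z) x)) (jw2 ji).
  by apply: (derivR_ext L0 _ s2) => x /E1[].
have [H1w1 _ E2] := dC_eq L0 r2' s2' (derivR_cont L0 h1r) (derivR_cont L0 h1i).
have [_ _ Ev] := dC_eq L0 (derivR_ext L0 Evr r3) (derivR_ext L0 Evi s3)
  (derivR_cont L0 h2r) (derivR_cont L0 h2i).
have Hr : forall x, 0 <= x <= L -> Re (flux L P (sw z) x) = jet_flux P (dR L P) jr x.
  by move=> x x0; rewrite Re_flux (E1 x x0).1 (E2 x x0).1.
have Hi : forall x, 0 <= x <= L -> Im (flux L P (sw z) x) = jet_flux P (dR L P) ji x.
  by move=> x x0; rewrite Im_flux (E1 x x0).2 (E2 x x0).2.
split=> //.
- split=> //.
  by apply: (@H1C_of _ _ L0 _ (fun x => Complex (jw2 jr x) (jw2 ji x)) _ _ h1r h1i).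
- exact: (H2C_of L0 (derivR_ext L0 Evr r3) (derivR_ext L0 Evi s3) h2r h2i).
split; apply: complex_ext.
- by rewrite Hr// bLr ReN (E1 L iL).1.
- by rewrite Hi// bLi ImN (E1 L iL).2.
- rewrite Hr// b0r /bc0 /Fb !partsE (E1 0 i0).1 (Ev 0 i0).1 -Ewr// -Evr//.
  ring.
- rewrite Hi// b0i /bc0 /Fb !partsE (E1 0 i0).2 (Ev 0 i0).2 -Ewi// -Evi//.
  ring.
Qed.

End Domain.

(** * Equivalence of the energy with the norm of H *)

Section NormEquivalence.
Variables (R : realType) (L : R).
Hypothesis L0 : 0 < L.
Local Notation hd := (has_derivR L).
Local Notation X := (energy_space L).
Local Notation reX := (@reX R L).
Local Notation imX := (@imX R L).
Variables (P P1 P2 : R -> R) (P0 : R).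
Hypothesis HP : hd P P1.
Hypothesis HP1 : hd P1 P2.
Hypothesis P00 : 0 < P0.
Hypothesis P0P : forall x, 0 <= x <= L -> P0 <= P x.
Variables (b c0 kap : R).
Hypothesis b0 : 0 < b.
Hypothesis c00 : 0 < c0.
Hypothesis kap0 : 0 < kap.
Local Notation N := (ipnorm (energy_form P P1 b c0 kap)).

Definition energy_sqr (z : state R) := N (reX z) ^+ 2 + N (imX z) ^+ 2.

Lemma energy_sqrE z : inH L z ->
  energy_sqr z =
    jet_form L P P1 b c0 kap (jet_re L (sw z) (sv z)) (jet_re L (sw z) (sv z))
    + jet_form L P P1 b c0 kap (jet_im L (sw z) (sv z)) (jet_im L (sw z) (sv z)).
Proof.
move=> Hz; have [Hw Hv _ _] := Hz; have [jr ji] := jets_ok Hw Hv.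
rewrite /energy_sqr !(energy_norm_sqr L0 HP P00 P0P b c00 kap0).
have er x : 0 <= x <= L -> jw (jet_re L (sw z) (sv z)) x = (wv (reX z)).1 x /\
    jv (jet_re L (sw z) (sv z)) x = (wv (reX z)).2 x.
  by move=> x0; rewrite (inH_reXP L0 Hz x0).1 (inH_reXP L0 Hz x0).2.
have ei x : 0 <= x <= L -> jw (jet_im L (sw z) (sv z)) x = (wv (imX z)).1 x /\
    jv (jet_im L (sw z) (sv z)) x = (wv (imX z)).2 x.
  by move=> x0; rewrite (inH_imXP L0 Hz x0).1 (inH_imXP L0 Hz x0).2.
rewrite (energy_form_jets L0 HP HP1 b c0 kap jr jr er er).
by rewrite (energy_form_jets L0 HP HP1 b c0 kap ji ji ei ei).
Qed.

Lemma normH_le_energy : exists2 C, 0 <= C &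
  forall z, inH L z -> normH L z ^+ 2 <= C * energy_sqr z.
Proof.
have [C C0 HC] := N_le_E L0 HP HP1 P00 P0P b0 c00 kap0; exists C => // z Hz.
have [Hw Hv _ _] := Hz; have [jr ji] := jets_ok Hw Hv.
by rewrite normH_sqr// energy_sqrE// mulrDr; apply: lerD; exact: HC.
Qed.

Lemma energy_le_normH : exists2 C, 0 <= C &
  forall z, inH L z -> energy_sqr z <= C * normH L z ^+ 2.
Proof.
have [C C0 HC] := E_le_N L0 HP HP1 P00 P0P b c00 kap0; exists C => // z Hz.
have [Hw Hv _ _] := Hz; have [jr ji] := jets_ok Hw Hv.
by rewrite normH_sqr// energy_sqrE// mulrDr; apply: lerD; exact: HC.
Qed.

Lemma normH_ge0 z : 0 <= normH L z. Proof. exact: sqrtr_ge0. Qed.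

Lemma normH_cvg0 (F : R -> state R) : (forall h, 0 < h -> inH L (F h)) ->
  normH L (F h) @[h --> 0^'+] --> (0 : R) <->
  (forall e, 0 < e -> exists2 dl : R, 0 < dl &
    forall h, 0 < h < dl -> N (reX (F h)) <= e) /\
  (forall e, 0 < e -> exists2 dl : R, 0 < dl &
    forall h, 0 < h < dl -> N (imX (F h)) <= e).
Proof.
move=> HF; rewrite cvg_right0P; last by move=> h; exact: normH_ge0.
have [C C0 HC] := normH_le_energy; have [C' C'0 HC'] := energy_le_normH.
have N0 x : 0 <= N x by exact: sqrtr_ge0.
have sqr_mono (x y : R) : 0 <= x -> x <= y -> x ^+ 2 <= y ^+ 2 by nra.
split=> [H|[Hr Hi] e e0].
  have key e : 0 < e -> exists2 dl : R, 0 < dl & forall h, 0 < h < dl ->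
      energy_sqr (F h) <= e ^+ 2.
    move=> e0; have C1 : 0 < C' + 1 by lra.
    have [dl dl0 Hd] := H (e / (C' + 1)) ltac:(by rewrite divr_gt0).
    exists dl => // h /[dup] hd /andP[h0 _]; apply: le_trans (HC' _ (HF h h0)) _.
    have := Hd h hd; rewrite ler_pdivlMr// => h1.
    have n0 := normH_ge0 (F h).
    have : (normH L (F h) * (C' + 1)) ^+ 2 <= e ^+ 2.
      by apply: sqr_mono => //; apply: mulr_ge0 => //; exact: ltW.
    apply: le_trans; rewrite exprMn mulrC; apply: ler_wpM2l; first exact: sqr_ge0.
    nra.
  split=> e e0; have [dl dl0 Hd] := key e e0; exists dl => // h /Hd h1;
    rewrite -(@ler_pXn2r _ 2) ?nnegrE ?(ltW e0)//; apply: le_trans h1;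
    rewrite /energy_sqr ?lerDl ?lerDr; exact: sqr_ge0.
(* Both parts are made smaller than [e / (2 C + 1)]; then [2 C <= (2 C + 1)^2] bounds the square of
   the norm by [e^2] without a square root of [C]. *)
have C1 : 0 < 2 * C + 1 by lra.
have [d1 d10 H1] := Hr (e / (2 * C + 1)) ltac:(by rewrite divr_gt0).
have [d2 d20 H2] := Hi (e / (2 * C + 1)) ltac:(by rewrite divr_gt0).
exists (Num.min d1 d2); first by rewrite lt_min d10.
move=> h; rewrite lt_min => /andP[h0 /andP[hd1 hd2]].
rewrite -(@ler_pXn2r _ 2) ?nnegrE ?normH_ge0//; last exact: ltW.
apply: le_trans (HC _ (HF h h0)) _.
have := H1 h; rewrite h0 hd1 => /(_ isT); rewrite ler_pdivlMr// => h1.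
have := H2 h; rewrite h0 hd2 => /(_ isT); rewrite ler_pdivlMr// => h2.
have s1 : (N (reX (F h)) * (2 * C + 1)) ^+ 2 <= e ^+ 2.
  by apply: sqr_mono => //; apply: mulr_ge0 => //; exact: ltW.
have s2 : (N (imX (F h)) * (2 * C + 1)) ^+ 2 <= e ^+ 2.
  by apply: sqr_mono => //; apply: mulr_ge0 => //; exact: ltW.
rewrite !exprMn in s1 s2; rewrite /energy_sqr.
move: s1 s2 (sqr_ge0 (N (reX (F h)))) (sqr_ge0 (N (imX (F h)))) (sqr_ge0 e).
move: (N (reX (F h)) ^+ 2) (N (imX (F h)) ^+ 2) (e ^+ 2) => p q E s1 s2 p0 q0 E0.
have sq : 2 * C <= (2 * C + 1) ^+ 2 by nra.
have := ler_wpM2l p0 sq; have := ler_wpM2l q0 sq; lra.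
Qed.

End NormEquivalence.

(** * The complex semigroup *)

Theorem theorem2p2 (R : realType) (L : R) (P : R -> R) (P0 : R)
    (th1 th2 th3 th4 a b : R) :
  0 < L ->
  H2R L P ->
  0 < P0 -> (forall x, 0 <= x <= L -> P0 <= P x) ->
  0 < a -> 0 < b -> (a + b - 1) ^+ 2 < 4 * a * b ->
  th1 = th3 / b - a -> th2 = th4 / b ->
  th1 < 0 -> th3 < 0 -> 0 < th2 -> 0 < th4 ->
  exists T : R -> state R -> state R,
    generates_ub_C0_semigroup L (inDA L P th1 th2 th3 th4)
      (opA L P th1 th2 th3 th4) T.
Proof.
move=> L0 [/dR_spec HP [P2 HP1]] P00 P0P a0 b0 _ th1E th2E _ th30 _ th40.
have [Tr [lin contr [T0 TD] cont gen]] :=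
  crane_semigroup L0 HP HP1 P00 P0P a0 b0 th1E th2E th30 th40.
set c0 := P 0 * (- th3 / th4) in contr cont gen.
set kap := P 0 * (b / th4) * (a + b) in contr cont gen.
have PO : 0 < P 0 by apply: lt_le_trans (P0P 0 _) => //; rewrite lexx ltW.
have c00 : 0 < c0 by rewrite mulr_gt0// divr_gt0// oppr_gt0.
have kap0 : 0 < kap by rewrite !mulr_gt0// ?invr_gt0// addr_gt0.
have cvg0 := normH_cvg0 L0 HP HP1 P00 P0P b0 c00 kap0.
have [C C0 HC] := normH_le_energy L0 HP HP1 P00 P0P b0 c00 kap0.
have [C' C'0 HC'] := energy_le_normH L0 HP HP1 P00 P0P b c00 kap0.
(* The coefficients are real, so the real semigroup acts on each part separately; rebuilding the
   state fills in the traces [xi] and [psi]. *)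
pose T t z := stateX (Tr t (reX L z)) (Tr t (imX L z)).
have inT t z : inH L (T t z) by exact: inH_stateX.
have reXT t z : reX L (T t z) = Tr t (reX L z) by exact: reX_stateX.
have imXT t z : imX L (T t z) = Tr t (imX L z) by exact: imX_stateX.
have inQ h z : inH L z -> inH L (dquot T z h).
  by move=> Hz; apply: inH_scale => //; exact: inH_sub.
have reXQ h z y : inH L z -> inH L y -> reX L (ssub (dquot T z h) y) =
    h^-1 *: (Tr h (reX L z) - reX L z) - reX L y.
  by move=> Hz Hy; rewrite reXB ?reXZ ?reXB ?reXT//; [exact: inH_sub|exact: inQ].
have imXQ h z y : inH L z -> inH L y -> imX L (ssub (dquot T z h) y) =
    h^-1 *: (Tr h (imX L z) - imX L z) - imX L y.
  by move=> Hz Hy; rewrite imXB ?imXZ ?imXB ?imXT//; [exact: inH_sub|exact: inQ].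
have genT z y : inH L z -> inH L y ->
    normH L (ssub (dquot T z h) y) @[h --> 0^'+] --> (0 : R) <->
    crane_rel P (dR L P) th1 th2 th3 th4 (reX L z) (reX L y) /\
    crane_rel P (dR L P) th1 th2 th3 th4 (imX L z) (imX L y).
  move=> Hz Hy; rewrite cvg0; last by move=> h _; apply: inH_sub => //; exact: inQ.
  rewrite -!gen; split=> -[H1 H2]; split=> e e0.
  - by have [dl dl0 Hd] := H1 e e0; exists dl => // h /Hd; rewrite reXQ.
  - by have [dl dl0 Hd] := H2 e e0; exists dl => // h /Hd; rewrite imXQ.
  - by have [dl dl0 Hd] := H1 e e0; exists dl => // h /Hd; rewrite reXQ.
  - by have [dl dl0 Hd] := H2 e e0; exists dl => // h /Hd; rewrite imXQ.
exists T; split; first by move=> *; exact: inT.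
split.
  by move=> t z1 z2 _ H1 _ E; rewrite /T (reX_eqH L0 H1 E) (imX_eqH L0 H1 E).
split.
  move=> t c z1 z2 t0 H1 H2; rewrite /T reX_lin// imX_lin// !lin//.
  by split=> [x x0|x x0| |]; apply: complex_ext;
    rewrite /= !partsE /= ?(addrfctE, scalrfctE) /GRing.scale /=; ring.
split.
  (* The squared norms compare with the factor [C * C'], which is at most [(C * C' + 1)^2]. *)
  exists (C * C' + 1) => t z t0 Hz; have CC : 0 <= C * C' by exact: mulr_ge0.
  have n0 := normH_ge0 L z.
  rewrite -(@ler_pXn2r _ 2) ?nnegrE ?normH_ge0 ?mulr_ge0 ?addr_ge0//.
  apply: le_trans (HC _ (inT t z)) _.
  apply: (@le_trans _ _ (C * energy_sqr L P (dR L P) b c0 kap z)).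
    apply: ler_wpM2l => //; rewrite /energy_sqr reXT imXT.
    by apply: lerD; rewrite ler_pXn2r ?nnegrE ?ipnorm_ge0//; exact: contr.
  apply: le_trans (ler_wpM2l C0 (HC' _ Hz)) _.
  rewrite mulrA exprMn; apply: ler_wpM2r; first exact: sqr_ge0.
  nra.
split; first by move=> z Hz; rewrite /T !T0; exact: eqH_stateX.
split; first by move=> t s z t0 s0 Hz; rewrite /T !TD// reX_stateX imX_stateX.
split.
  move=> z Hz; apply/cvg0; first by move=> h _; exact: inH_sub.
  split=> e e0.
    have [dl dl0 Hd] := cont (reX L z) e e0; exists dl => // h /andP[h0 hd].
    by rewrite reXB// reXT; apply: Hd; rewrite !ltW.
  have [dl dl0 Hd] := cont (imX L z) e e0; exists dl => // h /andP[h0 hd].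
  by rewrite imXB// imXT; apply: Hd; rewrite !ltW.
split.
  move=> z Hz; split=> [[y [Hy /(genT _ _ Hz Hy)[g1 g2]]]|Dz].
    exact: (rel_inDA L0 Hz g1 g2).
  have [HA g1 g2] := inDA_rel L0 HP HP1 Dz.
  by exists (opA L P th1 th2 th3 th4 z); split=> //; apply/genT.
move=> z Dz; have [HA g1 g2] := inDA_rel L0 HP HP1 Dz.
by apply/genT => //; exact: inDA_inH Dz.
Qed.
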